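(* Let $d\ge 2$ and let $\Omega\subset\mathbb{R}^d$ be a bounded, connected, open set with boundary $\Gamma$, let $\sigma$ be the $(d-1)$-dimensional Hausdorff measure on $\Gamma$, and assume $\sigma(\Gamma)<\infty$. Let $D_0$ be the Dirichlet-to-Neumann operator on $L_2(\Gamma)$ and let $S=(S_t)_{t>0}$ be the $C_0$-semigroup on $L_2(\Gamma)$ generated by $-D_0$. Define $P\colon L_2(\Gamma)\to L_2(\Gamma)$ by $P\varphi=\Big(\frac{1}{\sigma(\Gamma)}\int_\Gamma\varphi\,d\sigma\Big)\mathbb{1}_\Gamma$. Then the following are equivalent. (i) The trace on $\Omega$ is unique. (ii) $\dim(\ker D_0)=1$. (iii) $\lim_{t\to\infty}S_t\varphi=P\varphi$ in $L_2(\Gamma)$ for all $\varphi\in L_2(\Gamma)$. (iv) $S$ is irreducible.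
   Context: All spaces are real. $L_2(\Gamma)=L_2(\Gamma,\sigma)$, $H^1(\Omega)$ is the Sobolev space with norm $\|u\|_{H^1(\Omega)}^2=\int_\Omega|u|^2+\int_\Omega|\nabla u|^2$, and $H^1(\Omega)\cap C(\overline\Omega)$ is the set of $u\in C(\overline\Omega)$ whose restriction to $\Omega$ lies in $H^1(\Omega)$. The operator $\Delta$ is the distributional Laplacian on $\Omega$. Trace: for $u\in H^1(\Omega)$, a function $\varphi\in L_2(\Gamma)$ is called a trace of $u$ if there is a sequence $(u_n)_{n\in\mathbb{N}}$ in $H^1(\Omega)\cap C(\overline\Omega)$ with $\lim u_n=u$ in $H^1(\Omega)$ and $\lim u_n|_\Gamma=\varphi$ in $L_2(\Gamma)$. The trace on $\Omega$ is unique if $\varphi=0$ is the only trace of $u=0\in H^1(\Omega)$. Normal derivative: let $u\in H^1(\Omega)$ with $\Delta u\in L_2(\Omega)$. Then $u$ has a normal derivative in $L_2(\Gamma)$ if there is a $\psi\in L_2(\Gamma)$ such that $\int_\Omega(\Delta u)\,v+\int_\Omega\nabla u\cdot\nabla v=\int_\Gamma\psi\,v\,d\sigma$ for all $v\in H^1(\Omega)\cap C(\overline\Omega)$. Such $\psi$ is unique and one writes $\frac{\partial u}{\partial\nu}:=\psi$. Dirichlet-to-Neumann operator: for $\varphi,\psi\in L_2(\Gamma)$ one has $\varphi\in D(D_0)$ and $D_0\varphi=\psi$ if and only if there is a $u\in H^1(\Omega)$ such that $\Delta u=0$, $\varphi$ is a trace of $u$, and $u$ has a normal derivative in $L_2(\Gamma)$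 with $\frac{\partial u}{\partial\nu}=\psi$. This defines a single-valued, positive, self-adjoint operator on $L_2(\Gamma)$, so $-D_0$ generates a $C_0$-semigroup. Irreducibility: $S$ is irreducible if for every measurable $\Gamma_1\subset\Gamma$ with $S_tL_2(\Gamma_1)\subset L_2(\Gamma_1)$ for all $t>0$ one has $\sigma(\Gamma_1)=0$ or $\sigma(\Gamma\setminus\Gamma_1)=0$, where $L_2(\Gamma_1)=\{f\in L_2(\Gamma):f=0\text{ a.e. on }\Gamma\setminus\Gamma_1\}$. *)

(* Defs.v *)
From HB Require Import structures.
From mathcomp Require Import all_boot all_order all_algebra.
From mathcomp Require Import all_classical all_reals all_analysis.
From mathcomp Require Import measurable_realfun.

Set Implicit Arguments.
Unset Strict Implicit.
Unset Printing Implicit Defensive.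

Import Order.TTheory GRing.Theory Num.Theory.
Import numFieldNormedType.Exports.

Local Open Scope classical_set_scope.
Local Open Scope ring_scope.

(* The Borel sigma-algebra on $\mathbb{R}^n$. *)
Section borel_rV.
Context (R : realType) (n : nat).

Fact rV_display : measure_display.
Proof. exact: default_measure_display. Qed.

HB.instance Definition _ := @isMeasurable.Build rV_display 'rV[R]_n <<s open >>
  (@sigma_algebra0 _ setT open) (@sigma_algebraC _ open)
  (@sigma_algebra_bigcup _ setT open).

Lemma measurable_rVE : @measurable _ 'rV[R]_n = <<s open >>.
Proof. by []. Qed.

Lemma open_measurable_rV (A : set 'rV[R]_n) : open A -> measurable A.
Proof. exact: sub_sigma_algebra. Qed.

Lemma closed_measurable_rV (A : set 'rV[R]_n) : closed A -> measurable A.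
Proof.
by move=> cA; rewrite -(setCK A); apply: measurableC;
  apply: open_measurable_rV; exact: closed_openC.
Qed.

Let qrow (q : 'rV[rat]_n) : 'rV[R]_n := \row_j ratr (q ord0 j).

Let open_rV_bigcup_ball (U : set 'rV[R]_n) : open U ->
  U = \bigcup_(q in [set q : 'rV[rat]_n * rat |
         ball (qrow q.1) (ratr q.2 : R) `<=` U]) ball (qrow q.1) (ratr q.2 : R).
Proof.
move=> oU; apply/seteqP; split => [x Ux|x [q + qx]]; last exact.
have /nbhs_ballP [e /= e0 eU] : nbhs x U by exact: open_nbhs_nbhs.
have [r /andP[r0 re]] : exists r : rat, (0 < ratr r :> R) && (ratr r < e / 2).
  have e20 : 0 < e / 2 by rewrite divr_gt0.
  by have [r] := rat_in_itvoo e20; rewrite in_itv/= => rP; exists r.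
have /choice [q qP] : forall j, exists q : rat, `|x ord0 j - ratr q| < ratr r.
  move=> j; have : x ord0 j < x ord0 j + ratr r by rewrite ltrDl.
  move=> /rat_in_itvoo[q]; rewrite in_itv/= => /andP[q1 q2]; exists q.
  by rewrite ltr_distlC q2 andbT (lt_trans _ q1)// ltrBlDr ltrDl.
have xq : ball (qrow (\row_j q j)) (ratr r : R) x.
  by split => // i j; rewrite !mxE !ord1 /ball/= distrC.
exists (\row_j q j, r) => //= y qy; apply: eU.
rewrite (splitr e); apply: (@ball_triangle _ _ (qrow (\row_j q j))).
  by apply: (le_ball (ltW re)); exact/ball_sym/xq.
exact: (le_ball (ltW re)).
Qed.

Lemma measurable_fun_rVP d (T : measurableType d) (f : T -> 'rV[R]_n) :
  (forall i, measurable_fun setT (fun x => f x ord0 i)) ->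
  measurable_fun setT f.
Proof.
move=> mf; apply: (@measurability _ _ _ _ setT f open) => //.
move=> _ [U oU <-]; rewrite setTI (open_rV_bigcup_ball oU).
rewrite bigcup_mkcond preimage_bigcup; apply: countable_bigcupT_measurable.
  exact: countableP.
move=> [q r] /=; case: ifPn => _; last by rewrite preimage_set0.
have [r0|r0] := ltP 0 (ratr r : R); last first.
  rewrite (_ : _ @^-1` _ = set0)// -subset0 => x [] /=.
  by rewrite ltNge r0.
rewrite (_ : _ @^-1` _ = \bigcap_(i in [set: 'I_n])
   ((fun x => f x ord0 i) @^-1` ball (ratr (q ord0 i) : R) (ratr r : R))).
  apply: fin_bigcap_measurable => // i _; rewrite -[X in measurable X]setTI.
  by apply: mf => //; apply: open_measurable; exact: ball_open.
apply/seteqP; split => [x [_ /= fx] i _|x fx].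
  by have := fx ord0 i; rewrite mxE.
by split => // i j; rewrite ord1 mxE; exact: fx.
Qed.

Lemma measurable_rV_coord i : measurable_fun setT (fun x : 'rV[R]_n => x ord0 i).
Proof.
apply: (measurability _ (RGenOpens.measurableE R)).
move=> _ [_ [a [b ->] <-]]; rewrite setTI; apply: open_measurable_rV.
apply: open_comp => [x _|]; last exact: interval_open.
  exact: coord_continuous.
Qed.

End borel_rV.

Section lebesgue_rV.
Context (R : realType).
Local Open Scope ereal_scope.

Definition cons_rV n (p : measurableTypeR R * 'rV[R]_n) : 'rV[R]_n.+1 :=
  row_mx (\row_(_ < 1) p.1) p.2.

Lemma cons_rV0 n p : @cons_rV n p ord0 ord0 = p.1.
Proof.
rewrite /cons_rV (_ : ord0 = lshift n (ord0 : 'I_1)); last exact/val_inj.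
by rewrite (row_mxEl (\row_(_ < 1) p.1)) mxE.
Qed.

Lemma cons_rVS n p (i : 'I_n) : @cons_rV n p ord0 (lift ord0 i) = p.2 ord0 i.
Proof.
rewrite /cons_rV (_ : lift ord0 i = rshift 1 i); last exact/val_inj.
by rewrite (row_mxEr (\row_(_ < 1) p.1)).
Qed.

Lemma measurable_cons_rV n : measurable_fun setT (@cons_rV n).
Proof.
apply: measurable_fun_rVP => i; have [j ->|->] := unliftP ord0 i.
  by under eq_fun do rewrite cons_rVS;
    exact: (measurableT_comp (measurable_rV_coord j) measurable_snd).
by under eq_fun do rewrite cons_rV0; exact: measurable_fst.
Qed.

Definition tail_rV n (x : 'rV[R]_n.+1) : 'rV[R]_n := \row_i x ord0 (lift ord0 i).

Lemma cons_rVK n p : tail_rV (@cons_rV n p) = p.2.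
Proof. by apply/rowP => i; rewrite mxE cons_rVS. Qed.

Lemma measurable_tail_rV n : measurable_fun setT (@tail_rV n).
Proof.
apply: measurable_fun_rVP => i; under eq_fun do rewrite mxE.
exact: measurable_rV_coord.
Qed.

Section lebesgue_rV_step.
Context (n : nat) (mu : {sigma_finite_measure set 'rV[R]_n -> \bar R}).

Definition lebesgue_rV_step : set 'rV[R]_n.+1 -> \bar R :=
  pushforward (lebesgue_measure \x mu) (@cons_rV n).

Let step0 : lebesgue_rV_step set0 = 0.
Proof. by rewrite /lebesgue_rV_step /pushforward preimage_set0 measure0. Qed.

Let nu : {measure set 'rV[R]_n.+1 -> \bar R} :=
  measure_function_pushforward__canonical__measure_function_Measure
    (lebesgue_measure \x mu) (@measurable_cons_rV n).

Let step_ge0 A : 0 <= lebesgue_rV_step A.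
Proof. exact: (measure_ge0 nu). Qed.

Let step_sigma_additive : semi_sigma_additive lebesgue_rV_step.
Proof. exact: (@measure_semi_sigma_additive _ _ _ nu). Qed.

HB.instance Definition _ := isMeasure.Build _ _ _ lebesgue_rV_step
  step0 step_ge0 step_sigma_additive.

Lemma lebesgue_rV_stepX (A : set (measurableTypeR R)) (B : set 'rV[R]_n) :
  measurable A -> measurable B ->
  lebesgue_rV_step [set x : 'rV[R]_n.+1 | A (x ord0 ord0) /\ B (tail_rV x)] =
  lebesgue_measure A * mu B.
Proof.
move=> mA mB; rewrite -product_measure1E// /lebesgue_rV_step /pushforward.
rewrite (_ : _ @^-1` _ = A `*` B)//.
by apply/seteqP; split => p /=; rewrite cons_rV0 cons_rVK.
Qed.

Let step_sigma_finite : sigma_finite setT lebesgue_rV_step.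
Proof.
have /sigma_finiteP[F [TF ndF Foo]] := sigma_finiteT (@lebesgue_measure R).
have /sigma_finiteP[G [TG ndG Goo]] := sigma_finiteT mu.
exists (fun k => [set x : 'rV[R]_n.+1 | F k (x ord0 ord0) /\ G k (tail_rV x)]).
  apply/esym/seteqP; split => // x _.
  have : [set: measurableTypeR R] (x ord0 ord0) by [].
  have : [set: 'rV[R]_n] (tail_rV x) by [].
  rewrite TF TG => -[i _ Gi] [j _ Fj]; exists (maxn i j) => //; split.
    by have /subsetPset := ndF _ _ (leq_maxr i j); apply.
  by have /subsetPset := ndG _ _ (leq_maxl i j); apply.
move=> k; have [mF Fkoo] := Foo k; have [mG Gkoo] := Goo k; split; last first.
  by rewrite lebesgue_rV_stepX// lte_mul_pinfty// ge0_fin_numE.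
rewrite (_ : mkset _ = (fun x : 'rV[R]_n.+1 => x ord0 ord0) @^-1` F k `&`
  (@tail_rV n) @^-1` G k)//.
by apply: measurableI; rewrite -[X in measurable X]setTI;
  [exact: measurable_rV_coord|exact: measurable_tail_rV].
Qed.

HB.instance Definition _ := Measure_isSigmaFinite.Build _ _ _ lebesgue_rV_step
  step_sigma_finite.

End lebesgue_rV_step.

(* Lebesgue measure on $\mathbb{R}^n$, as an iterated product measure. *)
Fixpoint lebesgue_rV n : {sigma_finite_measure set 'rV[R]_n -> \bar R} :=
  match n with
  | 0 => \d_(0%R : 'rV[R]_0)
  | m.+1 => lebesgue_rV_step (lebesgue_rV m)
  end.

Lemma lebesgue_rV_box n (a b : 'rV[R]_n) :
  (forall i, (a ord0 i <= b ord0 i)%R) ->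
  lebesgue_rV n [set x | forall i, x ord0 i \in `]a ord0 i, b ord0 i]] =
  (\prod_(i < n) (b ord0 i - a ord0 i))%:E.
Proof.
elim: n => [|n IHn] in a b *; move=> ab.
  rewrite big_ord0 /= diracE mem_set// => -[]//.
rewrite big_ord_recl/= EFinM.
rewrite [X in lebesgue_rV_step _ X](_ : _ =
  [set x : 'rV[R]_n.+1 | [set` `]a ord0 ord0, b ord0 ord0]] (x ord0 ord0) /\
  [set y : 'rV[R]_n | forall i,
     y ord0 i \in `](tail_rV a) ord0 i, (tail_rV b) ord0 i]] (tail_rV x)]).
  rewrite lebesgue_rV_stepX//.
  - rewrite lebesgue_measure_itv/= lte_fin -EFinD IHn; last first.
      by move=> i; rewrite !mxE.
    congr (_ * _%:E); last by apply: eq_bigr => i _; rewrite !mxE.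
    by case: ltP (ab ord0) => // + ?; rewrite le_eqVlt ltNge; case: eqVneq => [->|]; rewrite ?subrr //= => _ /negP.
  - rewrite (_ : mkset _ = \bigcap_(i in [set: 'I_n])
       ((fun y : 'rV[R]_n => y ord0 i) @^-1`
          [set` `](tail_rV a) ord0 i, (tail_rV b) ord0 i]])).
      apply: fin_bigcap_measurable => // i _; rewrite -[X in measurable X]setTI.
      exact: measurable_rV_coord.
    by apply/seteqP; split => y /= h i; [move=> _; exact: h|exact: (h i I)].
apply/seteqP; split => x /= h.
  by split => [|i]; rewrite ?mxE; exact: h.
by move=> i; have [j ->|->] := unliftP ord0 i; [have := h.2 j; rewrite !mxE|exact: h.1].
Qed.

End lebesgue_rV.


(* The Euclidean norm; the canonical norm on ['rV[R]_n] is the sup norm. *)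
Definition enorm (R : realType) n (x : 'rV[R]_n) : R :=
  Num.sqrt (\sum_i x ord0 i ^+ 2).

Section hausdorff_measure.
Context (R : realType) (n s : nat).
Local Notation E := 'rV[R]_n.
Local Open Scope ereal_scope.
Implicit Types (A B U : set E) (e : R).

Definition ediam U : \bar R :=
  ereal_sup [set (enorm (x - y)%R)%:E | x in U & y in U].

Definition unit_ball_volume : R :=
  fine (lebesgue_rV R s [set x | (enorm x <= 1)%R]).

(* The normalization $\omega_s 2^{-s} \mathrm{diam}(U)^s$, for which the
   s-dimensional measure of an s-dimensional hypersurface is its area. *)
Definition hausdorff_gauge U : \bar R :=
  if U == set0 then 0 else (unit_ball_volume / 2 ^+ s)%:E * ediam U ^+ s.

Definition hausdorff_cover e A : set (set E)^nat :=
  [set U | (forall k, ediam (U k) <= e%:E) /\ A `<=` \bigcup_k U k].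

Definition hausdorff_content e A : \bar R :=
  ereal_inf [set \sum_(k <oo) hausdorff_gauge (U k) | U in hausdorff_cover e A].

Definition hausdorff_measure A : \bar R :=
  ereal_sup [set hausdorff_content e A | e in [set e : R | (0 < e)%R]].

Lemma ler_normr_enorm (x : E) : (`|x| <= enorm x)%R.
Proof.
rewrite /Num.norm/= mx_normrE; apply: bigmax_le; first exact: sqrtr_ge0.
move=> [i j] _ /=; rewrite ord1 -sqrtr_sqr ler_wsqrtr// (bigD1 j)//= lerDl.
by apply: sumr_ge0 => k _; exact: sqr_ge0.
Qed.

Let ediam_ge0 U : U !=set0 -> 0 <= ediam U.
Proof.
move=> [x Ux]; apply: ereal_sup_ubound; exists x => //; exists x => //.
by rewrite subrr /enorm big1 ?sqrtr0// => i _; rewrite mxE expr0n.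
Qed.

Let unit_ball_volume_ge0 : (0 <= unit_ball_volume)%R.
Proof. exact/fine_ge0/measure_ge0. Qed.

Let gauge0 : hausdorff_gauge set0 = 0.
Proof. by rewrite /hausdorff_gauge eqxx. Qed.

Let gauge_ge0 U : 0 <= hausdorff_gauge U.
Proof.
rewrite /hausdorff_gauge; case: eqVneq => // /set0P U0.
by rewrite mule_ge0 ?expe_ge0 ?ediam_ge0// lee_fin divr_ge0// exprn_ge0.
Qed.

Let content_ge0 e A : 0 <= hausdorff_content e A.
Proof.
by apply: le_ereal_inf_tmp => _ [U _ <-]; apply: nneseries_ge0 => *.
Qed.

Let hausdorff_measure_ge0 A : 0 <= hausdorff_measure A.
Proof.
by apply: (le_trans (content_ge0 1 A)); apply: ereal_sup_ubound; exists 1%R => /=.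
Qed.

Let ediam0 : ediam set0 = -oo.
Proof.
by rewrite /ediam (_ : [set _ | _ in _ & _ in _] = set0) ?ereal_sup0// -subset0
  => _ [x []].
Qed.

Let content0 e : hausdorff_content e set0 = 0.
Proof.
apply/eqP; rewrite eq_le content_ge0 andbT; apply: ereal_inf_lbound.
exists (fun=> set0); last by rewrite eseries0.
by split => // k; rewrite ediam0 leNye.
Qed.

Let le_content e A B : A `<=` B -> hausdorff_content e A <= hausdorff_content e B.
Proof.
move=> AB; apply: le_ereal_inf => _ [U [dU BU] <-]; exists U => //; split => //.
exact: subset_trans BU.
Qed.

Let content_anti e e' A : (e <= e')%R -> hausdorff_content e' A <= hausdorff_content e A.
Proof.
move=> ee'; apply: le_ereal_inf => _ [U [dU BU] <-]; exists U => //; split => // k.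
by rewrite (le_trans (dU k))// lee_fin.
Qed.

Let content_sigma_subadditive e : sigma_subadditive (hausdorff_content e).
Proof.
pose T := g_sigma_algebraType [set: set E].
pose mu (U : set T) : \bar R := if ediam U <= e%:E then hausdorff_gauge U else +oo.
have mu0 U : 0 <= mu U by rewrite /mu; case: ifP.
suff -> : hausdorff_content e = @mu_ext _ T R mu.
  exact: (@mu_ext_sigma_subadditive _ T R mu mu0).
apply/funext => A; apply/eqP; rewrite eq_le; apply/andP; split.
  apply: le_ereal_inf_tmp => _ [U [_ AU] <-].
  have [[k Uk]|] := pselect (exists k, ~~ (ediam (U k) <= e%:E)).
    rewrite (@eseries_pinfty _ _ _ k) ?leey//.
      by move=> m _; rewrite -ltNye (lt_le_trans _ (mu0 _)).
    by rewrite /mu (negbTE Uk).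
  move=> /forallNP dU; have {}dU k : ediam (U k) <= e%:E.
    by apply/negPn/negP; exact: dU.
  apply: ereal_inf_lbound; exists U => //.
  by apply: eq_eseriesr => k _; rewrite /mu dU.
apply: le_ereal_inf => _ [U [dU AU] <-]; exists U.
  by split => // k; exact: sub_sigma_algebra.
by apply: eq_eseriesr => k _; rewrite /mu dU.
Qed.

Let hausdorff_measure0 : hausdorff_measure set0 = 0.
Proof.
apply/eqP; rewrite eq_le hausdorff_measure_ge0 andbT.
by apply: ge_ereal_sup => _ [e _ <-]; rewrite content0.
Qed.

Let le_hausdorff_measure : {homo hausdorff_measure : A B / A `<=` B >-> A <= B}.
Proof.
move=> A B AB; apply: ge_ereal_sup => _ [e e0 <-].
apply: le_trans (le_content e AB) _.
by apply: ereal_sup_ubound; exists e.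
Qed.

Let hausdorff_measure_sigma_subadditive : sigma_subadditive hausdorff_measure.
Proof.
move=> F; apply: ge_ereal_sup => _ [e e0 <-].
apply: (le_trans (content_sigma_subadditive e F)).
apply: lee_nneseries => // k _.
by apply: ereal_sup_ubound; exists e.
Qed.

HB.instance Definition _ := isOuterMeasure.Build R E hausdorff_measure
  hausdorff_measure0 hausdorff_measure_ge0 le_hausdorff_measure
  hausdorff_measure_sigma_subadditive.

Let content_metric e r A B : (0 < e)%R -> (e < r)%R ->
  (forall x y, A x -> B y -> (r <= `|x - y|)%R) ->
  hausdorff_content e A + hausdorff_content e B <= hausdorff_content e (A `|` B).
Proof.
move=> e0 er AB; apply: le_ereal_inf_tmp => _ [U [dU ABU] <-].
pose V C k := if `[< (U k `&` C) !=set0 >] then U k else set0.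
have V_cover C : C `<=` A `|` B -> hausdorff_cover e C (V C).
  move=> CAB; split=> [k|x Cx].
    by rewrite /V; case: ifP => // _; rewrite ediam0 leNye.
  have [k _ Ukx] := ABU _ (CAB _ Cx); exists k => //.
  by rewrite /V; case: ifPn => // /asboolPn; apply: contra_notP => _; exists x.
apply: (@le_trans _ _ (\sum_(k <oo) (hausdorff_gauge (V A k)) +
                       \sum_(k <oo) (hausdorff_gauge (V B k)))).
  by apply: leeD; apply: ereal_inf_lbound;
    [exists (V A) => //|exists (V B) => //]; apply: V_cover => x; [left|right].
rewrite -nneseriesD//; apply: lee_nneseries => [k _ _|k _]; first exact: adde_ge0.
rewrite /V; case: asboolP => [[x [Ux Ax]]|_]; last first.
  by rewrite gauge0 add0e; case: ifP => // _; rewrite gauge0.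
case: asboolP => [[y [Uy By]]|_]; last by rewrite gauge0 adde0.
have : (r%:E <= e%:E).
  rewrite (le_trans _ (dU k))//; apply: (@le_trans _ _ (enorm (x - y)%R)%:E).
    by rewrite lee_fin (le_trans (AB _ _ Ax By))// ler_normr_enorm.
  by apply: ereal_sup_ubound; exists x => //; exists y.
by rewrite lee_fin leNgt er.
Qed.

Let hausdorff_metric r A B : (0 < r)%R ->
  (forall x y, A x -> B y -> (r <= `|x - y|)%R) ->
  hausdorff_measure A + hausdorff_measure B <= hausdorff_measure (A `|` B).
Proof.
move=> r0 AB; have [->|ABoo] := eqVneq (hausdorff_measure (A `|` B)) +oo.
  exact: leey.
have ABfin : hausdorff_measure (A `|` B) \is a fin_num.
  by rewrite ge0_fin_numE// ltey.
have Bfin : hausdorff_measure B \is a fin_num.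
  rewrite ge0_fin_numE//; apply: le_lt_trans (le_hausdorff_measure (@subsetUr _ A B)) _.
  by rewrite ltey.
rewrite -leeBrDr//; apply: ge_ereal_sup => _ [e1 e10 <-].
rewrite leeBrDr// addeC.
have [cfin|/negP cinf] := boolP (hausdorff_content e1 A \is a fin_num); last first.
  have : hausdorff_content e1 A <= hausdorff_measure (A `|` B).
    by apply: le_trans (le_content e1 (@subsetUl _ A B)) _; apply: ereal_sup_ubound; exists e1.
  move=> h; exfalso; apply: cinf; rewrite ge0_fin_numE//.
  by apply: le_lt_trans h _; rewrite ltey.
rewrite -leeBrDr//; apply: ge_ereal_sup => _ [e2 e20 <-].
rewrite leeBrDr// addeC.
pose e := (Num.min (Num.min e1 e2) (r / 2))%R.
have e0 : (0 < e)%R by rewrite !lt_min e10 e20 divr_gt0.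
have er : (e < r)%R.
  by rewrite !gt_min [X in _ || X](_ : _ = true) ?orbT// ltr_pdivrMr// ltr_pMr// ltr1n.
apply: (@le_trans _ _ (hausdorff_content e A + hausdorff_content e B)).
  apply: leeD; apply: content_anti; rewrite !ge_min lexx ?orbT//.
apply: le_trans (content_metric e0 er AB) _.
by apply: ereal_sup_ubound; exists e.
Qed.

Section closed_caratheodory.
Variables (F X : set E).
Hypotheses (cF : closed F) (Xoo : hausdorff_measure X < +oo).

Let A k := [set x | (X `&` ~` F) x /\ forall y, F y -> (k.+1%:R^-1 <= `|x - y|)%R].

Let C k := A k.+1 `\` A k.

Let AX k : A k `<=` X `&` ~` F. Proof. by move=> x []. Qed.

Let A_near x : (X `&` ~` F) x -> exists k, A k x.
Proof.
move=> [Xx Fx]; have : nbhs x (~` F) by apply: open_nbhs_nbhs; split => //; exact: closed_openC.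
move=> /nbhs_ballP[e /= e0 eF].
have [k ke] : exists k, (k.+1%:R^-1 < e)%R.
  have [k _ /(_ k (leqnn k)) ke] := near_infty_natSinv_lt (PosNum e0).
  by exists k.
exists k; split => // y Fy; rewrite leNgt; apply/negP => xy.
apply: (eF y) Fy; rewrite -ball_normE /=; exact: lt_trans ke.
Qed.

Let FA k : hausdorff_measure (X `&` F) + hausdorff_measure (A k) <= hausdorff_measure X.
Proof.
have r0 : (0 < k.+1%:R^-1 :> R)%R by rewrite invr_gt0.
rewrite addeC; apply: (le_trans (hausdorff_metric r0 _)).
- by move=> x y [_ +] [_ Fy]; exact.
- by apply: le_hausdorff_measure => x [[[]]//|[]].
Qed.

Let AC k : hausdorff_measure (A k) + hausdorff_measure (C k.+1) <= hausdorff_measure (A k.+2).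
Proof.
have r0 : (0 < k.+1%:R^-1 - k.+2%:R^-1 :> R)%R.
  by rewrite subr_gt0 ltf_pV2 ?posrE// ltr_nat.
apply: (le_trans (hausdorff_metric r0 _)).
- move=> x y [_ Ax] [[Xy _] /not_andP[//|]] /existsNP[z /not_implyP[Fz /negP]].
  rewrite -ltNge => yz; rewrite lerBlDr (le_trans (Ax _ Fz))//.
  rewrite (_ : x - z = (x - y) + (y - z))%R; last by rewrite addrA subrK.
  by rewrite (le_trans (ler_normD _ _))// lerD2l ltW.
- apply: le_hausdorff_measure => x [[Xx Ax]|[]//]; split => // y Fy.
  by rewrite (le_trans _ (Ax _ Fy))// lef_pV2 ?posrE// ler_nat !ltnS ltnW.
Qed.

Let sumC m c : \sum_(i < m) hausdorff_measure (C (i.*2 + c).+1) <=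
  hausdorff_measure (A (m.*2 + c)).
Proof.
elim: m => [|m IHm]; first by rewrite big_ord0.
by rewrite big_ord_recr/= doubleS; apply: le_trans (leeD2r _ IHm) (AC _).
Qed.

Let sumC2 m : \sum_(i < m.*2) hausdorff_measure (C i.+1) =
  \sum_(i < m) hausdorff_measure (C (i.*2 + 0).+1) +
  \sum_(i < m) hausdorff_measure (C (i.*2 + 1).+1).
Proof.
elim: m => [|m IHm]; first by rewrite !big_ord0 adde0.
by rewrite doubleS !big_ord_recr/= IHm addn0 addn1 -!addeA; congr (_ + _);
  rewrite addeCA.
Qed.

Let seriesC : \sum_(k <oo) hausdorff_measure (C k.+1) < +oo.
Proof.
apply: (@le_lt_trans _ _ (hausdorff_measure X + hausdorff_measure X)).
  apply: lime_le; first exact: is_cvg_nneseries.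
  apply: nearW => m; rewrite big_mkord.
  apply: (@le_trans _ _ (\sum_(i < m.*2) hausdorff_measure (C i.+1))).
    by apply: (lee_sum_nneg_ord (fun k => hausdorff_measure (C k.+1)) xpredT) => //;
      rewrite -addnn leq_addr.
  rewrite sumC2; apply: leeD; apply: (le_trans (sumC _ _));
    by apply: le_hausdorff_measure => x [[]].
by rewrite lte_add_pinfty.
Qed.

Let tailC N : X `&` ~` F `<=` A N.+1 `|` \bigcup_(k in ~` `I_N) C k.+1.
Proof.
move=> x Xx; have [Ax|Ax] := pselect (A N.+1 x); [by left|right].
have : exists k, `[< A k x >] by have [k ?] := A_near Xx; exists k; exact/asboolP.
move=> /ex_minnP[k /asboolP Ak kmin].
have Amono i j : (i <= j)%N -> A i x -> A j x.
  move=> ij [_ Ai]; split => // y Fy.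
  by rewrite (le_trans _ (Ai _ Fy))// lef_pV2 ?posrE// ler_nat.
have Nk : (N.+1 < k)%N.
  by rewrite ltnNge; apply/negP => /Amono/(_ Ak).
case: k => [//|[//|k]] in Ak kmin Nk *.
exists k => /=; first by apply/negP; rewrite -leqNgt; move: Nk; rewrite !ltnS.
split => // /asboolP/kmin; by rewrite ltnn.
Qed.

Lemma closed_caratheodory_fin :
  hausdorff_measure (X `&` F) + hausdorff_measure (X `&` ~` F) <= hausdorff_measure X.
Proof.
apply/lee_addgt0Pr => e e0.
have := nneseries_tail_cvg seriesC (fun k _ => hausdorff_measure_ge0 (C k.+1)).
move=> /fine_cvgP[tfin] /cvgrPdist_lt /(_ _ e0) tlt.
have [N _ HN] := filterI tfin tlt.
have [{}tfin {}tlt] := HN N (leqnn N).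
apply: (@le_trans _ _ (hausdorff_measure (X `&` F) + (hausdorff_measure (A N.+1) +
    hausdorff_measure (\bigcup_(k in ~` `I_N) C k.+1)))).
  apply: leeD => //; apply: (le_trans (le_hausdorff_measure (tailC N))).
  exact: outer_measureU2.
rewrite addeA; apply: leeD; first exact: FA.
apply: (le_trans (outer_measure_sigma_subadditive_tail _ N (fun k => C k.+1))).
rewrite -(fineK tfin) lee_fin.
by move: tlt => /=; rewrite sub0r normrN => /ltW; apply: le_trans; exact: ler_norm.
Qed.

End closed_caratheodory.

Let closed_caratheodory F : closed F -> hausdorff_measure.-caratheodory F.
Proof.
move=> cF; apply: le_caratheodory_measurable => X.
have [Xoo|Xoo] := eqVneq (hausdorff_measure X) +oo.
  by rewrite [leRHS]Xoo leey.
by apply: closed_caratheodory_fin => //; rewrite ltey.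
Qed.

Lemma borel_caratheodory A : measurable A -> hausdorff_measure.-caratheodory A.
Proof.
move: A; apply: smallest_sub.
  exact: (@sigma_algebra_measurable _ (caratheodory_type hausdorff_measure)).
move=> A oA; rewrite -(setCK A); apply: caratheodory_measurable_setC.
by apply: closed_caratheodory; exact: open_closedC.
Qed.

Let hausdorff_measure_semi_sigma_additive : semi_sigma_additive hausdorff_measure.
Proof.
move=> F mF tF mUF.
by apply: caratheodory_measure_sigma_additive => // [i|];
  exact: borel_caratheodory.
Qed.

HB.instance Definition _ := isMeasure.Build _ _ _ hausdorff_measure
  hausdorff_measure0 hausdorff_measure_ge0 hausdorff_measure_semi_sigma_additive.

End hausdorff_measure.

Section L2_operators.
Context d (T : measurableType d) (R : realType) (mu : {measure set T -> \bar R}).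

(* Elements of $L_2(\mu)$ are represented by square-integrable functions,
   identified when they agree almost everywhere. *)
Definition L2 := LfunType mu (lee1n 2).

Implicit Types (f g : L2) (A : L2 -> L2 -> Prop) (S : R -> L2 -> L2).

Definition L2dist (f g : T -> R) : \bar R := 'N[mu]_2[EFin \o (f \- g)].

(* Compatibility of [S t] with a.e. equality follows from the first two fields. *)
Record C0_semigroup S : Prop := {
  semigroup_linear : forall t, 0 < t -> forall (a : R) f g,
    S t (a *: f + g) = a *: S t f + S t g %[ae mu] ;
  semigroup_bounded : forall t, 0 < t -> exists M : R, forall f,
    ('N[mu]_2[EFin \o S t f] <= M%:E * 'N[mu]_2[EFin \o f])%E ;
  semigroup_law : forall s t, 0 < s -> 0 < t -> forall f,
    S (s + t) f = S s (S t f) %[ae mu] ;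
  semigroup_continuous : forall f, L2dist (S t f) f @[t --> 0^'+] --> 0%E }.

(* An unbounded, possibly multivalued operator is given by its graph [A]:
   [A f g] means $f \in D(A)$ and $A f = g$. *)
Definition infinitesimal_generator S f g : Prop :=
  L2dist (h^-1 *: (S h f - f)) g @[h --> 0^'+] --> 0%E.

Definition generated_by S A : Prop :=
  C0_semigroup S /\ forall f g, infinitesimal_generator S f g <-> A f g.

Definition opp_graph A f g : Prop := A f (- g).

Definition dim_ker A (n : nat) : Prop :=
  exists e : 'I_n -> L2,
  [/\ forall i, A (e i) 0,
      forall c : 'I_n -> R, \sum_i c i *: e i = 0 %[ae mu] -> forall i, c i = 0 &
      forall f, A f 0 -> exists c : 'I_n -> R, f = \sum_i c i *: e i %[ae mu]].

Definition irreducible (G : set T) S : Prop :=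
  forall G1, measurable G1 -> G1 `<=` G ->
    (forall t, 0 < t -> forall f,
      ae_eq mu (G `\` G1) f (cst 0) -> ae_eq mu (G `\` G1) (S t f) (cst 0)) ->
    mu G1 = 0%E \/ mu (G `\` G1) = 0%E.

End L2_operators.

Definition boundary (T : topologicalType) (A : set T) : set T :=
  closure A `\` interior A.

Lemma measurable_boundary (R : realType) n (A : set 'rV[R]_n) :
  measurable (boundary A).
Proof.
apply: measurableD; first by apply: closed_measurable_rV; exact: closed_closure.
by apply: open_measurable_rV; exact: open_interior.
Qed.

Section dirichlet_to_neumann.
Context (R : realType) (d : nat).
Local Notation E := 'rV[R]_d.
Local Notation lambda := (lebesgue_rV R d).
Implicit Types (Omega : set E) (u v f phi : E -> R).

Definition partial (i : 'I_d) phi : E -> R := 'D_(delta_mx ord0 i) phi.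

Definition smooth phi : Prop :=
  forall (s : seq 'I_d) x, differentiable (foldr partial phi s) x.

Definition test_function Omega phi : Prop :=
  [/\ smooth phi, compact (closure [set x | phi x != 0]) &
      closure [set x | phi x != 0] `<=` Omega].

(* Functions on Omega, on its closure or on its boundary are represented by
   total functions, whose values elsewhere are irrelevant. *)
Definition square_integrable Omega u : Prop :=
  measurable_fun Omega u /\ lambda.-integrable Omega (fun x => (u x ^+ 2)%:E).

Definition weak_gradient Omega u (g : 'I_d -> E -> R) : Prop :=
  forall i, square_integrable Omega (g i) /\
    forall phi, test_function Omega phi ->
      \int[lambda]_(x in Omega) (u x * partial i phi x) =
      - \int[lambda]_(x in Omega) (g i x * phi x).

Definition H1 Omega : set (E -> R) :=
  [set u | square_integrable Omega u /\ exists g, weak_gradient Omega u g].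

(* A choice of weak gradient, which is unique up to a.e. equality on Omega. *)
Definition grad Omega u : 'I_d -> E -> R :=
  xget (fun _ => cst 0) [set g | weak_gradient Omega u g].

Definition H1norm Omega u : R :=
  Num.sqrt (\int[lambda]_(x in Omega) (u x ^+ 2) +
            \int[lambda]_(x in Omega) (\sum_i grad Omega u i x ^+ 2)).

Definition H1C Omega : set (E -> R) :=
  [set u | {within closure Omega, continuous u} /\ H1 Omega u].

(* The distributional Laplacian of [u] on Omega is the function [f]. *)
Definition is_laplacian Omega u f : Prop :=
  forall phi, test_function Omega phi ->
    \int[lambda]_(x in Omega) (u x * \sum_i partial i (partial i phi) x) =
    \int[lambda]_(x in Omega) (f x * phi x).

(* The (d-1)-dimensional Hausdorff measure on the boundary, as a Borel measure
   on the whole space that vanishes off the boundary: [L2 (surface_measure Omega)]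
   is $L_2(\Gamma)$. *)
Definition surface_measure Omega : {measure set E -> \bar R} :=
  mrestr (hausdorff_measure d.-1) (measurable_boundary Omega).

Local Notation L2bd Omega := (L2 (surface_measure Omega)).

Definition is_trace Omega u (phi : L2bd Omega) : Prop :=
  exists u_ : (E -> R)^nat,
  [/\ forall n, H1C Omega (u_ n),
      H1norm Omega (u_ n \- u) @[n --> \oo] --> (0 : R) &
      L2dist (surface_measure Omega) (u_ n \* \1_(boundary Omega)) phi
        @[n --> \oo] --> 0%E].

Definition trace_unique Omega : Prop :=
  forall phi : L2bd Omega, is_trace (cst 0) phi <->
    phi = 0 %[ae surface_measure Omega].

Definition is_normal_derivative Omega u (psi : L2bd Omega) : Prop :=
  exists f : E -> R,
  [/\ square_integrable Omega f, is_laplacian Omega u f &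
      forall v, H1C Omega v ->
        \int[lambda]_(x in Omega) (f x * v x) +
        \int[lambda]_(x in Omega) (\sum_i grad Omega u i x * grad Omega v i x) =
        \int[surface_measure Omega]_(x in boundary Omega) (psi x * v x)].

(* The graph of $D_0$. *)
Definition dtn Omega (phi psi : L2bd Omega) : Prop :=
  exists u, [/\ H1 Omega u, is_laplacian Omega u (cst 0), is_trace u phi &
                is_normal_derivative u psi].

Definition mean_projection Omega (phi : L2bd Omega) : E -> R :=
  fun x => (fine (surface_measure Omega (boundary Omega)))^-1 *
    (\int[surface_measure Omega]_(y in boundary Omega) phi y) *
    \1_(boundary Omega) x.

End dirichlet_to_neumann.

(* Main.v *)
Require Import Defs.
From HB Require Import structures.
From mathcomp Require Import all_boot all_order all_algebra.
From mathcomp Require Import all_classical all_reals all_analysis.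
From mathcomp Require Import ring lra measurable_realfun.
Import Order.TTheory GRing.Theory Num.Theory.
Import numFieldNormedType.Exports.
Local Open Scope classical_set_scope.
Local Open Scope ring_scope.

(* By Green's formula, $(D_0\varphi, \varphi') = \int_\Omega \nabla u \cdot \nabla u'$
   whenever [u] realizes $\varphi \in D(D_0)$ and $\varphi'$ is a trace of [u']. So
   $D_0$ is symmetric and positive, S consists of symmetric contractions, and
   $\|S_{t/2}\varphi\|^2 = (S_t\varphi, \varphi)$ decreases in t, which makes $S_t\varphi$
   converge to an element of $\ker D_0$; conversely S fixes $\ker D_0$.

   An element of $\ker D_0$ is a trace of a function with zero gradient on the
   connected set Omega, hence of a constant c, and equals c if traces are unique.
   If $\ker D_0$ is one-dimensional, the limit of $S_t\varphi$ is a constant, and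
   by symmetry of S it is the mean of $\varphi$. If $S_t\varphi$ always tends to the
   mean, then no $\Gamma_1$ of positive but not full measure is invariant.

   Finally, the traces of 0 form a closed subspace of $\ker D_0$ which is stable
   under multiplication by smooth functions, hence by Borel indicators. If
   $\varphi$ is such a trace, S therefore leaves every Borel subset of
   $[\varphi \ne 0]$ invariant. Under irreducibility each of them is null or
   conull in $\Gamma$; as points are null, so is $[\varphi \ne 0]$. *)

Set Implicit Arguments.
Unset Strict Implicit.

(** * Semi-inner product spaces *)

(** The data of S are weak: [C0_semigroup] bounds each [S t] separately, and of the generator only
    the graph is known. Symmetry and positivity of that graph give the symmetry and contractivity of
    S on the domain of the generator, by a discretized differentiation in t. The passage to all of
    $L_2$ needs the domain to be dense and S to be locally bounded, hence the uniform boundedness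
    principle. No spectral theorem is used.

    Elements of [L2] are functions, so there are nonzero vectors of norm 0; the abstract part
    therefore works with a semi-inner product and with equality modulo its null vectors.

    Traces of 0 are singled out because multiplication by a smooth m keeps the limit 0 in $H^1$,
    while other limits change in general. The invariance of subsets of $[\varphi \ne 0]$ is in fact
    pointwise: if f lives on such a set, $(S_t f - f)\varphi = 0$ a.e. gives $(S_t f, f) = \|f\|^2$,
    and for a contraction this means $S_t f = f$.

    The boundary must have positive measure, or constants would be null and $\ker D_0$ could not
    have dimension one. This is obtained by projecting the boundary along a coordinate axis. *)

Record semi_inner (R : realType) (V : lmodType R) := SemiInner {
  ip :> V -> V -> R ;
  ipC : forall x y, ip x y = ip y x ;
  ip_linear : forall a x y z, ip (a *: x + y) z = a * ip x z + ip y z ;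
  ip_ge0 : forall x, 0 <= ip x x }.

Section semi_inner_theory.
Context (R : realType) (V : lmodType R) (B : semi_inner V).
Implicit Types (x y z : V) (a : R).

Definition nrm x := Num.sqrt (B x x).

Definition complete_ip := forall u : nat -> V,
  (forall e : R, 0 < e -> exists N, forall m n, (N <= m)%N -> (N <= n)%N ->
     nrm (u m - u n) <= e) ->
  exists x, forall e : R, 0 < e -> exists N, forall n, (N <= n)%N ->
    nrm (u n - x) <= e.

Lemma ipDl x y z : B (x + y) z = B x z + B y z.
Proof. by rewrite -[x in LHS]scale1r ip_linear mul1r. Qed.

Lemma ip0l z : B 0 z = 0.
Proof. by have := ipDl 0 0 z; rewrite addr0 => /eqP; rewrite -subr_eq0 opprD addNKr oppr_eq0 =>
  /eqP. Qed.

Lemma ipZl a x z : B (a *: x) z = a * B x z.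
Proof. by rewrite -[a *: x]addr0 ip_linear ip0l addr0. Qed.

Lemma ipNl x z : B (- x) z = - B x z.
Proof. by rewrite -scaleN1r ipZl mulN1r. Qed.

Lemma ipBl x y z : B (x - y) z = B x z - B y z.
Proof. by rewrite ipDl ipNl. Qed.

Lemma ipDr x y z : B z (x + y) = B z x + B z y.
Proof. by rewrite ipC ipDl !(ipC B z). Qed.

Lemma ipZr a x z : B z (a *: x) = a * B z x.
Proof. by rewrite ipC ipZl (ipC B z). Qed.

Lemma ipBr x y z : B z (x - y) = B z x - B z y.
Proof. by rewrite ipC ipBl !(ipC B z). Qed.

Lemma ip_suml I (r : seq I) (P : pred I) (F : I -> V) z :
  B (\sum_(i <- r | P i) F i) z = \sum_(i <- r | P i) B (F i) z.
Proof.
by apply: (big_morph (fun x => B x z)); [move=> x y; exact: ipDl|exact: ip0l].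
Qed.

Lemma nrm_ge0 x : 0 <= nrm x. Proof. exact: sqrtr_ge0. Qed.
Hint Resolve nrm_ge0 : core.

Lemma sqr_nrm x : nrm x ^+ 2 = B x x.
Proof. by rewrite sqr_sqrtr// ip_ge0. Qed.

Lemma ip_sqr_le x y : B x y ^+ 2 <= B x x * B y y.
Proof.
have key a : 0 <= B x x + a * B x y *+ 2 + a ^+ 2 * B y y.
  have := ip_ge0 B (x + a *: y).
  rewrite ipDl !ipDr !ipZl !ipZr (ipC B y x).
  rewrite (_ : _ + _ = B x x + a * B x y *+ 2 + a ^+ 2 * B y y)//; ring.
have [y0|y0] := eqVneq (B y y) 0.
  suff -> : B x y = 0 by rewrite expr0n/= y0 mulr0.
  have [//|n0] := eqVneq (B x y) 0.
  (* The form may be degenerate: for an isotropic [y] the polynomial in [a] is affine, and this [a]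
     gives it the value -1. *)
  have := key (- (B x x + 1) / B x y / 2); rewrite y0 mulr0 addr0.
  rewrite -mulr_natr (_ : _ + _ = -1) ?lerN10// ?oppr_ge0 ?ler10//.
  by field.
have {}y0 : 0 < B y y by rewrite lt_neqAle eq_sym y0 ip_ge0.
have := key (- B x y / B y y).
rewrite (_ : _ + _ = B x x - B x y ^+ 2 / B y y); last first.
  by field; rewrite gt_eqF.
by rewrite subr_ge0 ler_pdivrMr.
Qed.

Lemma cauchy_schwarz x y : `|B x y| <= nrm x * nrm y.
Proof.
rewrite -ler_sqr ?nnegrE ?mulr_ge0// exprMn !sqr_nrm -normrX ger0_norm ?sqr_ge0//.
exact: ip_sqr_le.
Qed.

Lemma nrmD x y : nrm (x + y) <= nrm x + nrm y.
Proof.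
rewrite -ler_sqr ?nnegrE ?addr_ge0// sqrrD !sqr_nrm ipDl !ipDr (ipC B y x).
have := le_trans (ler_norm _) (cauchy_schwarz x y); lra.
Qed.

Lemma nrmZ a x : nrm (a *: x) = `|a| * nrm x.
Proof. by rewrite /nrm ipZl ipZr mulrA sqrtrM -expr2 ?sqr_ge0// sqrtr_sqr. Qed.

Lemma nrm0 : nrm 0 = 0. Proof. by rewrite /nrm ip0l sqrtr0. Qed.

Lemma nrmN x : nrm (- x) = nrm x.
Proof. by rewrite -scaleN1r nrmZ normrN1 mul1r. Qed.

Lemma nrmB x y : nrm (x - y) = nrm (y - x).
Proof. by rewrite -nrmN opprB. Qed.

Lemma nrm_sub_trans y x z : nrm (x - z) <= nrm (x - y) + nrm (y - z).
Proof. by rewrite (le_trans _ (nrmD _ _))// addrA subrK. Qed.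

Lemma ler_nrmB x y : nrm x - nrm y <= nrm (x - y).
Proof. by rewrite lerBlDr (le_trans _ (nrmD _ _))// subrK. Qed.

Lemma nrm_sum I (r : seq I) (P : pred I) (F : I -> V) :
  nrm (\sum_(i <- r | P i) F i) <= \sum_(i <- r | P i) nrm (F i).
Proof.
elim/big_ind2 : _ => //; first by rewrite nrm0.
by move=> x a y b xa yb; rewrite (le_trans (nrmD _ _))// lerD.
Qed.

(** Equality in the Hausdorff quotient, without forming the quotient; on [L2] it is equality almost
    everywhere. *)
Definition eqn x y := nrm (x - y) = 0.

Lemma nrm_le0 x : (forall e : R, 0 < e -> nrm x <= e) -> nrm x = 0.
Proof.
move=> h; apply/eqP; rewrite eq_le nrm_ge0 andbT; apply/ler_addgt0Pr => e e0.
by rewrite add0r h.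
Qed.

Lemma eqn_refl x : eqn x x. Proof. by rewrite /eqn subrr nrm0. Qed.

Lemma eqn_sym x y : eqn x y -> eqn y x. Proof. by rewrite /eqn nrmB. Qed.

Lemma eqn_trans x y z : eqn x y -> eqn y z -> eqn x z.
Proof.
rewrite /eqn => xy yz; apply/eqP; rewrite eq_le nrm_ge0 andbT.
by rewrite (le_trans (nrm_sub_trans y _ _))// xy yz addr0.
Qed.

Lemma eqn_nrm x y : eqn x y -> nrm x = nrm y.
Proof.
move=> xy; apply/eqP; rewrite eq_le -[in X in X && _]subr_le0 -[in X in _ && X]subr_le0.
by rewrite !(le_trans (ler_nrmB _ _)) ?xy// nrmB xy.
Qed.

Lemma eqn_ip x x' y y' : eqn x x' -> eqn y y' -> B x y = B x' y'.
Proof.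
move=> xx' yy'; have h u v z : eqn u v -> B u z = B v z.
  move=> uv; apply/eqP; rewrite -subr_eq0 -ipBl -normr_le0.
  by rewrite (le_trans (cauchy_schwarz _ _))// uv mul0r.
by rewrite (h _ _ _ xx') ipC (h _ _ _ yy') ipC.
Qed.

Lemma eqnD x x' y y' : eqn x x' -> eqn y y' -> eqn (x + y) (x' + y').
Proof.
rewrite /eqn => xx' yy'; rewrite opprD addrACA; apply/eqP.
by rewrite eq_le nrm_ge0 andbT (le_trans (nrmD _ _))// xx' yy' addr0.
Qed.

Lemma eqnZ a x x' : eqn x x' -> eqn (a *: x) (a *: x').
Proof. by rewrite /eqn -scalerBr nrmZ => ->; rewrite mulr0. Qed.

Lemma eqnN x x' : eqn x x' -> eqn (- x) (- x').
Proof. by rewrite -[- x]scaleN1r -[- x']scaleN1r; exact: eqnZ. Qed.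

Lemma eqnB x x' y y' : eqn x x' -> eqn y y' -> eqn (x - y) (x' - y').
Proof. by move=> ? /eqnN; exact: eqnD. Qed.

End semi_inner_theory.

(** A discrete substitute for the mean value inequality: if [n] steps of length [t / n] contribute
    [e * t / n] each, the total change is [e * t]. It replaces the differentiation of orbits of the
    semigroup. *)
Lemma ler_dist_telescope (R : realType) (F : nat -> R) (c : R) n :
  (forall k, (k < n)%N -> `|F k.+1 - F k| <= c) -> `|F n - F 0%N| <= n%:R * c.
Proof.
elim: n => [|n IH] h; first by rewrite subrr normr0 mul0r.
rewrite -(subrKA (F n)) mulrS mulrDl mul1r (le_trans (ler_normD _ _))//.
by rewrite lerD// ?h// IH// => k kn; rewrite h// ltnW.
Qed.

Lemma ler_telescope (R : realType) (F : nat -> R) (c : R) n :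
  (forall k, (k < n)%N -> F k.+1 - F k <= c) -> F n - F 0%N <= n%:R * c.
Proof.
elim: n => [|n IH] h; first by rewrite subrr mul0r.
rewrite -(subrKA (F n)) mulrS mulrDl mul1r lerD ?h// IH// => k kn.
by rewrite h// ltnW.
Qed.

(** The restriction [e <= 1] allows [c] to be fixed before [e], even when it has to bound quantities
    that vary with [e]. *)
Lemma le0_of_small (R : realType) (a c : R) :
  (forall e : R, 0 < e -> e <= 1 -> a <= e * c) -> a <= 0.
Proof.
move=> h; rewrite leNgt; apply/negP => a0.
have c1 : 0 < `|c| + 1 by rewrite ltr_wpDl.
have a2 : 0 < a / (2 * (`|c| + 1)) by rewrite divr_gt0// mulr_gt0.
have e0 : 0 < Num.min 1 (a / (2 * (`|c| + 1))) by rewrite lt_min ltr01.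
have := h _ e0; rewrite ge_min lexx => /(_ isT); apply/negP; rewrite -ltNge.
apply: (@le_lt_trans _ _ (a / (2 * (`|c| + 1)) * (`|c| + 1))).
  apply: (@le_trans _ _ (Num.min 1 (a / (2 * (`|c| + 1))) * (`|c| + 1))).
    by rewrite ler_wpM2l ?(ltW e0)// (le_trans (ler_norm _))// lerDl.
  by rewrite ler_wpM2r ?(ltW c1)// ge_min lexx orbT.
by rewrite invfM mulrA mulfVK ?gt_eqF//; lra.
Qed.

Lemma exists_small_step (R : realType) (t d : R) : 0 <= t -> 0 < d ->
  exists n, t / n.+1%:R < d.
Proof.
move=> t0 d0; exists (Num.truncn (t / d)).
by rewrite ltr_pdivrMr// mulrC -ltr_pdivrMr// truncnS_gt.
Qed.

Lemma exists_primitive (R : realType) (f : R -> R) (a b : R) : continuous f ->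
  exists F : R -> R, forall x, x \in `]a, b[ -> is_derive x 1 F (f x).
Proof.
move=> cf; exists (fun x => \int[lebesgue_measure]_(t in `[a, x]) f t)%R.
move=> x; rewrite in_itv/= => /andP[ax xb].
have [] := @continuous_FTC1_closed R f a x b xb _ ax (cf x).
  apply: continuous_compact_integrable; first exact: segment_compact.
  exact: continuous_subspaceT.
move=> dF dE; split; first exact: dF.
by rewrite -derive1E dE.
Qed.

(** * Strongly continuous semigroups *)

Section semigroup.
Context (R : realType) (V : lmodType R) (B : semi_inner V).
Hypothesis Bcomplete : complete_ip B.
Variable S : R -> V -> V.
Local Notation "`N x" := (nrm B x) (at level 10).
Local Notation "x =~ y" := (eqn B x y) (at level 70).

Let nrm_ge0B x : 0 <= `N x := nrm_ge0 B x.
Let eqn_reflB x : x =~ x := eqn_refl B x.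
#[local] Hint Resolve nrm_ge0B eqn_reflB : core.

Hypothesis S_lin : forall t : R, 0 < t -> forall a x y,
  S t (a *: x + y) =~ a *: S t x + S t y.
Hypothesis S_bdd : forall t : R, 0 < t -> exists M : R, forall x, `N (S t x) <= M * `N x.
Hypothesis S_law : forall s t : R, 0 < s -> 0 < t -> forall x, S (s + t) x =~ S s (S t x).
Hypothesis S_cont : forall x (e : R), 0 < e ->
  exists2 d : R, 0 < d & forall t : R, 0 < t -> t < d -> `N (S t x - x) <= e.

Definition ipgen x y := forall e : R, 0 < e ->
  exists2 d : R, 0 < d & forall h : R, 0 < h -> h < d -> `N (h^-1 *: (S h x - x) - y) <= e.

(** Extends [S] by the identity to nonpositive times, so that the semigroup law holds from time 0 on
    and bounds up to a time [r] need no sign condition. *)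
Let T (t : R) x := if 0 < t then S t x else x.

Let T0 t x : t <= 0 -> T t x = x.
Proof. by rewrite /T ltNge => ->. Qed.

Let TP t x : 0 < t -> T t x = S t x.
Proof. by rewrite /T => ->. Qed.

Let T_lin t a x y : T t (a *: x + y) =~ a *: T t x + T t y.
Proof. by rewrite /T; case: ifPn => // t0; exact: S_lin. Qed.

Let T_bdd t : exists2 M : R, 0 <= M & forall x, `N (T t x) <= M * `N x.
Proof.
have [t0|t0] := ltP 0 t; last by exists 1 => // x; rewrite T0// mul1r.
have [M hM] := S_bdd t0; exists (Num.max M 0); first by rewrite le_max lexx orbT.
move=> x; rewrite TP// (le_trans (hM x))// ler_wpM2r// le_max lexx//.
Qed.

Let T_z t : T t 0 =~ 0.
Proof.
have := T_lin t (-1) 0 0; rewrite scaler0 addr0 scaleN1r addNr => h; exact: h.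
Qed.

Let T_D t x y : T t (x + y) =~ T t x + T t y.
Proof. by have := T_lin t 1 x y; rewrite !scale1r. Qed.

Let T_Z t a x : T t (a *: x) =~ a *: T t x.
Proof.
have := T_lin t a x 0; rewrite addr0 => /eqn_trans; apply.
by rewrite -[X in _ =~ X]addr0; apply: eqnD.
Qed.

Let T_B t x y : T t (x - y) =~ T t x - T t y.
Proof.
apply: (eqn_trans (T_D _ _ _)); apply: eqnD => //.
by rewrite -scaleN1r; apply: (eqn_trans (T_Z _ _ _)); rewrite scaleN1r.
Qed.

Let T_law s t x : 0 <= s -> 0 <= t -> T (s + t) x =~ T s (T t x).
Proof.
rewrite le_eqVlt => /predU1P[<- _|s0]; first by rewrite add0r [T 0 _]T0.
rewrite le_eqVlt => /predU1P[<-|t0]; first by rewrite addr0 [T 0 x]T0.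
by rewrite !TP ?addr_gt0//; exact: S_law.
Qed.

Let T_sum t I (r : seq I) (F : I -> V) :
  T t (\sum_(i <- r) F i) =~ \sum_(i <- r) T t (F i).
Proof.
elim: r => [|i r IH]; first by rewrite !big_nil.
by rewrite !big_cons; apply: (eqn_trans (T_D _ _ _)); exact: eqnD.
Qed.

Let T_cont x e : 0 < e ->
  exists2 d : R, 0 < d & forall t : R, 0 <= t -> t < d -> `N (T t x - x) <= e.
Proof.
move=> e0; have [d d0 h] := S_cont x e0; exists d => // t.
rewrite le_eqVlt => /predU1P[<- _|t0 td]; last by rewrite TP// h.
by rewrite T0// subrr nrm0 ltW.
Qed.

(* The uniform boundedness principle, by Sokal's gliding-hump argument. *)
Let T_bdd_near0 : exists2 d : R, 0 < d & exists2 M : R, 0 <= M &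
  forall t : R, 0 <= t -> t < d -> forall x, `N (T t x) <= M * `N x.
Proof.
apply: contrapT => unbdd.
(* The last estimate retains the fraction [(2 / 3 - 1 / 2) * 3^-1 ^+ n] of [sup (E n)]; with
   [K n <= sup (E n)] exactly [n] is left. *)
pose K n : R := 6 * 3 ^+ n * n%:R.
have /choice[t_ ht] n : exists t : R, [/\ 0 <= t, t < n.+1%:R^-1 &
    exists x, K n * `N x < `N (T t x)].
  apply: contrapT => h; apply: unbdd; exists n.+1%:R^-1; rewrite ?invr_gt0//.
  exists (K n); first by rewrite !mulr_ge0.
  move=> t t0 tn x; rewrite leNgt; apply/negP => Kx; apply: h.
  by exists t; split => //; exists x.
pose E n := [set `N (T (t_ n) x) | x in [set x | `N x <= 1]].
have E_sup n : has_sup (E n).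
  split; first by exists (`N (T (t_ n) 0)), 0 => //=; rewrite nrm0.
  have [M M0 hM] := T_bdd (t_ n); exists M => _ [x /= x1 <-].
  by rewrite (le_trans (hM _))// ler_piMr.
have K_sup n : K n <= sup (E n).
  have [_ _ [x Kx]] := ht n.
  have x0 : 0 < `N x.
    rewrite lt_neqAle eq_sym nrm_ge0 andbT; apply/eqP => x0.
    have [M _ /(_ x)] := T_bdd (t_ n); rewrite x0 mulr0.
    by move: Kx; rewrite x0 mulr0 ltNge => /negP.
  apply: (@le_trans _ _ (`N (T (t_ n) ((`N x)^-1 *: x)))).
    rewrite (eqn_nrm (T_Z _ _ _)) nrmZ ger0_norm ?invr_ge0// mulrC ler_pdivlMr//.
    exact: ltW.
  apply: ub_le_sup; first by case: (E_sup n).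
  by exists ((`N x)^-1 *: x) => //=; rewrite nrmZ ger0_norm ?invr_ge0// mulVf ?gt_eqF.
have sup_bdd n x : `N (T (t_ n) x) <= sup (E n) * `N x.
  have [x0|x0] := eqVneq (`N x) 0.
    by have [M _ /(_ x)] := T_bdd (t_ n); rewrite x0 !mulr0.
  have {}x0 : 0 < `N x by rewrite lt_neqAle eq_sym x0 nrm_ge0.
  rewrite -ler_pdivrMr//; apply: ub_le_sup; first by case: (E_sup n).
  exists ((`N x)^-1 *: x) => /=.
    by rewrite nrmZ ger0_norm ?invr_ge0// mulVf ?gt_eqF.
  by rewrite (eqn_nrm (T_Z _ _ _)) nrmZ ger0_norm ?invr_ge0// mulrC.
have /choice[y_ hy] n : exists y, `N y <= 1 /\ 2 / 3 * sup (E n) <= `N (T (t_ n) y).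
  have [s0|s0] := leP (sup (E n)) 0.
    exists 0; split; first by rewrite nrm0.
    by rewrite (le_trans _ (nrm_ge0 _ _))// pmulr_rle0// divr_gt0.
  have [_ [y /= y1 <-] sy] := @sup_adherent _ (E n) (1 / 3 * sup (E n))
    (mulr_gt0 (divr_gt0 ltr01 (ltr0n _ 3)) s0) (E_sup n).
  exists y; split => //; apply/ltW; apply: le_lt_trans sy; lra.
(* One of [z + c *: y_ n] and [z - c *: y_ n] works: their images differ by [2 * c] times
   [T (t_ n) (y_ n)], so they cannot both be small. *)
have step n z : exists w, `N (w - z) <= 3^-1 ^+ n /\
    2 / 3 * sup (E n) * 3^-1 ^+ n <= `N (T (t_ n) w).
  have [y1 yT] := hy n; set c := 3^-1 ^+ n.
  have c0 : 0 <= c by rewrite exprn_ge0.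
  have [] := lerP (2 / 3 * sup (E n) * c) (`N (T (t_ n) (z + c *: y_ n))) => h.
    exists (z + c *: y_ n); split => //.
    by rewrite addrAC subrr add0r nrmZ ger0_norm// ler_piMr.
  exists (z - c *: y_ n); split.
    by rewrite addrAC subrr add0r nrmN nrmZ ger0_norm// ler_piMr.
  rewrite leNgt; apply/negP => h'.
  have := nrmD B (T (t_ n) (z + c *: y_ n)) (- T (t_ n) (z - c *: y_ n)).
  rewrite nrmN leNgt => /negP; apply.
  have -> : `N (T (t_ n) (z + c *: y_ n) - T (t_ n) (z - c *: y_ n)) =
      2 * c * `N (T (t_ n) (y_ n)).
    rewrite (eqn_nrm (eqn_sym (T_B _ _ _))) opprB addrC addrA subrK -scalerDl.
    rewrite (eqn_nrm (T_Z _ _ _)) nrmZ ger0_norm ?addr_ge0//; ring.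
  have : 2 / 3 * sup (E n) * c <= `N (T (t_ n) (y_ n)) * c by rewrite ler_wpM2r.
  lra.
have {step} [z [z0 hz]] : exists z : nat -> V, z 0%N = 0 /\
    forall n, `N (z n.+1 - z n) <= 3^-1 ^+ n /\
      2 / 3 * sup (E n) * 3^-1 ^+ n <= `N (T (t_ n) (z n.+1)).
  have /choice[f hf] : forall p : nat * V, exists w, `N (w - p.2) <= 3^-1 ^+ p.1 /\
    2 / 3 * sup (E p.1) * 3^-1 ^+ p.1 <= `N (T (t_ p.1) w) by move=> p; exact: step.
  pose z := fix z n := if n is m.+1 then f (m, z m) else 0.
  by exists z; split => // n; have := hf (n, z n).
(* The exact partial sum of the geometric series, which makes the induction step an identity. *)
have z_cauchy m k : `N (z (m + k)%N - z m) <= 3 / 2 * 3^-1 ^+ m * (1 - 3^-1 ^+ k).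
  elim: k => [|k IH]; first by rewrite addn0 subrr nrm0 expr0 subrr mulr0.
  have [h _] := hz (m + k)%N.
  rewrite addnS (le_trans (nrm_sub_trans B (z (m + k)%N) _ _))//.
  rewrite (le_trans (lerD h IH))// exprD exprS le_eqVlt; apply/orP; left; apply/eqP.
  by field.
have e3 n : 0 < 3^-1 ^+ n :> R by rewrite exprn_gt0// invr_gt0.
have e31 n : 3^-1 ^+ n <= 1 :> R by rewrite exprn_ile1// invf_le1// ler1n.
have z_cauchy' m k : `N (z (m + k)%N - z m) <= 3 / 2 * 3^-1 ^+ m.
  by rewrite (le_trans (z_cauchy _ _))// ler_piMr// ?mulr_ge0// ?ltW// gerBl ltW.
have e3cvg (e : R) : 0 < e -> exists N, forall n, (N <= n)%N -> 3^-1 ^+ n <= e.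
  move=> e0; have : 3^-1 ^+ n @[n --> \oo] --> (0 : R).
    by apply: cvg_expr; rewrite ger0_norm// invf_lt1// ltr1n.
  move=> /cvgrPdist_le /(_ e e0)[N _ hN]; exists N => n Nn.
  by have := hN n Nn; rewrite sub0r normrN; exact: le_trans (ler_norm _).
have [|zz hzz] := Bcomplete (u := z).
  move=> e e0; have [N hN] := e3cvg (e / 3) (divr_gt0 e0 (ltr0n _ 3)).
  exists N => m n Nm Nn; rewrite (le_trans (nrm_sub_trans B (z N) _ _))//.
  rewrite (nrmB B (z N)); have := z_cauchy' N (m - N)%N.
  by have := z_cauchy' N (n - N)%N; rewrite !subnKC//; have := hN N (leqnn N); lra.
have zzn n : `N (zz - z n.+1) <= 1 / 2 * 3^-1 ^+ n.
  apply/ler_addgt0Pr => e e0; have [N hN] := hzz e e0.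
  rewrite (le_trans (nrm_sub_trans B (z (n.+1 + N)%N) _ _))// addrC lerD//.
    apply: (le_trans (z_cauchy' _ _)); rewrite exprS le_eqVlt; apply/orP; left.
    by apply/eqP; field.
  by rewrite nrmB hN// leq_addl.
have big n : n%:R <= `N (T (t_ n) zz).
  have [_ h] := hz n.
  have h1 : `N (T (t_ n) (z n.+1)) - `N (T (t_ n) zz) <= sup (E n) * (1 / 2 * 3^-1 ^+ n).
    rewrite (le_trans (ler_nrmB B _ _))// (eqn_nrm (eqn_sym (T_B _ _ _))).
    rewrite (le_trans (sup_bdd _ _))// ler_wpM2l//; last by rewrite nrmB.
    by rewrite (le_trans _ (K_sup _))// !mulr_ge0.
  have h2 : n%:R <= 1 / 6 * sup (E n) * 3^-1 ^+ n.
    have : 1 / 6 * K n * 3^-1 ^+ n <= 1 / 6 * sup (E n) * 3^-1 ^+ n.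
      by apply: ler_wpM2r; [exact: ltW|apply: ler_wpM2l => //; rewrite divr_ge0].
    apply: le_trans; rewrite /K exprVn le_eqVlt; apply/orP; left; apply/eqP.
    by field; rewrite expf_neq0.
  lra.
(* Strong continuity at the single vector [zz] bounds [T t zz] by [N zz + 1] near 0, which
   contradicts [big] at the times [t_ k], as these tend to 0. *)
have [d d0 hd] := T_cont zz ltr01.
have [k [k1 k2]] : exists n, n.+1%:R^-1 < d /\ `N zz + 1 < n%:R.
  have [N1 _ hN1] := near_infty_natSinv_lt (PosNum d0).
  have [N2 hN2] : exists N2, `N zz + 1 < N2%:R.
    by exists (Num.truncn (`N zz + 1)).+1; exact: truncnS_gt.
  exists (maxn N1 N2); split; first by apply: hN1; rewrite /= leq_maxl.
  by rewrite (lt_le_trans hN2)// ler_nat leq_maxr.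
have [t0 tk _] := ht k.
have := hd _ t0 (lt_trans tk k1).
have := ler_nrmB B (T (t_ k) zz) zz; have := big k; lra.
Qed.

(** The bound near 0 is iterated through the semigroup law in steps of length [d / 2], each costing
    a factor [M]. Taking [M >= 1] makes the powers increase and covers the negative times, where [T]
    is the identity. *)
Let T_bddW r : exists2 M : R, 0 < M &
  forall t : R, t <= r -> forall x, `N (T t x) <= M * `N x.
Proof.
have [d d0 [M0 M00 hM]] := T_bdd_near0.
pose M := M0 + 1; have M1 : 1 <= M by rewrite lerDr.
have M_gt0 : 0 < M by rewrite ltr_wpDl.
have {}hM t x : t < d -> `N (T t x) <= M * `N x.
  move=> td; have [t0|/ltW t0] := leP 0 t; last by rewrite T0// ler_peMl.
  by rewrite (le_trans (hM _ t0 td _))// ler_wpM2r// lerDl.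
have hn n : forall t : R, t <= n%:R * (d / 2) -> forall x, `N (T t x) <= M ^+ n.+1 * `N x.
  elim: n => [|n IH] t.
    rewrite mul0r => t0 x; rewrite T0// expr1 ler_peMl//.
  have [td _ x|dt] := ltP t d.
    by rewrite (le_trans (hM _ _ td))// ler_wpM2r// exprS ler_peMr// ?exprn_ege1// ltW.
  move=> tn x; have d2 : 0 < d / 2 by rewrite divr_gt0.
  have -> : t = (t - d / 2) + d / 2 by rewrite subrK.
  rewrite (eqn_nrm (T_law _ _ _)) ?(ltW d2)//; last lra.
  apply: (@le_trans _ _ (M ^+ n.+1 * `N (T (d / 2) x))).
    by apply: IH; move: tn; rewrite -natr1 mulrDl mul1r; lra.
  rewrite [M ^+ n.+2]exprS mulrC -mulrA (mulrC (M ^+ _)) mulrA ler_wpM2r ?exprn_ge0 ?(ltW M_gt0)//.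
  by apply: hM; lra.
have d2 : 0 < d / 2 by rewrite divr_gt0.
exists (M ^+ (Num.truncn (r / (d / 2))).+2); first by rewrite exprn_gt0.
move=> t tr x; apply: hn; apply: (le_trans tr).
by rewrite -ler_pdivrMr// ltW// truncnS_gt.
Qed.

Let T_contW r x e : 0 < e -> exists2 d : R, 0 < d &
  forall s t : R, s <= r -> t <= r -> `|s - t| < d -> `N (T s x - T t x) <= e.
Proof.
move=> e0; have [M M0 hM] := T_bddW r.
have e'0 : 0 < Num.min e (e / M) by rewrite lt_min e0 divr_gt0.
have [d d0 hd] := T_cont x e'0; exists d => // s t.
wlog st : s t / s <= t.
  move=> h sr tr dst; have [/h|/ltW/h] := leP s t; first exact.
  by rewrite nrmB distrC; exact.
move=> sr tr; rewrite ler0_norm ?subr_le0// opprB => dst.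
have [s0|/ltW s0] := leP 0 s.
  have -> : t = s + (t - s) by rewrite subrKC.
  rewrite (eqn_nrm (eqnB (eqn_refl _ _) (T_law _ _ _))) ?subr_ge0//.
  rewrite (eqn_nrm (eqn_sym (T_B _ _ _))) (le_trans (hM _ sr _))// nrmB.
  rewrite mulrC -ler_pdivlMr// (le_trans (hd _ _ _)) ?subr_ge0//.
  by rewrite ge_min lexx orbT.
rewrite (T0 _ s0); have [t0|/ltW t0] := leP 0 t; last first.
  by rewrite T0// subrr nrm0 ltW.
rewrite nrmB (le_trans (hd _ _ _))// ?ge_min ?lexx//.
by rewrite (le_lt_trans _ dst)// lerDl oppr_ge0.
Qed.

Let gen_step x x' : ipgen x x' -> forall e : R, 0 < e -> exists2 d : R, 0 < d &
  forall h : R, 0 < h -> h < d -> `N (T h x - x - h *: x') <= h * e.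
Proof.
move=> g e e0; have [d d0 hd] := g e e0; exists d => // h h0 hd'.
have := hd h h0 hd'; rewrite -(TP x h0) => /(ler_wpM2l (ltW h0)); apply: le_trans.
rewrite -[X in X * _](gtr0_norm h0) -nrmZ scalerBr scalerA mulfV ?gt_eqF//.
by rewrite scale1r.
Qed.

(** [T s] is bounded and commutes with [T h], hence it carries the difference quotients at [x] to
    those at [T s x]. *)
Let gen_T s x x' : 0 <= s -> ipgen x x' -> ipgen (T s x) (T s x').
Proof.
move=> s0 g e e0; have [M M0 hM] := T_bddW s.
have [d d0 hd] := g (e / M) (divr_gt0 e0 M0); exists d => // h h0 hd'.
have := hd h h0 hd'; rewrite ler_pdivlMr// mulrC; apply: le_trans.
apply: le_trans (hM _ (lexx s) _); rewrite le_eqVlt; apply/orP; left; apply/eqP.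
apply: eqn_nrm; apply: eqn_sym; apply: (eqn_trans (T_B _ _ _)); apply: eqnB => //.
apply: (eqn_trans (T_Z _ _ _)); apply: eqnZ.
apply: (eqn_trans (T_B _ _ _)); apply: eqnB => //.
rewrite -!(TP _ h0); apply: (eqn_trans (eqn_sym (T_law _ _ _))) => //; first exact: ltW.
by rewrite addrC; apply: T_law => //; exact: ltW.
Qed.

(** A first-order expansion of the orbit at time [s]. The remainder is [T s] applied to a vector of
    size o(h), which [gen_step] and [T_bddW] control. *)
Let T_step s h x x' : 0 <= s -> 0 <= h ->
  T (s + h) x =~ T s x + h *: T s x' + T s (T h x - x - h *: x').
Proof.
move=> s0 h0; apply: (eqn_trans (T_law _ _ _)) => //.
have E : T h x = x + h *: x' + (T h x - x - h *: x').
  by rewrite -(addrA (T h x)) -opprD subrKC.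
rewrite [X in T s X =~ _]E.
apply: (eqn_trans (T_D _ _ _)); apply: eqnD => //.
apply: (eqn_trans (T_D _ _ _)); apply: eqnD => //; exact: T_Z.
Qed.

(* [T (n h) x - x] telescopes into n terms of size o(h). *)
Lemma gen0_fix x t : ipgen x 0 -> 0 < t -> S t x =~ x.
Proof.
move=> g t0; rewrite -(TP x t0); apply/eqP; rewrite eq_le nrm_ge0 andbT.
have [M M0 hM] := T_bddW t.
apply: (@le0_of_small _ _ (t * M)) => e e0 _.
have [d d0 hd] := gen_step g e0.
have [n nd] := exists_small_step (ltW t0) d0; set h := t / n.+1%:R in nd.
have h0 : 0 < h by rewrite divr_gt0.
pose F k : R := `N (T (k%:R * h) x - x).
have nh : n.+1%:R * h = t by rewrite /h mulrCA mulfV ?mulr1// pnatr_eq0.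
have F0 : F 0%N = 0 by rewrite /F mul0r T0// subrr nrm0.
have Fn : F n.+1 = `N (T t x - x) by rewrite /F nh.
rewrite -Fn -[F _]subr0 -F0 (_ : e * _ = n.+1%:R * (M * (h * e))); last first.
  by rewrite -nh; ring.
apply: ler_telescope => k kn.
have kh0 : 0 <= k%:R * h by rewrite mulr_ge0// ltW.
have kt : k%:R * h <= t by rewrite -nh ler_wpM2r ?(ltW h0)// ler_nat ltnW.
rewrite /F -natr1 mulrDl mul1r (le_trans (ler_nrmB B _ _))//.
rewrite opprB addrA subrK.
have := hd h h0 nd; rewrite scaler0 subr0 => /(ler_wpM2l (ltW M0)); apply: le_trans.
apply: le_trans (hM _ kt _).
rewrite (eqn_nrm (T_B _ _ _)) (eqn_nrm (eqnB (T_law _ _ _) (eqn_refl _ _)))//.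
exact: ltW.
Qed.

(** * Symmetry and contractivity from the generator *)

Hypothesis gen_sym : forall x x' y y', ipgen x x' -> ipgen y y' -> B x' y = B x y'.

(** The function [s |-> B (T s x) (T (t - s) y)] has derivative [B (T s x') (T (t - s) y) - B (T s
    x) (T (t - s) y')], which is 0 by [gen_sym] because the domain is invariant. Its values at [t]
    and 0 are the two sides. *)
Let T_sym_dom t x x' y y' : 0 <= t -> ipgen x x' -> ipgen y y' ->
  B (T t x) y = B x (T t y).
Proof.
move=> t0 gx gy; have [M M0 hM] := T_bddW t.
apply/eqP; rewrite -subr_eq0 -normr_le0.
apply: (@le0_of_small _ _ (t * (M * M * (`N x + `N y)))) => e e0 _.
have [d1 d10 hd1] := gen_step gx e0; have [d2 d20 hd2] := gen_step gy e0.
have d0 : 0 < Num.min d1 d2 by rewrite lt_min d10.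
have [n] := exists_small_step t0 d0; set h := t / n.+1%:R; rewrite lt_min => /andP[nd1 nd2].
have := t0; rewrite le_eqVlt => /predU1P[t00|{}t0].
  by rewrite !T0 -?t00// subrr normr0 mul0r mulr0.
have h0 : 0 < h by rewrite divr_gt0.
have nh : n.+1%:R * h = t by rewrite /h mulrCA mulfV ?mulr1// pnatr_eq0.
pose F k : R := B (T (k%:R * h) x) (T (t - k%:R * h) y).
have F0 : F 0%N = B x (T t y) by rewrite /F mul0r subr0 T0.
have Fn : F n.+1 = B (T t x) y by rewrite /F nh subrr [T 0 y]T0.
rewrite -F0 -Fn (_ : e * _ = n.+1%:R * (h * e * (M * M * (`N x + `N y)))); last first.
  by rewrite -nh; ring.
apply: ler_dist_telescope => k kn.
have kh0 : 0 <= k%:R * h by rewrite mulr_ge0// ltW.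
have kt : k%:R * h <= t by rewrite -nh ler_wpM2r ?(ltW h0)// ler_nat ltnW.
have kt' : k.+1%:R * h <= t by rewrite -nh ler_wpM2r ?(ltW h0)// ler_nat.
set s := k%:R * h in kh0 kt *; pose s' := t - k.+1%:R * h.
have s'0 : 0 <= s' by rewrite subr_ge0.
have s't : s' <= t by rewrite gerBl mulr_ge0// ltW.
have e1 : k.+1%:R * h = s + h by rewrite -natr1 mulrDl mul1r.
have e2 : t - s = s' + h by rewrite /s' e1; ring.
rewrite /F -/s e2 -/s' e1.
rewrite (eqn_ip (T_step x x' kh0 (ltW h0)) (eqn_refl _ _)).
rewrite (eqn_ip (eqn_refl _ (T s x)) (T_step y y' s'0 (ltW h0))).
rewrite !ipDl !ipDr ipZl ipZr (gen_sym (gen_T kh0 gx) (gen_T s'0 gy)).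
set r := T h x - x - _; set r' := T h y - y - _.
rewrite (_ : _ - _ = B (T s r) (T s' y) - B (T s x) (T s' r')); last by ring.
rewrite (le_trans (ler_normB _ _))//.
rewrite (_ : h * e * _ = (M * (h * e)) * (M * `N y) + (M * `N x) * (M * (h * e))); last by ring.
have he0 : 0 <= h * e by rewrite mulr_ge0// ltW.
have hr := hd1 h h0 nd1; have hr' := hd2 h h0 nd2.
apply: lerD; apply: (le_trans (cauchy_schwarz _ _ _)); apply: ler_pM => //; try exact: hM.
  by rewrite (le_trans (hM _ kt _))// ler_wpM2l// ltW.
by rewrite (le_trans (hM _ s't _))// ler_wpM2l// ltW.
Qed.

Hypothesis gen_diss : forall x x', ipgen x x' -> B x' x <= 0.

(** The derivative of the squared norm of [T t x] is [2 * B (T t x') (T t x)], which is nonpositive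
    by [gen_diss]. *)
Let T_contr_dom t x x' : 0 <= t -> ipgen x x' -> `N (T t x) <= `N x.
Proof.
move=> t0 gx; have [M M0 hM] := T_bddW t.
rewrite -ler_sqr ?nnegrE// !sqr_nrm -subr_le0.
apply: (@le0_of_small _ _ (t * (2 * (M * M * `N x) + (M * (`N x' + 1)) ^+ 2))) => e e0 e1.
have [d1 d10 hd1] := gen_step gx e0.
(* Steps shorter than [e] turn the quadratic remainder, of order [h ^+ 2], into one of order
   [h * e]. *)
have d0 : 0 < Num.min d1 e by rewrite lt_min d10.
have [n] := exists_small_step t0 d0; set h := t / n.+1%:R; rewrite lt_min => /andP[nd1 he].
have := t0; rewrite le_eqVlt => /predU1P[t00|{}t0].
  by rewrite !T0 -?t00// subrr mul0r mulr0.
have h0 : 0 < h by rewrite divr_gt0.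
have nh : n.+1%:R * h = t by rewrite /h mulrCA mulfV ?mulr1// pnatr_eq0.
pose F k : R := B (T (k%:R * h) x) (T (k%:R * h) x).
have F0 : F 0%N = B x x by rewrite /F mul0r T0.
have Fn : F n.+1 = B (T t x) (T t x) by rewrite /F nh.
set c := _ + _ ^+ 2.
rewrite -F0 -Fn (_ : e * _ = n.+1%:R * (h * e * c)); last by rewrite -nh; ring.
apply: ler_telescope => k kn.
have kh0 : 0 <= k%:R * h by rewrite mulr_ge0// ltW.
have kt : k%:R * h <= t by rewrite -nh ler_wpM2r ?(ltW h0)// ler_nat ltnW.
set s := k%:R * h in kh0 kt *.
have -> : F k.+1 = B (T (s + h) x) (T (s + h) x).
  by rewrite /F -natr1 mulrDl mul1r.
have st := T_step x x' kh0 (ltW h0); rewrite (eqn_ip st st) /F -/s.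
set r := T h x - x - _; rewrite -addrA.
set v := h *: T s x' + T s r.
have -> : B (T s x + v) (T s x + v) - B (T s x) (T s x) = 2 * B v (T s x) + B v v.
  by move: (T s x) v => u v; rewrite ipDl !ipDr (ipC B u v); ring.
have hr := hd1 h h0 nd1.
have hTr : `N (T s r) <= M * (h * e).
  by rewrite (le_trans (hM _ kt _))// ler_wpM2l// ltW.
have v1 : B v (T s x) <= h * e * (M * M * `N x).
  rewrite ipDl ipZl -[leRHS]add0r lerD//.
    by rewrite pmulr_rle0// gen_diss//; exact: gen_T.
  rewrite (le_trans (ler_norm _))// (le_trans (cauchy_schwarz _ _ _))//.
  rewrite (_ : h * e * _ = (M * (h * e)) * (M * `N x)); last by ring.
  by apply: ler_pM => //; exact: hM.
have v2 : B v v <= h * e * (M * (`N x' + 1)) ^+ 2.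
  rewrite -sqr_nrm; apply: (@le_trans _ _ ((h * (M * (`N x' + 1))) ^+ 2)); last first.
    by rewrite exprMn ler_wpM2r ?sqr_ge0// expr2 ler_wpM2l// ltW.
  rewrite ler_sqr ?nnegrE ?mulr_ge0 ?addr_ge0 ?(ltW h0) ?(ltW M0)//.
  rewrite (le_trans (nrmD _ _ _))// nrmZ gtr0_norm//.
  rewrite (_ : h * _ = h * (M * `N x') + M * (h * 1)); last by ring.
  rewrite lerD// ?ler_pM2l//; first exact: hM.
  by rewrite (le_trans hTr)// ler_pM2l// ler_pM2l.
  exact: ltW.
rewrite /c; lra.
Qed.

(* The Riemann sums [avg n] converge to [y = h^-1 int_0^h T s x ds], which lies in
   the domain of the generator. Vector-valued integrals are avoided: [T t y] is
   paired with [g], and [s |-> B (T s x) g] has a real primitive. *)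
Section density.
Variables (x : V) (h : R).
Hypotheses (h0 : 0 < h) (h1 : h <= 1).

Let avg n := n.+1%:R^-1 *: \sum_(k < n.+1) T (k%:R * (h / n.+1%:R)) x.

Let orbit g (s : R) : R := B (T s x) g.

Let orbit_cont g : continuous (orbit g).
Proof.
move=> s; apply/cvgrPdist_le => e e0.
have c0 : 0 < `N g + 1 by rewrite ltr_wpDl.
have [d d0 hd] := T_contW (s + 1) x (divr_gt0 e0 c0).
near=> t; rewrite /orbit -ipBl (le_trans (cauchy_schwarz _ _ _))//.
have : `|s - t| < Num.min d 1.
  near: t; apply/nbhs_ballP; exists (Num.min d 1); last by [].
  by rewrite /= lt_min d0 ltr01.
rewrite lt_min => /andP[std st1].
have st : `N (T s x - T t x) <= e / (`N g + 1).
  by apply: hd => //; rewrite ?lerDl//; move: st1; rewrite ltr_distlC; lra.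
rewrite (le_trans (ler_wpM2r (nrm_ge0 _ _) st))// -mulrA ler_piMr ?(ltW e0)//.
by rewrite mulrC ler_pdivrMr// mul1r lerDl.
Unshelve. all: by end_near. Qed.

(** Times up to 2 are enough: only [t + h] with both [t] and [h] at most 1 occurs. *)
Let primitive g : exists F : R -> R, forall s : R, 0 <= s -> s <= 2 -> is_derive s 1 F (orbit g s).
Proof.
have [F hF] := exists_primitive (-1) 3 (@orbit_cont g).
by exists F => s s0 s2; apply: hF; rewrite in_itv/=; apply/andP; split; lra.
Qed.

Let primitive_MVT (F : R -> R) g : (forall s : R, 0 <= s -> s <= 2 -> is_derive s 1 F (orbit g
  s)) ->
  forall a b : R, 0 <= a -> a <= b -> b <= 2 ->
  exists2 c, a <= c <= b & F b - F a = (b - a) * orbit g c.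
Proof.
move=> hF a b a0 ab b2.
have dF s : s \in `[a, b] -> is_derive s 1 F (orbit g s).
  by rewrite in_itv/= => /andP[as_ sb]; apply: hF; lra.
have cF : {within `[a, b], continuous F}.
  by apply: derivable_within_continuous => s sab; exact: (@ex_derive _ _ _ _ _ _ _ (dF s sab)).
have dF' s (sab : s \in `]a, b[) := dF s (subset_itv_oo_cc sab).
have [c cab E] := MVT_segment ab dF' cF.
by exists c; [move: cab; rewrite in_itv|rewrite E mulrC].
Qed.

(** On each of the [n.+1] subintervals the mean value theorem writes the increment of [F] as [q]
    times a value of the orbit, within [M * e * N g] of the value at the left end. The error is
    proportional to the norm of [g]; this lets the choice of [g] as the very vector to be estimated
    convert weak bounds into norm bounds. *)
Let avg_weak (M e : R) n (t : R) g (F : R -> R) :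
  (forall s : R, 0 <= s -> s <= 2 -> is_derive s 1 F (orbit g s)) ->
  (forall s : R, s <= 2 -> forall y, `N (T s y) <= M * `N y) -> 0 < M ->
  (forall s : R, 0 <= s -> s <= h / n.+1%:R -> `N (T s x - x) <= e) ->
  0 <= t -> t <= 1 ->
  `|h * B (T t (avg n)) g - (F (t + h) - F t)| <= h * (M * e) * `N g.
Proof.
move=> hF hM M0 he t0 t1; set q := h / n.+1%:R in he.
have q0 : 0 < q by rewrite divr_gt0.
have nq : n.+1%:R * q = h by rewrite /q mulrCA mulfV ?mulr1// pnatr_eq0.
have kq k : (k <= n.+1)%N -> k%:R * q <= h.
  by move=> kn; rewrite -nq ler_wpM2r ?(ltW q0)// ler_nat.
pose G (m : nat) : R := q * (\sum_(k < m) orbit g (t + k%:R * q)) - (F (t + m%:R * q) - F t).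
have G0 : G 0%N = 0 by rewrite /G big_ord0 mul0r mulr0 addr0 !subrr.
have -> : h * B (T t (avg n)) g - (F (t + h) - F t) = G n.+1.
  rewrite /G nq; congr (_ - _).
  rewrite (eqn_ip (T_Z _ _ _) (eqn_refl _ _)) ipZl mulrA; congr (_ * _).
  rewrite (eqn_ip (T_sum _ _ _) (eqn_refl _ _)) ip_suml; apply: eq_bigr => k _.
  rewrite /orbit (eqn_ip (T_law _ _ _) (eqn_refl _ _))// mulr_ge0// ltW//.
rewrite -[G _]subr0 -G0 (_ : h * _ * _ = n.+1%:R * (q * (M * e * `N g))); last first.
  by rewrite -nq; ring.
apply: ler_dist_telescope => k kn.
have k0 : 0 <= t + k%:R * q by rewrite addr_ge0// mulr_ge0// ltW.
have k2 : t + k.+1%:R * q <= 2 by rewrite (le_trans (lerD t1 (le_trans (kq _ kn) h1))).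
have kk : k.+1%:R * q = k%:R * q + q by rewrite -natr1 mulrDl mul1r.
have [|c /andP[c1 c2] Fc] := primitive_MVT hF k0 _ k2.
  by rewrite kk addrA lerDl ltW.
rewrite /G big_ord_recr/= mulrDr.
rewrite (_ : _ - _ = q * orbit g (t + k%:R * q) - (F (t + k.+1%:R * q) - F (t + k%:R * q)));
  last by ring.
rewrite Fc (_ : t + k.+1%:R * q - _ = q); last by rewrite kk; ring.
rewrite -mulrBr normrM gtr0_norm// ler_pM2l//.
rewrite /orbit -ipBl (le_trans (cauchy_schwarz _ _ _))// ler_wpM2r//.
rewrite nrmB -[c](subrKC (t + k%:R * q)).
rewrite (eqn_nrm (eqnB (T_law _ _ _) (eqn_refl _ _)))//; last by rewrite subr_ge0.
rewrite (eqn_nrm (eqn_sym (T_B _ _ _))) (le_trans (hM _ _ _))//; last first.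
  by rewrite ler_pM2l// he ?subr_ge0//; lra.
lra.
Qed.

Lemma gen_dense e : 0 < e -> (forall s : R, 0 <= s -> s <= h -> `N (T s x - x) <= e) ->
  exists y, `N (y - x) <= e /\ exists y', ipgen y y'.
Proof.
move=> e0 he.
have [M M1 hM] : exists2 M : R, 1 <= M & forall s : R, s <= 2 -> forall y, `N (T s y) <= M * `N y.
  have [M M0 hM] := T_bddW 2; exists (M + 1); first by rewrite lerDr ltW.
  by move=> s s2 y; rewrite (le_trans (hM _ s2 _))// ler_wpM2r// lerDl.
have M0 : 0 < M by exact: lt_le_trans M1.
have step (a : R) : 0 < a -> exists N, forall n, (N <= n)%N ->
    forall s : R, 0 <= s -> s <= h / n.+1%:R -> `N (T s x - x) <= a.
  move=> a0; have [d d0 hd] := T_cont x a0.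
  have [N hN] := exists_small_step (ltW h0) d0; exists N => n Nn s s0 sn.
  apply: hd => //; apply: (le_lt_trans sn); apply: le_lt_trans hN.
  by rewrite ler_pM2l// lef_pV2 ?posrE// ler_nat.
have [|y hy] := Bcomplete (u := avg).
  move=> a a0; have a2 : 0 < a / (2 * M) by rewrite divr_gt0// mulr_gt0.
  have [N hN] := step _ a2; exists N => m n Nm Nn.
  (* The vector to be bounded is its own test vector: the primitive cancels between the two
     estimates, which leaves [N g ^+ 2 <= a * N g]. *)
  set g := avg m - avg n.
  have [F hF] := primitive g.
  have := avg_weak hF hM M0 (hN _ Nm) (lexx _) ler01.
  have := avg_weak hF hM M0 (hN _ Nn) (lexx _) ler01.
  rewrite add0r [T 0 _]T0// [T 0 _]T0// => h2 h3.
  have : h * `N g ^+ 2 <= h * a * `N g.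
    have -> : h * a * `N g = h * (M * (a / (2 * M))) * `N g + h * (M * (a / (2 * M))) * `N g.
      by field; rewrite gt_eqF.
    have E : B g g = B (avg m) g - B (avg n) g by rewrite -ipBl.
    rewrite sqr_nrm E; move: h2 h3; rewrite !ler_norml => /andP[+ _] /andP[_ +].
    move: (B (avg m) g) (B (avg n) g) => u v; lra.
  rewrite -mulrA ler_pM2l// expr2.
  have := nrm_ge0 B g; rewrite le_eqVlt => /predU1P[<- _|g0]; first exact: ltW.
  by rewrite ler_pM2r.
have exact_weak (t : R) g (F : R -> R) : (forall s : R, 0 <= s -> s <= 2 -> is_derive s 1 F
  (orbit g s)) ->
    0 <= t -> t <= 1 -> h * B (T t y) g = F (t + h) - F t.
  move=> hF t0 t1; apply/eqP; rewrite -subr_eq0 -normr_le0.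
  apply: (@le0_of_small _ _ (2 * h * M * `N g)) => a a0 _.
  have [N1 hN1] := step _ a0; have [N2 hN2] := hy _ a0.
  pose n := maxn N1 N2; have := hN2 n (leq_maxr _ _).
  have := avg_weak hF hM M0 (hN1 n (leq_maxl _ _)) t0 t1 => k1 k2.
  rewrite (_ : _ - _ = h * B (T t (avg n)) g - (F (t + h) - F t) - h * B (T t (avg n - y)) g).
    rewrite (le_trans (ler_normB _ _))//.
    rewrite (_ : a * _ = h * (M * a) * `N g + h * (M * a * `N g)); last by ring.
    rewrite lerD// normrM gtr0_norm// ler_pM2l//.
    rewrite (le_trans (cauchy_schwarz _ _ _))// ler_wpM2r// (le_trans (hM _ _ _))//; first lra.
    by rewrite ler_pM2l.
  by rewrite (eqn_ip (T_B _ _ _) (eqn_refl _ _)) ipBl; ring.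
have T_avg n : `N (avg n - x) <= e.
  rewrite (_ : avg n - x = n.+1%:R^-1 *: \sum_(k < n.+1) (T (k%:R * (h / n.+1%:R)) x - x)).
    rewrite nrmZ gtr0_norm ?invr_gt0// mulrC ler_pdivrMr//.
    rewrite (le_trans (nrm_sum _ _ _ _))//.
    rewrite (le_trans (ler_sum _ (G := fun=> e) _))//; last first.
      by rewrite sumr_const card_ord mulr_natr.
    move=> k _; apply: he; first by rewrite mulr_ge0// divr_ge0// ltW.
    by rewrite mulrCA ler_piMr ?(ltW h0)// ler_pdivrMr// mul1r ler_nat ltnW.
  rewrite sumrB scalerBr sumr_const card_ord -(scaler_nat n.+1 x) scalerA mulVf ?scale1r//.
exists y; split.
  apply/ler_addgt0Pr => a a0; have [N hN] := hy _ a0.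
  rewrite (le_trans (nrm_sub_trans B (avg N) _ _))// addrC lerD//.
  by rewrite nrmB hN.
(* The generator maps the mean of the orbit over [[0, h]] to its difference quotient over that
   interval. Again the error, [z] below, is tested against itself. *)
exists (h^-1 *: (T h x - x)) => a a0.
have c0 : 0 < h * a / (2 * M) by rewrite divr_gt0// mulr_gt0.
have [d d0 hd] := T_cont x c0.
have d10 : 0 < Num.min d 1 by rewrite lt_min d0 ltr01.
exists (Num.min d 1) => // t t0; rewrite lt_min => /andP[td t1].
rewrite -(TP y t0); set z := _ - _; have [F hF] := primitive z.
have E1 := exact_weak t z F hF (ltW t0) (ltW t1).
have := exact_weak 0 z F hF (lexx _) ler01; rewrite add0r [T 0 y]T0// => E0.
have [c1 /andP[c11 c12] F1] : exists2 c, h <= c <= t + h & F (t + h) - F h = (t + h - h) * orbit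
  z c.
  by apply: (primitive_MVT hF); have := h1; have := h0; lra.
have [c2 /andP[c21 c22] F2] : exists2 c, 0 <= c <= t & F t - F 0 = (t - 0) * orbit z c.
  by apply: (primitive_MVT hF); have := h1; have := h0; lra.
rewrite addrK in F1; rewrite subr0 in F2.
(* Regrouping [(F (t + h) - F t) - (F h - F 0)] as [(F (t + h) - F h) - (F t - F 0)] leaves
   increments over two intervals of length [t], one starting at [h] and one at 0. *)
have key : B (t^-1 *: (T t y - y)) z = h^-1 * (orbit z c1 - orbit z c2).
  have Q : h * (B (T t y) z - B y z) = t * (orbit z c1 - orbit z c2).
    by rewrite !mulrBr E1 E0 -F1 -F2; ring.
  rewrite ipZl ipBl (_ : B (T t y) z - _ = t * (orbit z c1 - orbit z c2) / h).
    by field; rewrite !gt_eqF.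
  by rewrite -Q mulrAC mulfV ?mul1r ?gt_eqF.
have zz : `N z ^+ 2 <= a * `N z.
  rewrite sqr_nrm (_ : B z z = B (t^-1 *: (T t y - y)) z - B (h^-1 *: (T h x - x)) z); last first.
    by rewrite -ipBl.
  rewrite key ipZl -mulrBr.
  rewrite ipBl -/(orbit z h) (_ : B x z = orbit z 0); last by rewrite /orbit T0.
  rewrite ler_pdivrMl//.
  rewrite (_ : _ - _ = (orbit z c1 - orbit z h) + (orbit z 0 - orbit z c2)); last by ring.
  have b1 : orbit z c1 - orbit z h <= h * a / 2 * `N z.
    rewrite /orbit -ipBl (le_trans (ler_norm _))// (le_trans (cauchy_schwarz _ _ _))// ler_wpM2r//.
    rewrite -[c1](subrKC h) (eqn_nrm (eqnB (T_law _ _ _) (eqn_refl _ _))) ?subr_ge0// ?(ltW h0)//.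
    rewrite (eqn_nrm (eqn_sym (T_B _ _ _))) (le_trans (hM _ _ _))//; first by have := h1; lra.
    rewrite (_ : h * a / 2 = M * (h * a / (2 * M))); last by field; rewrite gt_eqF.
    by rewrite ler_pM2l// hd ?subr_ge0//; lra.
  have b2 : orbit z 0 - orbit z c2 <= h * a / 2 * `N z.
    rewrite /orbit -ipBl (le_trans (ler_norm _))// (le_trans (cauchy_schwarz _ _ _))// ler_wpM2r//.
    rewrite [T 0 x]T0// nrmB (le_trans (hd _ _ _))//; first by lra.
    rewrite ler_wpM2l ?mulr_ge0 ?(ltW h0) ?(ltW a0)// lef_pV2 ?posrE ?mulr_gt0//.
    by rewrite ler_peMr.
  lra.
move: zz; rewrite expr2; have := nrm_ge0 B z; rewrite le_eqVlt => /predU1P[<- _|z0].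
  exact: ltW.
by rewrite ler_pM2r.
Qed.

End density.

Lemma ipgen_dense x (e : R) : 0 < e -> exists y y', ipgen y y' /\ `N (x - y) <= e.
Proof.
move=> e0; have [d d0 hd] := T_cont x e0.
have h0 : 0 < Num.min (d / 2) 1 by rewrite lt_min ltr01 divr_gt0.
have h1 : Num.min (d / 2) 1 <= 1 by rewrite ge_min lexx orbT.
have [|y [yx [y' gy]]] := @gen_dense x _ h0 h1 e e0; last by exists y, y'; rewrite nrmB.
move=> s s0 sh; apply: hd => //; apply: (le_lt_trans sh).
by rewrite gt_min; apply/orP; left; lra.
Qed.

Let T_contr t x : 0 <= t -> `N (T t x) <= `N x.
Proof.
move=> t0; rewrite -subr_le0; have [M M0 hM] := T_bddW t.
apply: (@le0_of_small _ _ (M + 1)) => e e0 _.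
have [y [y' [gy xy]]] := ipgen_dense x e0.
have k1 : `N (T t x) - `N (T t y) <= M * e.
  rewrite (le_trans (ler_nrmB B _ _))// (eqn_nrm (eqn_sym (T_B _ _ _))).
  by rewrite (le_trans (hM _ (lexx _) _))// ler_pM2l.
have := ler_nrmB B y x; rewrite nrmB; have := T_contr_dom t0 gy.
move: k1 xy; lra.
Qed.

Let T_sym t x y : 0 <= t -> B (T t x) y = B x (T t y).
Proof.
move=> t0; apply/eqP; rewrite -subr_eq0 -normr_le0.
apply: (@le0_of_small _ _ (2 * (`N x + 1) + 2 * `N y)) => e e0 e1.
have [x1 [x1' [gx xx]]] := ipgen_dense x e0.
have [y1 [y1' [gy yy]]] := ipgen_dense y e0.
have nx1 : `N x1 <= `N x + 1.
  by rewrite -lerBlDl (le_trans (ler_nrmB B _ _))// nrmB (le_trans xx).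
have csT u v : `|B (T t u) v| <= `N u * `N v.
  by rewrite (le_trans (cauchy_schwarz _ _ _))// ler_wpM2r// T_contr.
have csT' u v : `|B v (T t u)| <= `N u * `N v by rewrite ipC.
have E : B (T t x) y - B x (T t y) =
    (B (T t (x - x1)) y + B (T t x1) (y - y1)) - (B (x - x1) (T t y) + B x1 (T t (y - y1))).
  rewrite (eqn_ip (T_B _ _ _) (eqn_refl _ _)) (eqn_ip (eqn_refl _ x1) (T_B _ _ _)).
  by rewrite !ipBl !ipBr (T_sym_dom t0 gx gy); ring.
rewrite E (le_trans (ler_normB _ _))//.
rewrite (_ : e * _ = (e * `N y + (`N x + 1) * e) + (`N y * e + e * (`N x + 1))); last by ring.
apply: lerD; apply: (le_trans (ler_normD _ _)); apply: lerD.
- by rewrite (le_trans (csT _ _))// ler_wpM2r.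
- by rewrite (le_trans (csT _ _))// ler_pM.
- by rewrite (le_trans (csT' _ _))// ler_wpM2l.
- by rewrite (le_trans (csT' _ _))// ler_pM.
Qed.

Lemma semigroup_contraction (t : R) x : 0 < t -> `N (S t x) <= `N x.
Proof. by move=> t0; rewrite -(TP _ t0) T_contr// ltW. Qed.

Lemma semigroup_symmetric (t : R) x y : 0 < t -> B (S t x) y = B x (S t y).
Proof. by move=> t0; rewrite -!(TP _ t0) T_sym// ltW. Qed.

(* [t |-> B (T t x) x = |T (t / 2) x|^2] is nonincreasing and nonnegative,
   which makes [T t x] Cauchy. *)
Lemma semigroup_converges x : exists q, ipgen q 0 /\
  forall e : R, 0 < e -> exists r : R, forall t, r < t -> `N (S t x - q) <= e.
Proof.
pose g t := B (T t x) x.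
have gE t : 0 <= t -> g t = `N (T (t / 2) x) ^+ 2.
  move=> t0; have t20 : 0 <= t / 2 by rewrite divr_ge0.
  rewrite sqr_nrm -(T_sym _ _ t20); apply: eqn_ip => //.
  by rewrite [X in T X x =~ _](splitr t); exact: T_law.
have g0 t : 0 <= t -> 0 <= g t by move=> t0; rewrite gE// sqr_ge0.
have g_anti s t : 0 <= s -> s <= t -> g t <= g s.
  move=> s0 st; rewrite !gE//; last exact: le_trans st.
  rewrite ler_sqr ?nnegrE// (_ : t / 2 = (t - s) / 2 + s / 2); last by field.
  rewrite (eqn_nrm (T_law _ _ _)) ?divr_ge0 ?subr_ge0//.
  by rewrite T_contr// divr_ge0// subr_ge0.
pose E := [set g t | t in [set t | 0 <= t]].
have E_inf : has_inf E.
  split; first by exists (g 0), 0 => /=.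
  by exists 0 => _ [t /= t0 <-]; exact: g0.
have cauchyT (e : R) : 0 < e -> exists2 r : R, 0 <= r &
    forall s t, r <= s -> r <= t -> `N (T s x - T t x) <= e.
  move=> e0; have e20 : 0 < e ^+ 2 / 2 by rewrite divr_gt0// exprn_gt0.
  have [_ [r /= r0 <-] gr] := inf_adherent e20 E_inf.
  exists r => // s t rs rt; have s0 := le_trans r0 rs; have t0 := le_trans r0 rt.
  (* The squared norm is [g (s + s) - g (s + t) - g (t + s) + g (t + t)]; the two positive terms are
     within [e ^+ 2 / 2] of the infimum and the other two are at least the infimum. *)
  rewrite -ler_sqr ?nnegrE ?(ltW e0)// sqr_nrm ipBl !ipBr.
  have key u v : 0 <= u -> 0 <= v -> B (T u x) (T v x) = g (u + v).
    move=> u0 v0; rewrite -T_sym// addrC; apply: eqn_ip => //.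
    by apply: eqn_sym; exact: T_law.
  rewrite !key//.
  have lb u : 0 <= u -> inf E <= g u.
    by move=> u0; apply: ge_inf; [case: E_inf|exists u].
  have h1 := g_anti _ (s + s) r0 (le_trans rs (ler_wpDr s0 (lexx _))).
  have h2 := g_anti _ (t + t) r0 (le_trans rt (ler_wpDr t0 (lexx _))).
  have h3 := lb _ (addr_ge0 s0 t0); have h4 := lb _ (addr_ge0 t0 s0).
  move: h1 h2 h3 h4 gr; lra.
have [|q hq] := Bcomplete (u := fun n => T n%:R x).
  move=> e /cauchyT[r r0 hr]; exists (Num.truncn r).+1 => m n rm rn.
  have rN k : (Num.truncn r < k)%N -> r <= k%:R.
    by move=> rk; rewrite (le_trans (ltW (truncnS_gt _)))// ler_nat.
  by apply: hr; exact: rN.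
have lim (e : R) : 0 < e -> exists2 r : R, 0 <= r & forall t, r <= t -> `N (T t x - q) <= e.
  move=> e0; have e20 : 0 < e / 2 by rewrite divr_gt0.
  have [r r0 hr] := cauchyT _ e20; have [N hN] := hq _ e20.
  exists r => // t rt; pose n := maxn N (Num.truncn r).+1.
  rewrite (le_trans (nrm_sub_trans B (T n%:R x) _ _))// [leRHS]splitr lerD//.
    by apply: hr => //; rewrite (le_trans (ltW (truncnS_gt _)))// ler_nat leq_maxr.
  by apply: hN; exact: leq_maxl.
exists q; split; last first.
  by move=> e /lim[r r0 hr]; exists r => t rt; rewrite -TP ?(le_lt_trans r0 rt)// hr// ltW.
move=> e e0; exists 1 => // h h0 _; rewrite subr0 nrmZ -(TP _ h0).
(* The limit is fixed by every [T h], since [T h] is a contraction and [T (h + t) x] has the same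
   limit as [T t x]. *)
suff -> : `N (T h q - q) = 0 by rewrite mulr0 ltW.
apply: nrm_le0 => a a0; have [r r0 hr] := lim _ (divr_gt0 a0 (ltr0n _ 2)).
rewrite (le_trans (nrm_sub_trans B (T h (T r x)) _ _))// [leRHS]splitr lerD//.
  rewrite (eqn_nrm (eqn_sym (T_B _ _ _))) (le_trans (T_contr _ (ltW h0)))//.
  by rewrite nrmB hr.
rewrite (eqn_nrm (eqnB (eqn_sym (T_law _ _ _)) (eqn_refl _ _))) ?(ltW h0)//.
by rewrite hr// ler_wpDl// ltW.
Qed.

End semigroup.

(** * The space $L_2$ *)

Section square_integrable_on.
Context d (T : measurableType d) (R : realType) (mu : {measure set T -> \bar R}).
Implicit Types (D : set T) (f g : T -> R).

(** For Lebesgue measure this unfolds to [square_integrable]; the arbitrary measure lets the same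
    lemmas serve the boundary. *)
Definition sqint D f :=
  measurable_fun D f /\ mu.-integrable D (fun x => (f x ^+ 2)%:E).

Lemma le_integrable_fin D f g : measurable D -> measurable_fun D f ->
  (forall x, D x -> `|f x| <= g x) -> mu.-integrable D (EFin \o g) ->
  mu.-integrable D (EFin \o f).
Proof.
move=> mD mf fg ig; apply: le_integrable ig => //; first exact/measurable_EFinP.
by move=> x Dx /=; rewrite lee_fin (le_trans (fg x Dx))// ler_norm.
Qed.

Lemma sqint_mul D f g : measurable D -> sqint D f -> sqint D g ->
  mu.-integrable D (EFin \o (fun x => f x * g x)).
Proof.
move=> mD [mf sf] [mg sg].
apply: (@le_integrable_fin _ _ (fun x => f x ^+ 2 + g x ^+ 2)) => //.
- exact: measurable_funM.
- move=> x _; rewrite normrM -[f x ^+ 2]real_normK ?num_real// -[g x ^+ 2]real_normK ?num_real//.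
  have := sqr_ge0 (`|f x| - `|g x|); have := sqr_ge0 `|f x|; have := sqr_ge0 `|g x|.
  by rewrite sqrrB; lra.
- by have := integrableD mD sf sg.
Qed.

Lemma sqintD D f g : measurable D -> sqint D f -> sqint D g -> sqint D (f \+ g).
Proof.
move=> mD sf sg; split; first exact: measurable_funD sf.1 sg.1.
have /(integrableZl mD 2) h := sqint_mul mD sf sg.
have := integrableD mD (integrableD mD sf.2 sg.2) h.
by apply: eq_integrable => // x _ /=; rewrite -?EFinM -?EFinD; congr EFin; ring.
Qed.

Lemma sqintM D f g (c : R) : measurable D -> sqint D f -> measurable_fun D g ->
  (forall x, D x -> `|g x| <= c) -> sqint D (f \* g).
Proof.
move=> mD sf mg gc; split; first exact: measurable_funM sf.1 mg.
apply: (@le_integrable_fin _ _ (fun x => c ^+ 2 * f x ^+ 2)) => //.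
- by apply: measurable_funX; exact: measurable_funM sf.1 mg.
- move=> x Dx; rewrite ger0_norm ?sqr_ge0// exprMn mulrC ler_wpM2r ?sqr_ge0//.
  by rewrite -[leLHS]real_normK ?num_real// ler_sqr ?nnegrE ?gc// (le_trans _ (gc x Dx)).
- by have := integrableZl mD (c ^+ 2) sf.2.
Qed.

Lemma sqintZ D f (a : R) : measurable D -> sqint D f -> sqint D (fun x => a * f x).
Proof.
move=> mD sf; have := @sqintM D f (cst a) `|a| mD sf (measurable_cst _) (fun _ _ => lexx _).
by rewrite (_ : f \* cst a = (fun x => a * f x))//; apply/funext => x /=; rewrite mulrC.
Qed.

Lemma sqint_ae_bounded D f (c : R) : measurable D -> (mu D < +oo)%E ->
  measurable_fun D f -> (forall x, D x -> `|f x| <= c) -> sqint D f.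
Proof.
move=> mD Doo mf fc; split => //.
apply: (@le_integrable_fin _ _ (cst (c ^+ 2))) => //.
- exact: measurable_funX.
- move=> x Dx; rewrite normrX ler_sqr ?nnegrE ?fc//.
  by rewrite (le_trans _ (fc x Dx)).
- apply/integrableP; split; first by apply/measurable_EFinP; exact: measurable_cst.
  rewrite (eq_integral (cst `|c ^+ 2|%:E)) ?integral_cst//.
  by rewrite lte_mul_pinfty// lee_fin.
Qed.

Lemma sqint_integrable D f : measurable D -> (mu D < +oo)%E -> sqint D f ->
  mu.-integrable D (EFin \o f).
Proof.
move=> mD Doo sf; have s1 : sqint D (cst 1).
  by apply: (@sqint_ae_bounded D _ 1) => // x _; rewrite normr1.
have := sqint_mul mD sf s1; apply: eq_integrable => // x _ /=.
by rewrite mulr1.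
Qed.

Lemma sqint_patch D f : measurable D -> sqint D f -> sqint setT (f \_ D).
Proof.
move=> mD [mf sf]; split.
  by apply/(measurable_restrictT _ mD).
have /(integrable_mkcond (fun x => (f x ^+ 2)%:E) mD) := sf.
apply: eq_integrable => // x _; rewrite /patch; case: ifPn => // _.
by rewrite expr0n.
Qed.

Lemma Lnorm2E f : mu.-integrable setT (fun x => (f x ^+ 2)%:E) ->
  'N[mu]_2[EFin \o f]%E = (Num.sqrt (\int[mu]_x (f x ^+ 2)))%:E.
Proof.
move=> sf; rewrite unlock /Lnorm poweR12_sqrt; last first.
  by apply: integral_ge0 => x _; exact: poweR_ge0.
rewrite (_ : (\int[mu]_x _)%E = (\int[mu]_x (f x ^+ 2))%:E)//.
rewrite /Rintegral fineK; last exact: integrable_fin_num.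
by apply: eq_integral => x _; rewrite /= powR_mulrn// real_normK ?num_real.
Qed.

Lemma sqint_Lfun f : sqint setT f -> f \in Lfun mu 2%:E.
Proof.
move=> [mf sf]; rewrite inE; apply/andP; split; rewrite inE//=.
by rewrite /finite_norm Lnorm2E// ltry.
Qed.

Lemma L2_sqint (f : L2 mu) : sqint setT f.
Proof. by split => //; have := Lfun2_integrable_sqr (LfunP f). Qed.

Definition mkL2 f (sf : sqint setT f) : L2 mu := Lfun_Sub (lee1n 2) (sqint_Lfun sf).

Lemma mkL2E f (sf : sqint setT f) x : mkL2 sf x = f x. Proof. by []. Qed.

End square_integrable_on.

Section L2_inner.
Context d (T : measurableType d) (R : realType) (mu : {measure set T -> \bar R}).
Local Notation L2 := (L2 mu).
Implicit Types f g h : L2.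

Definition L2_dot f g : R := \int[mu]_x (f x * g x).

Lemma L2_mul_integrable f g : mu.-integrable setT (EFin \o (fun x => f x * g x)).
Proof. by apply: sqint_mul => //; exact: L2_sqint. Qed.

Lemma L2_dotC f g : L2_dot f g = L2_dot g f.
Proof. by apply: eq_Rintegral => x _; rewrite mulrC. Qed.

Lemma L2_dot_linear a f g h : L2_dot (a *: f + g) h = a * L2_dot f h + L2_dot g h.
Proof.
rewrite /L2_dot -RintegralZl//; last exact: L2_mul_integrable.
rewrite -RintegralD//.
- by apply: eq_Rintegral => x _ /=; rewrite mulrDl mulrA.
- have := integrableZl measurableT a (L2_mul_integrable f h).
  by apply: eq_integrable.
- exact: L2_mul_integrable.
Qed.

Lemma L2_dot_ge0 f : 0 <= L2_dot f f.
Proof. by apply: Rintegral_ge0 => x _; rewrite -expr2 sqr_ge0. Qed.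

Definition L2_ip : semi_inner L2 := SemiInner L2_dotC L2_dot_linear L2_dot_ge0.

Lemma L2_nrmE f : 'N[mu]_2[EFin \o f]%E = (nrm L2_ip f)%:E.
Proof. by rewrite (Lnorm2E (L2_sqint f).2). Qed.

Lemma L2distE f g : L2dist mu f g = (nrm L2_ip (f - g))%:E.
Proof. by rewrite -L2_nrmE. Qed.

Lemma L2_eqnP f g : eqn L2_ip f g <-> f = g %[ae mu].
Proof.
split.
  move=> fg; have : (f - g : L2) = 0 %[ae mu].
    by apply: fine_Lnormr_eq0; rewrite L2_nrmE fg.
  by apply: filterS => x /= /(_ I) fg0 _; apply/eqP; rewrite -subr_eq0; apply/eqP.
move=> fg; rewrite /eqn /nrm (_ : L2_ip _ _ = 0) ?sqrtr0//.
rewrite /= /L2_dot /Rintegral (ae_eq_integral (cst 0%E)) ?integral0//.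
- by apply/measurable_EFinP; apply: measurable_funM.
- apply: filterS fg => x /(_ I) fg _.
  have E : (f - g : L2) x = 0 by rewrite (_ : (f - g : L2) x = f x - g x)// fg subrr.
  by change (((f - g : L2) x * (f - g : L2) x)%:E = 0%E); rewrite E mul0r.
Qed.

Lemma dot_mkL2 (u v : T -> R) (su : sqint mu setT u) (sv : sqint mu setT v) :
  L2_dot (mkL2 su) (mkL2 sv) = \int[mu]_x (u x * v x).
Proof. by []. Qed.

(* Riesz-Fischer: a fast subsequence converges a.e. since the sum of its
   increments is integrable, and Fatou's lemma identifies the limit in L2. *)
Lemma L2_complete : (mu setT < +oo)%E -> complete_ip L2_ip.
Proof.
move=> muoo u u_cauchy; pose N := nrm L2_ip.
have /choice[M hM] k : exists M, forall m n, (M <= m)%N -> (M <= n)%N ->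
    N (u m - u n) <= 2^-1 ^+ k by apply: u_cauchy; rewrite exprn_gt0// invr_gt0.
pose n_ k := \big[maxn/0%N]_(i < k.+1) M i.
have n_M k : (M k <= n_ k)%N by exact: (leq_bigmax (Ordinal (ltnSn k))).
have n_S k : (n_ k <= n_ k.+1)%N by rewrite /n_ [leqRHS]big_ord_recr/= leq_maxl.
pose f k := u (n_ k).
have f_step k : N (f k.+1 - f k) <= 2^-1 ^+ k.
  by apply: hM; [exact: leq_trans (n_M k) (n_S k)|exact: n_M].
have one_sq : sqint mu setT (cst 1).
  by apply: (@sqint_ae_bounded _ _ _ _ _ _ 1) => // x _; rewrite normr1.
pose a k x := `|f k.+1 x - f k x|.
have a0 k x : (0 <= (a k x)%:E)%E by rewrite lee_fin normr_ge0.
have a_sq k : sqint mu setT (a k).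
  have [mf sf] := L2_sqint (f k.+1 - f k); split.
    by apply: measurableT_comp => //; exact: measurable_funB.
  apply: eq_integrable sf => // x _ /=; rewrite real_normK ?num_real//.
have a_int k : (\int[mu]_x (a k x)%:E <= (2^-1 ^+ k * N (mkL2 one_sq))%:E)%E.
  have E : (\int[mu]_x (a k x)%:E = (L2_dot (mkL2 (a_sq k)) (mkL2 one_sq))%:E)%E.
    rewrite dot_mkL2 /Rintegral fineK; last first.
      by apply: integrable_fin_num => //; exact: (sqint_mul measurableT (a_sq k) one_sq).
    by apply: eq_integral => x _; rewrite mulr1.
  (* The finiteness of the measure enters through the constant 1: Cauchy-Schwarz against it bounds
     the integral of an increment by its [L2] norm. *)
  rewrite E lee_fin (le_trans (ler_norm _))// (le_trans (cauchy_schwarz L2_ip _ _))//.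
  rewrite ler_wpM2r ?nrm_ge0//; apply: le_trans (f_step k).
  rewrite /N /nrm ler_wsqrtr// le_eqVlt; apply/orP; left; apply/eqP.
  by apply: eq_Rintegral => x _; rewrite !mkL2E /a -expr2 real_normK ?num_real.
have ma k : measurable_fun setT (a k) by exact: (a_sq k).1.
have suma_int : mu.-integrable setT (fun x => \sum_(k <oo) (a k x)%:E)%E.
  apply/integrableP; split.
    apply: (@ge0_emeasurable_sum _ _ R setT (fun k x => (a k x)%:E) xpredT) => //.
    by move=> k _; exact/measurable_EFinP.
  rewrite (eq_integral (fun x => \sum_(k <oo) (a k x)%:E)%E); last first.
    by move=> x _; rewrite gee0_abs//; exact: nneseries_ge0.
  rewrite integral_nneseries//; last by move=> k; exact/measurable_EFinP.
  apply: (@le_lt_trans _ _ (2 * N (mkL2 one_sq))%:E); last exact: ltry.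
  apply: lime_le.
    by apply: is_cvg_nneseries => k _ _; apply: integral_ge0.
  apply: nearW => n; apply: (@le_trans _ _ (\sum_(0 <= k < n) (2^-1 ^+ k * N (mkL2 one_sq))%:E)%E).
    by apply: lee_sum => k _; exact: a_int.
  rewrite sumEFin lee_fin -mulr_suml ler_wpM2r ?nrm_ge0//.
  suff -> : \sum_(0 <= k < n) 2^-1 ^+ k = 2 - 2 * 2^-1 ^+ n :> R.
    by rewrite gerBl mulr_ge0// exprn_ge0// invr_ge0.
  elim: n => [|n IH]; first by rewrite big_geq// expr0; ring.
  by rewrite big_nat_recr//= IH exprS; field.
have f_cvg : {ae mu, forall x, cvgn (fun k => f k x)}.
  apply: filterS (integrable_ae measurableT suma_int) => x /(_ I) suma.
  have : cvgn [normed series (fun k => f k.+1 x - f k x)].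
    apply: nondecreasing_is_cvgn.
      by apply: nondecreasing_series => k _ _ /=.
    exists (fine (\sum_(k <oo) (a k x)%:E)%E) => _ [n _ <-].
    rewrite -lee_fin fineK// /series/= -sumEFin.
    by apply: nneseries_lim_ge => k _ _.
  move=> /normed_cvg; rewrite /series/=.
  under eq_fun do rewrite telescope_sumr//.
  move=> h; rewrite (_ : (fun k => f k x) = (fun k => f k x - f 0%N x) \+ cst (f 0%N x)).
    by apply: is_cvgD => //; exact: is_cvg_cst.
  by apply/funext => k /=; rewrite subrK.
(* An upper limit is measurable on the whole space, whereas the limit exists only almost everywhere;
   [fine] supplies a real value at the remaining points. *)
pose g x := fine (limn_esup (fun k => (f k x)%:E)).
have mg : measurable_fun setT g.
  apply: measurableT_comp => //; apply: measurable_fun_limn_esup => k.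
  exact/measurable_EFinP.
have fg : {ae mu, forall x, f k x @[k --> \oo] --> g x}.
  apply: filterS f_cvg => x fx; rewrite /g.
  have : (f k x)%:E @[k --> \oo] --> (limn (fun k => f k x))%:E.
    by apply: cvg_EFin; [exact: nearW|exact: fx].
  by move=> /cvg_limn_einf_sup[_ ->]; exact: fx.
have fgk k : mu.-integrable setT (fun x => ((g x - f k x) ^+ 2)%:E) /\
    \int[mu]_x (g x - f k x) ^+ 2 <= (2^-1 ^+ k) ^+ 2.
  pose h m x := ((f (m + k)%N x - f k x) ^+ 2)%:E.
  have mh m : measurable_fun setT (h m).
    by apply/measurable_EFinP; apply: measurable_funX; exact: measurable_funB.
  have mgk : measurable_fun setT (fun x => ((g x - f k x) ^+ 2)%:E).
    by apply/measurable_EFinP; apply: measurable_funX; exact: measurable_funB.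
  have h0 m x : setT x -> (0 <= h m x)%E by rewrite lee_fin sqr_ge0.
  have int_le : (\int[mu]_x ((g x - f k x) ^+ 2)%:E <= ((2^-1 ^+ k) ^+ 2)%:E)%E.
    apply: (@le_trans _ _ (\int[mu]_x limn_einf (fun m => h m x))%E).
      apply: ae_ge0_le_integral => //.
      - by move=> x _; rewrite lee_fin sqr_ge0.
      - move=> x _; rewrite limn_einf_lim; apply: lime_ge; first exact: is_cvg_einfs.
        by apply: nearW => n; apply: le_ereal_inf_tmp => _ [m _ <-]; exact: h0.
      - apply: measurableT_comp => //; apply: measurable_fun_limn_esup => m.
        exact: measurableT_comp.
      - apply: filterS fg => x fx _.
        have hx : h m x @[m --> \oo] --> ((g x - f k x) ^+ 2)%:E.
          apply: cvg_EFin; first exact: nearW.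
          have fkx : f (m + k)%N x - f k x @[m --> \oo] --> g x - f k x.
            apply: cvgB; last exact: cvg_cst.
            by rewrite (cvg_shiftn k (fun m => f m x)); exact: fx.
          exact: (cvgM fkx fkx).
        by have [-> _] := cvg_limn_einf_sup hx.
    apply: (le_trans (fatou mu measurableT mh h0)).
    rewrite limn_einf_lim; apply: lime_le; first exact: is_cvg_einfs.
    apply: nearW => m; apply: (@le_trans _ _ (\int[mu]_x h m x)%E).
      by apply: ereal_inf_lbound; exists m => /=.
    set F := f (m + k)%N - f k.
    have -> : (\int[mu]_x h m x)%E = (N F ^+ 2)%:E.
      rewrite /N sqr_nrm /= /L2_dot /Rintegral fineK//.
      by apply: integrable_fin_num => //; exact: L2_mul_integrable.
    rewrite lee_fin ler_sqr ?nnegrE ?nrm_ge0 ?exprn_ge0 ?invr_ge0//.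
    apply: hM; last exact: n_M.
    by rewrite (leq_trans (n_M k))//; elim: m @F => // m; rewrite addSn => /leq_trans; exact.
  have igk : mu.-integrable setT (fun x => ((g x - f k x) ^+ 2)%:E).
    apply/integrableP; split => //.
    rewrite (eq_integral (fun x => ((g x - f k x) ^+ 2)%:E)); last first.
      by move=> x _; rewrite gee0_abs// lee_fin sqr_ge0.
    by rewrite (le_lt_trans int_le)// ltry.
  split => //; rewrite -lee_fin /Rintegral fineK//; exact: integrable_fin_num.
have sg : sqint mu setT g.
  have sg0 : sqint mu setT (fun x => g x - f 0%N x).
    by split; [exact: measurable_funB|exact: (fgk 0%N).1].
  have := sqintD measurableT sg0 (L2_sqint (f 0%N)).
  by rewrite (_ : _ \+ _ = g)//; apply/funext => x /=; rewrite subrK.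
exists (mkL2 sg) => e e0.
have [k hk] : exists k, 2^-1 ^+ k <= e / 2.
  have : 2^-1 ^+ n @[n --> \oo] --> (0 : R).
    by apply: cvg_expr; rewrite ger0_norm// invf_lt1// ltr1n.
  move=> /cvgrPdist_le /(_ _ (divr_gt0 e0 (ltr0n _ 2)))[k _ hk]; exists k.
  by have := hk k (leqnn k); rewrite sub0r normrN; exact: le_trans (ler_norm _).
exists (M k) => n Mn; rewrite (le_trans (nrm_sub_trans _ (f k) _ _))// [leRHS]splitr.
rewrite lerD// (le_trans _ hk)//; first by apply: hM => //; exact: n_M.
rewrite nrmB -ler_sqr ?nnegrE ?nrm_ge0 ?exprn_ge0 ?invr_ge0// sqr_nrm.
exact: (fgk k).2.
Qed.
End L2_inner.

Lemma ecvg0P (R : realType) (T : Type) (F : set_system T) (FF : Filter F)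
    (r : T -> R) : (forall t, 0 <= r t) ->
  ((r t)%:E @[t --> F] --> 0%E) <-> forall e : R, 0 < e -> \forall t \near F, r t <= e.
Proof.
move=> r0; split.
  move=> /fine_cvgP[_] /cvgrPdist_le h e /h; apply: filterS => t /=.
  by rewrite sub0r normrN ger0_norm.
move=> h; apply: cvg_EFin; first exact: nearW.
by apply/cvgrPdist_le => e /h; apply: filterS => t /=; rewrite sub0r normrN ger0_norm.
Qed.

Lemma near_right0P (R : realType) (P : R -> Prop) :
  (\forall t \near 0^'+, P t) <-> exists2 d : R, 0 < d & forall t : R, 0 < t -> t < d -> P t.
Proof.
split.
  move=> [d /= d0 h]; exists d => // t t0 td; apply: h => //=.
  by rewrite sub0r normrN gtr0_norm.
move=> [d d0 h]; exists d => //= t /=; rewrite sub0r normrN => td t0.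
by apply: h => //; rewrite (le_lt_trans (ler_norm _)).
Qed.

Lemma near_pinftyP (R : realType) (P : R -> Prop) :
  (\forall t \near +oo, P t) <-> exists M : R, forall t : R, M < t -> P t.
Proof.
split; first by move=> [M [_ h]]; exists M.
by move=> [M h]; exists M; split => //; exact: num_real.
Qed.

(** * Semigroups on [L2] *)

Section L2_semigroup.
Context d (T : measurableType d) (R : realType) (mu : {measure set T -> \bar R}).
Hypothesis mu_fin : (mu setT < +oo)%E.
Local Notation L2 := (L2 mu).
Local Notation N := (nrm (L2_ip mu)).
Variables (S : R -> L2 -> L2) (S_C0 : C0_semigroup S).
Implicit Types f g : L2.

Let S_lin (t : R) : 0 < t -> forall a f g,
  eqn (L2_ip mu) (S t (a *: f + g)) (a *: S t f + S t g).
Proof. by move=> t0 a f g; apply/L2_eqnP; exact: semigroup_linear S_C0 t t0 a f g. Qed.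

Let S_bdd (t : R) : 0 < t -> exists M : R, forall f, N (S t f) <= M * N f.
Proof.
move=> t0; have [M hM] := semigroup_bounded S_C0 t0; exists M => f.
by have := hM f; rewrite !L2_nrmE -EFinM lee_fin.
Qed.

Let S_law (s t : R) : 0 < s -> 0 < t -> forall f,
  eqn (L2_ip mu) (S (s + t) f) (S s (S t f)).
Proof. by move=> s0 t0 f; apply/L2_eqnP; exact: semigroup_law S_C0 _ _ s0 t0 f. Qed.

Let S_cont f (e : R) : 0 < e ->
  exists2 d : R, 0 < d & forall t : R, 0 < t -> t < d -> N (S t f - f) <= e.
Proof.
move=> e0; apply/near_right0P; have := semigroup_continuous S_C0 f.
under eq_fun do rewrite L2distE.
by move=> /ecvg0P; apply => // t; exact: nrm_ge0.
Qed.

Lemma infinitesimal_generatorP f g :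
  infinitesimal_generator S f g <-> ipgen (L2_ip mu) S f g.
Proof.
rewrite /infinitesimal_generator.
under eq_fun do rewrite L2distE.
rewrite ecvg0P => [|t]; last exact: nrm_ge0.
by split => h e /h; [move=> /near_right0P|move=> ?; apply/near_right0P].
Qed.

Lemma L2_gen0_fix f (t : R) : infinitesimal_generator S f 0 -> 0 < t -> S t f = f %[ae mu].
Proof.
move=> /infinitesimal_generatorP gf t0; apply/L2_eqnP.
by apply: gen0_fix => //; exact: L2_complete.
Qed.

Section symmetric_dissipative.
Hypothesis gen_sym : forall f f' g g', infinitesimal_generator S f f' ->
  infinitesimal_generator S g g' -> L2_dot f' g = L2_dot f g'.
Hypothesis gen_diss : forall f f', infinitesimal_generator S f f' -> L2_dot f' f <= 0.

Let sym f f' g g' : ipgen (L2_ip mu) S f f' -> ipgen (L2_ip mu) S g g' ->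
  L2_ip mu f' g = L2_ip mu f g'.
Proof. by move=> /infinitesimal_generatorP ? /infinitesimal_generatorP; exact: gen_sym. Qed.

Let diss f f' : ipgen (L2_ip mu) S f f' -> L2_ip mu f' f <= 0.
Proof. by move=> /infinitesimal_generatorP; exact: gen_diss. Qed.

Lemma L2_semigroup_contraction (t : R) f : 0 < t -> N (S t f) <= N f.
Proof.
by apply: (@semigroup_contraction R L2 (L2_ip mu) (L2_complete mu_fin) S).
Qed.

Lemma L2_semigroup_symmetric (t : R) f g : 0 < t -> L2_dot (S t f) g = L2_dot f (S t g).
Proof.
by apply: (@semigroup_symmetric R L2 (L2_ip mu) (L2_complete mu_fin) S).
Qed.

Lemma L2_semigroup_converges f : exists q, infinitesimal_generator S q 0 /\
  forall e : R, 0 < e -> exists r : R, forall t, r < t -> N (S t f - q) <= e.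
Proof.
have [q [gq hq]] := semigroup_converges (L2_complete mu_fin) S_lin S_bdd S_law
  S_cont sym diss f.
by exists q; split => //; apply/infinitesimal_generatorP.
Qed.

End symmetric_dissipative.
End L2_semigroup.

(** * Smooth functions and bumps *)

Section smooth1.
Context (R : realType).
Implicit Types (f g : R -> R) (C : (R -> R) -> Prop) (p : {poly R}).

(* Smoothness as a greatest fixed point: no formula for higher derivatives of
   products or of [exp (- 1 / x)] is ever needed. *)
Definition smooth1 f := exists C, C f /\
  forall g, C g -> exists2 g', C g' & forall x : R, is_derive x 1 g (g' x).

Lemma smooth1_derive f : smooth1 f ->
  exists2 f', smooth1 f' & forall x : R, is_derive x 1 f (f' x).
Proof.
by move=> [C [Cf hC]]; have [f' Cf' df] := hC _ Cf; exists f' => //; exists C.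
Qed.

Lemma smooth1_primitive f f' : (forall x : R, is_derive x 1 f (f' x)) -> smooth1 f' ->
  smooth1 f.
Proof.
move=> df sf'; exists (fun g => g = f \/ smooth1 g); split; first by left.
move=> g [->|/smooth1_derive[g' sg' dg]]; first by exists f' => //; right.
by exists g' => //; right.
Qed.

Lemma smooth1_affine f (c k : R) : smooth1 f -> smooth1 (fun x => f (c * x + k)).
Proof.
move=> sf; exists (fun g => exists a h, smooth1 h /\ g = fun x => a * h (c * x + k)).
split; first by exists 1, f; split => //; apply/funext => x; rewrite mul1r.
move=> _ [a [h [/smooth1_derive[h' sh' dh] ->]]].
exists (fun x => (a * c) * h' (c * x + k)); first by exists (a * c), h'.
move=> x; have dc : is_derive x 1 (fun x => c * x + k : R) c.
  have hid : is_derive x (1 : R) (id : R -> R) 1 by exact: is_derive_id.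
  have := is_deriveD (is_deriveM (is_derive_cst c x 1) hid) (is_derive_cst k x 1).
  by move/is_derive_eq; apply; rewrite scaler0 !addr0 /GRing.scale/= mulr1.
have := @is_derive1_comp _ h (fun x => c * x + k) x _ _ (dh _) dc => dhc.
have := is_deriveM (is_derive_cst a x 1) dhc.
by move/is_derive_eq; apply; rewrite scaler0 addr0 /GRing.scale/=; ring.
Qed.

(** The derivative of a product is a sum of two products, so the smallest class that coinduction can
    use is that of finite sums of products. *)
Inductive sum_prod : (R -> R) -> Prop :=
| SumProd1 f g : smooth1 f -> smooth1 g -> sum_prod (fun x => f x * g x)
| SumProdD f g : sum_prod f -> sum_prod g -> sum_prod (fun x => f x + g x).

Lemma smooth1M f g : smooth1 f -> smooth1 g -> smooth1 (fun x => f x * g x).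
Proof.
move=> sf sg; exists sum_prod; split; first exact: SumProd1.
move=> h; elim=> {h f g sf sg}
    [f g sf sg|f g Pf [f' Pf' df] Pg [g' Pg' dg]].
  have [f' sf' df] := smooth1_derive sf; have [g' sg' dg] := smooth1_derive sg.
  exists (fun x => f x * g' x + g x * f' x).
    by apply: SumProdD; exact: SumProd1.
  by move=> x; exact: (is_deriveM (df x) (dg x)).
exists (fun x => f' x + g' x); first exact: SumProdD.
by move=> x; exact: (is_deriveD (df x) (dg x)).
Qed.

Lemma smooth1_cst (c : R) : smooth1 (cst c).
Proof.
exists (fun g => exists a : R, g = cst a); split; first by exists c.
move=> _ [a ->]; exists (cst 0); first by exists 0.
by move=> x; exact: is_derive_cst.
Qed.

Lemma smooth1D f g : smooth1 f -> smooth1 g -> smooth1 (fun x => f x + g x).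
Proof.
move=> sf sg; exists (fun h => exists f g, [/\ smooth1 f, smooth1 g & h = fun x => f x + g x]).
split; first by exists f, g.
move=> _ [{sf}f [{sg}g [/smooth1_derive[f' sf' df] /smooth1_derive[g' sg' dg] ->]]].
exists (fun x => f' x + g' x); first by exists f', g'.
by move=> x; exact: (is_deriveD (df x) (dg x)).
Qed.

Lemma smooth1_continuous f : smooth1 f -> continuous f.
Proof.
move=> /smooth1_derive[f' _ df] x; apply: differentiable_continuous.
by apply/derivable1_diffP; exact: (@ex_derive _ _ _ _ _ _ _ (df x)).
Qed.

(** The inequality [y / n <= expR (y / n)], raised to the power [n]. *)
Lemma exprn_le_expR n (y : R) : 0 <= y -> y ^+ n <= n%:R ^+ n * expR y.
Proof.
case: n => [|n] y0; first by rewrite expr0 mul1r -expR0 ler_expR.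
have -> : expR y = expR (y / n.+1%:R) ^+ n.+1.
  by rewrite -expRM_natl mulrC divfK// pnatr_eq0.
rewrite -exprMn lerXn2r ?nnegrE ?mulr_ge0 ?expR_ge0//.
rewrite -ler_pdivrMl// mulrC (le_trans _ (expR_ge1Dx _))// lerDr//.
Qed.

Definition expo_poly p (x : R) := if 0 < x then p.[x^-1] * expR (- x^-1) else 0.

Lemma expo_poly_bounded p : exists2 c, 0 <= c & forall x, `|expo_poly p x| <= c.
Proof.
exists (\sum_(i < size p) `|p`_i| * i%:R ^+ i).
  by apply: sumr_ge0 => i _; rewrite mulr_ge0// exprn_ge0.
move=> x; rewrite /expo_poly; case: ifPn => x0; last first.
  by rewrite normr0; apply: sumr_ge0 => i _; rewrite mulr_ge0// exprn_ge0.
rewrite normrM (ger0_norm (expR_ge0 _)) expRN ler_pdivrMr ?expR_gt0//.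
rewrite horner_coef (le_trans (ler_norm_sum _ _ _))// mulr_suml ler_sum// => i _.
rewrite normrM -mulrA ler_wpM2l// normrX ger0_norm ?invr_ge0 ?(ltW x0)//.
by apply: exprn_le_expR; rewrite invr_ge0 ltW.
Qed.

Lemma expo_poly_derive p (x : R) :
  is_derive x 1 (expo_poly p) (expo_poly ('X^2 * (p - p^`())) x).
Proof.
have [x0|x0|->] := ltgtP x 0.
- rewrite [X in is_derive _ _ _ X](_ : _ = 0); last first.
    by rewrite /expo_poly ltNge (ltW x0).
  have E : \forall y \near x, cst 0 y = expo_poly p y.
    near=> y; rewrite /expo_poly ltNge ltW//.
    by near: y; exact: (cvgr_lt x).
  exact: near_eq_is_derive E (is_derive_cst _ _ _).
- have E : \forall y \near x, p.[y^-1] * expR (- y^-1) = expo_poly p y.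
    near=> y; rewrite /expo_poly ifT//.
    by near: y; exact: (cvgr_gt x).
  apply: (near_eq_is_derive E).
  have dV : is_derive x 1 (fun y : R => y^-1) (- (x ^- 2)).
    have hid : is_derive x (1 : R) (id : R -> R) 1 by exact: is_derive_id.
    have := is_deriveV (lt0r_neq0 x0) hid.
    by move/is_derive_eq; apply; rewrite /GRing.scale/= mulr1.
  have dp := @is_derive1_comp _ (horner p) (fun y => y^-1) x _ _ (is_derive_poly p _) dV.
  have de := @is_derive1_comp _ expR (fun y => - y^-1) x _ _ (is_derive_expR _) (is_deriveN dV).
  have := is_deriveM dp de; move/is_derive_eq; apply.
  rewrite /expo_poly x0 /GRing.scale/= hornerM hornerXn hornerD hornerN; field; exact: lt0r_neq0.
- rewrite [X in is_derive _ _ _ X](_ : _ = 0); last by rewrite /expo_poly ltxx.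
  suff h : h^-1 *: ((expo_poly p \o shift 0) (h *: (1 : R)) - expo_poly p 0) @[h --> 0^'] --> (0
    : R).
    by split; [apply/cvg_ex; exists 0|exact: cvg_lim h].
  (* At 0 the difference quotient of the function of [p] is [h] times the function of ['X^2 * p],
     which is bounded. *)
  have [c c0 hc] := expo_poly_bounded ('X^2 * p).
  have Eh (h : R) : `|h^-1 *: ((expo_poly p \o shift 0) (h *: (1 : R)) - expo_poly p 0)| <= `|h|
    * c.
    rewrite /= [h *: 1]mulr1 addr0 {2}/expo_poly ltxx subr0 /expo_poly /GRing.scale/=.
    case: ifPn => h0; last by rewrite mulr0 normr0 mulr_ge0.
    have := hc h; rewrite /expo_poly h0 => /(ler_wpM2l (normr_ge0 h)); apply: le_trans.
    rewrite -normrM hornerM hornerXn; rewrite le_eqVlt; apply/orP; left; apply/eqP; congr `|_|;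
      field; exact: lt0r_neq0.
  apply/cvgrPdist_le => e e0; near=> h; rewrite sub0r normrN (le_trans (Eh h))//.
  have : `|h| <= e / (c + 1).
    near: h; apply: dnbhs0_le; by rewrite divr_gt0// ltr_wpDl.
  rewrite ler_pdivlMr ?ltr_wpDl// => /(le_trans _); apply.
  by rewrite ler_wpM2l// lerDl.
Unshelve. all: by end_near. Qed.

Definition expo (x : R) := expo_poly 1 x.

Lemma smooth1_expo : smooth1 expo.
Proof.
exists (fun g => exists p, g = expo_poly p); split; first by exists 1.
move=> _ [p ->]; exists (expo_poly ('X^2 * (p - p^`()))); first by eexists.
exact: expo_poly_derive.
Qed.

Lemma expoE x : expo x = if 0 < x then expR (- x^-1) else 0.
Proof. by rewrite /expo /expo_poly hornerC mul1r. Qed.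

Lemma expo_ge0 x : 0 <= expo x.
Proof. by rewrite expoE; case: ifP => // _; exact: expR_ge0. Qed.

Lemma expo_le1 x : expo x <= 1.
Proof.
rewrite expoE; case: ifPn => // x0.
by rewrite -expR0 ler_expR oppr_le0 invr_ge0 ltW.
Qed.

Lemma expo_gt0 x : (0 < expo x) = (0 < x).
Proof. by rewrite expoE; case: ifPn => _; rewrite ?expR_gt0 ?ltxx. Qed.

(** Positive exactly on []a, b[] when [n] is positive, and converging to the indicator of that
    interval as [n] grows. The arguments are written as [c * x + k] to fit [smooth1_affine]. *)
Definition bump (a b : R) (n : nat) (x : R) :=
  expo (n%:R * x + - (n%:R * a)) * expo (- n%:R * x + n%:R * b).

Lemma smooth1_bump a b n : smooth1 (bump a b n).
Proof. by apply: smooth1M; apply: smooth1_affine; exact: smooth1_expo. Qed.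

Lemma bump_ge0 a b n x : 0 <= bump a b n x.
Proof. by rewrite mulr_ge0 ?expo_ge0. Qed.

Lemma bump_le1 a b n x : bump a b n x <= 1.
Proof. by rewrite mulr_ile1 ?expo_ge0 ?expo_le1. Qed.

Lemma bump_gt0 a b n x : (0 < bump a b n.+1 x) = (a < x < b).
Proof.
have e1 : (0 < expo (n.+1%:R * x + - (n.+1%:R * a))) = (a < x).
  by rewrite expo_gt0 subr_gt0 ltr_pM2l.
have e2 : (0 < expo (- n.+1%:R * x + n.+1%:R * b)) = (x < b).
  by rewrite expo_gt0 mulNr addrC subr_gt0 ltr_pM2l.
rewrite /bump -e1 -e2; have := expo_ge0 (n.+1%:R * x + - (n.+1%:R * a)).
rewrite le_eqVlt => /predU1P[<-|x0]; first by rewrite mul0r ltxx.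
by rewrite pmulr_rgt0// x0.
Qed.

Lemma bump_out a b n x : ~~ (a < x < b) -> bump a b n.+1 x = 0.
Proof. by move=> h; apply/eqP; rewrite eq_le bump_ge0 andbT leNgt bump_gt0. Qed.

Lemma expo_cvg y : 0 < y -> expo (n.+1%:R * y) @[n --> \oo] --> (1 : R).
Proof.
move=> y0; rewrite -[X in _ --> X]expR0.
rewrite (_ : (fun n => _) = (fun n : nat => expR (harmonic n * - y^-1))); last first.
  apply/funext => n; rewrite expoE pmulr_rgt0// y0 invfM mulrN//.
have h : harmonic n * - y^-1 @[n --> \oo] --> (0 : R).
  rewrite -[X in _ --> X](mul0r (- y^-1)); apply: cvgM; first exact: cvg_harmonic.
  exact: cvg_cst.
exact: (cvg_comp _ _ h (@continuous_expR R 0)).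
Qed.

Lemma bump_cvg a b x : bump a b n.+1 x @[n --> \oo] --> (\1_`]a, b[ x : R).
Proof.
rewrite indicE; have [xab|xab] := boolP (x \in `]a, b[); last first.
  rewrite memNset; last exact/negP.
  rewrite (_ : (fun n => _) = cst 0); first exact: cvg_cst.
  by apply/funext => n; rewrite bump_out//; move: xab; rewrite in_itv.
rewrite mem_set//; move: xab; rewrite in_itv/= => /andP[ax xb].
rewrite -[1%:R](mulr1 1).
rewrite (_ : (fun n => _) = (fun n : nat => expo (n.+1%:R * (x - a)) * expo (n.+1%:R * (b - x)))).
  by apply: cvgM; apply: expo_cvg; rewrite subr_gt0.
by apply/funext => n; rewrite /bump; congr (expo _ * expo _); ring.
Qed.

End smooth1.

(** * Smooth functions of several variables *)

Section smooth_rV.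
Context (R : realType) (d : nat).
Local Notation E := 'rV[R]_d.
Implicit Types (f g phi : E -> R) (C : (E -> R) -> Prop) (i j : 'I_d).

Lemma smooth_coind C : (forall f, C f ->
    (forall x, differentiable f x) /\ forall i, C (partial i f)) ->
  forall f, C f -> smooth f.
Proof.
(* In [foldr partial f s] the last index of [s] is applied first, hence the induction from the right
   end. *)
move=> hC f Cf s; elim/last_ind: s f Cf => [f Cf|s i IH f Cf] x.
  exact: (hC _ Cf).1.
by rewrite foldr_rcons; apply: IH; exact: (hC _ Cf).2.
Qed.

Lemma smooth_differentiable f x : smooth f -> differentiable f x.
Proof. by move=> /(_ [::]). Qed.

Lemma smooth_partial f i : smooth f -> smooth (partial i f).
Proof. by move=> sf s x; have := sf (rcons s i) x; rewrite foldr_rcons. Qed.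

Lemma smooth_continuous f : smooth f -> continuous f.
Proof. by move=> sf x; exact/differentiable_continuous/smooth_differentiable. Qed.

Lemma partialD f g i : (forall x, differentiable f x) -> (forall x, differentiable g x) ->
  partial i (f \+ g) = partial i f \+ partial i g.
Proof.
by move=> df dg; apply/funext => x; apply: deriveD; exact: diff_derivable.
Qed.

Lemma partialM f g i : (forall x, differentiable f x) -> (forall x, differentiable g x) ->
  partial i (f \* g) = (f \* partial i g) \+ (g \* partial i f).
Proof.
by move=> df dg; apply/funext => x; apply: deriveM; exact: diff_derivable.
Qed.

Inductive rV_sum_prod : (E -> R) -> Prop :=
| RVSumProd1 f g : smooth f -> smooth g -> rV_sum_prod (f \* g)
| RVSumProdD f g : rV_sum_prod f -> rV_sum_prod g -> rV_sum_prod (f \+ g).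

Lemma smoothM f g : smooth f -> smooth g -> smooth (f \* g).
Proof.
move=> sf sg; apply: (@smooth_coind rV_sum_prod); last exact: RVSumProd1.
move=> h; elim=> {h f g sf sg} [f g sf sg|f g Pf [df IHf] Pg [dg IHg]]; split.
- by move=> x; apply: differentiableM; exact: smooth_differentiable.
- move=> i; rewrite partialM; [|exact: (sf [::])|exact: (sg [::])].
  by apply: RVSumProdD; apply: RVSumProd1 => //; exact: smooth_partial.
- by move=> x; exact: differentiableD.
- by move=> i; rewrite partialD//; exact: RVSumProdD.
Qed.

Lemma smooth_cst (c : R) : smooth (cst c : E -> R).
Proof.
apply: (@smooth_coind (fun h => exists c : R, h = cst c)); last by exists c.
move=> _ [{}c ->]; split; first by move=> x; exact: differentiable_cst.
by move=> i; exists 0; apply/funext => x; exact: derive_cst.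
Qed.

Lemma derive_line f (x v : E) (t : R) : differentiable f (x + t *: v) ->
  is_derive t 1 (fun s => f (x + s *: v)) ('D_v f (x + t *: v)).
Proof.
move=> dfx; have df : derivable f (x + t *: v) v by exact: diff_derivable.
have E0 : (fun h : R => h^-1 *: (((fun s => f (x + s *: v)) \o shift t) (h *: 1) - f (x + t *:
  v))) =
    (fun h : R => h^-1 *: ((f \o shift (x + t *: v)) (h *: v) - f (x + t *: v))).
  apply/funext => h; congr (_ *: (f _ - _)) => /=.
  by rewrite [h *: 1]mulr1 scalerDl addrCA.
by split; [rewrite /derivable E0|rewrite /derive E0].
Qed.

Lemma differentiable_coord_comp (f : R -> R) j (x : E) :
  derivable f (x ord0 j) 1 -> differentiable (fun y : E => f (y ord0 j)) x.
Proof.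
move=> /derivable1_diffP df.
by apply: (@differentiable_comp _ _ _ _ (fun y : E => y ord0 j) f) => //;
  exact: differentiable_coord.
Qed.

Lemma partial_prod (g : 'I_d -> R -> R) i (g' : R -> R) :
  (forall t : R, is_derive t 1 (g i) (g' t)) ->
  partial i (fun x : E => \prod_j g j (x ord0 j)) =
  fun x => \prod_j (if j == i then g' else g j) (x ord0 j).
Proof.
move=> dg; apply/funext => x; rewrite /partial (bigD1 i)//= eqxx.
set c := \prod_(_ < d | _) _.
have cE y : (forall j, j != i -> y ord0 j = x ord0 j) ->
    \prod_j g j (y ord0 j) = g i (y ord0 i) * c.
  move=> yx; rewrite (bigD1 i)//=; congr (_ * _); apply: eq_bigr => j ji.
  by rewrite (negbTE ji) yx.
have := is_deriveM (dg (x ord0 i)) (is_derive_cst c (x ord0 i) 1).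
move=> [_]; rewrite scaler0 add0r => D.
rewrite (_ : g' _ * c = 'D_1 (g i * cst c) (x ord0 i)); last by rewrite D mulrC.
pose F (y : E) := \prod_j g j (y ord0 j).
have EF : (fun h : R => h^-1 *: ((F \o shift x) (h *: delta_mx ord0 i) - F x)) =
    (fun h : R => h^-1 *: (((g i * cst c) \o shift (x ord0 i)) (h *: 1) - (g i * cst c) (x ord0
      i))).
  apply/funext => h; congr (_ *: (_ - _)); last exact: cE.
  rewrite /= /F cE => [|j ji]; last by rewrite !mxE (negbTE ji) andbF mulr0 add0r.
  by rewrite !mxE !eqxx.
by rewrite /derive EF.
Qed.

Lemma smooth_prod (g : 'I_d -> R -> R) : (forall i, smooth1 (g i)) ->
  smooth (fun x : E => \prod_j g j (x ord0 j)).
Proof.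
move=> sg; apply: (@smooth_coind (fun h => exists g : 'I_d -> R -> R,
  (forall i, smooth1 (g i)) /\ h = fun x : E => \prod_j g j (x ord0 j))); last by exists g.
move=> _ [{sg}g [sg ->]]; split => [x|i]; last first.
  have [g' sg' dg'] := smooth1_derive (sg i).
  exists (fun j => if j == i then g' else g j); split; last exact: partial_prod.
  by move=> j; case: ifP.
rewrite (_ : (fun x => _) = \prod_j (fun x : E => g j (x ord0 j))); last first.
  by apply/funext => y; rewrite fct_prodE.
elim/big_ind: _ => [|f1 f2|j _]; [exact: (@differentiable_cst R E R 1)|exact: differentiableM|].
apply: differentiable_coord_comp.
have [g' _ dg'] := smooth1_derive (sg j); exact: (@ex_derive _ _ _ _ _ _ _ (dg' _)).
Qed.

Definition obox (a b : E) : set E := [set x | forall i, a ord0 i < x ord0 i < b ord0 i].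
Definition cbox (a b : E) : set E := [set x | forall i, a ord0 i <= x ord0 i <= b ord0 i].

Lemma cbox_compact a b : compact (cbox a b).
Proof.
rewrite (_ : cbox a b = [set v | forall i, `[a ord0 i, b ord0 i]%classic (v ord0 i)]).
  apply: (@rV_compact _ _ (fun i => `[a ord0 i, b ord0 i]%classic)) => i.
  exact: segment_compact.
by apply/seteqP; split => x /= + i => /(_ i); rewrite in_itv.
Qed.

Lemma cbox_closed a b : closed (cbox a b).
Proof.
rewrite (_ : cbox a b = \bigcap_(i in setT) ((fun x : E => x ord0 i) @^-1` `[a ord0 i, b ord0 i])).
  apply: closed_bigI => i _; apply: closed_comp; last exact: itv_closed.
  by move=> x _; exact: coord_continuous.
apply/seteqP; split => x /=; first by move=> h i _; have := h i; rewrite /= in_itv.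
by move=> h i; have := h i I; rewrite /= in_itv.
Qed.

Lemma obox_open a b : open (obox a b).
Proof.
rewrite openE => x xab.
have H i : \forall y \near x, a ord0 i < (y : E) ord0 i < b ord0 i.
  have : open ((fun x : E => x ord0 i) @^-1` `]a ord0 i, b ord0 i[).
    by apply: open_comp; [move=> y _; exact: coord_continuous|exact: interval_open].
  rewrite openE => /(_ x); rewrite /= in_itv/= => /(_ (xab i)).
  by apply: filterS => y /=; rewrite in_itv.
exact: (filter_forall _ H).
Qed.

Lemma obox_cbox a b : obox a b `<=` cbox a b.
Proof. by move=> x h i; have /andP[/ltW -> /ltW ->] := h i. Qed.

Lemma test_function_prod (Omega : set E) (g : 'I_d -> R -> R) (a b : E) :
  (forall i, smooth1 (g i)) -> cbox a b `<=` Omega ->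
  (forall i t, ~~ (a ord0 i <= t <= b ord0 i) -> g i t = 0) ->
  test_function Omega (fun x => \prod_j g j (x ord0 j)).
Proof.
move=> sg abO g0.
have supp : closure [set x : E | \prod_j g j (x ord0 j) != 0] `<=` cbox a b.
  apply: (@subset_trans _ (closure (cbox a b))).
    apply: closureS => x /= + i; apply: contra_neqT => xi.
    by rewrite (bigD1 i)//= g0// mul0r.
  by rewrite -(closure_id _).1//; exact: cbox_closed.
split; [exact: smooth_prod| |exact: subset_trans abO].
apply: subclosed_compact supp; [exact: closed_closure|exact: cbox_compact].
Qed.

Lemma test_functionM (Omega : set E) m phi : smooth m -> test_function Omega phi ->
  test_function Omega (m \* phi).
Proof.
move=> sm [sp cp pO].
have supp : closure [set x : E | (m \* phi) x != 0] `<=` closure [set x : E | phi x != 0].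
  by apply: closureS => x /=; rewrite mulf_eq0 negb_or => /andP[].
split; [exact: smoothM| |exact: subset_trans pO].
by apply: subclosed_compact supp => //; exact: closed_closure.
Qed.

Lemma test_function0 (Omega : set E) phi x : test_function Omega phi -> ~ Omega x -> phi x = 0.
Proof.
move=> [_ _ pO] nx; apply/eqP/negPn/negP => px; apply: nx; apply: pO.
exact: subset_closure.
Qed.

Definition boxbump (a b : E) (n : nat) (x : E) : R :=
  \prod_j bump (a ord0 j) (b ord0 j) n.+1 (x ord0 j).

Lemma smooth_boxbump a b n : smooth (boxbump a b n).
Proof.
by apply: (@smooth_prod (fun j => bump (a ord0 j) (b ord0 j) n.+1)) => i; exact: smooth1_bump.
Qed.

Lemma boxbump_ge0 a b n x : 0 <= boxbump a b n x.
Proof. by apply: prodr_ge0 => i _; exact: bump_ge0. Qed.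

Lemma boxbump_le1 a b n x : boxbump a b n x <= 1.
Proof. by apply: prodr_ile1 => i _; rewrite bump_ge0 bump_le1. Qed.

Lemma boxbump_cvg a b x : boxbump a b n x @[n --> \oo] --> (\1_(obox a b) x : R).
Proof.
rewrite indicE; have [xab|xab] := pselect (obox a b x).
  rewrite mem_set//.
  have h : \prod_j bump (a ord0 j) (b ord0 j) n.+1 (x ord0 j) @[n --> \oo] -->
      \prod_(j : 'I_d) (1 : R).
    rewrite (_ : (fun n => _) = \prod_j (fun n => bump (a ord0 j) (b ord0 j) n.+1 (x ord0 j))).
      2: by apply/funext => n; rewrite fct_prodE.
    elim/big_ind2: _ => [|f1 l1 f2 l2|j _]; [exact: cvg_cst|exact: cvgM|].
    have := @bump_cvg R (a ord0 j) (b ord0 j) (x ord0 j).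
    by rewrite indicE mem_set//= in_itv; exact: xab.
  by move: h; rewrite big1_eq.
rewrite memNset//; move/existsNP: xab => [i xi].
rewrite (_ : (fun n => _) = cst 0); first exact: cvg_cst.
by apply/funext => n; rewrite /boxbump (bigD1 i)//= bump_out ?mul0r//; exact/negP.
Qed.

Lemma test_boxbump (Omega : set E) a b n : cbox a b `<=` Omega ->
  test_function Omega (boxbump a b n).
Proof.
move=> abO; apply: (@test_function_prod _ (fun j => bump (a ord0 j) (b ord0 j) n.+1) _ _ _ abO)
  => [i|i t]; first exact: smooth1_bump.
by move=> tab; apply: bump_out; apply: contra tab => /andP[/ltW -> /ltW ->].
Qed.

End smooth_rV.

(** * Borel sets and boxes *)

Section real_convergence.
Context d (T : measurableType d) (R : realType) (mu : {measure set T -> \bar R}).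

Lemma Rdominated_cvg (D : set T) (f_ : (T -> R)^nat) (f g : T -> R) : measurable D ->
  (forall n, measurable_fun D (f_ n)) ->
  (forall x, D x -> f_ n x @[n --> \oo] --> f x) ->
  mu.-integrable D (EFin \o g) -> (forall n x, D x -> `|f_ n x| <= g x) ->
  mu.-integrable D (EFin \o f) /\
  \int[mu]_(x in D) f_ n x @[n --> \oo] --> \int[mu]_(x in D) f x.
Proof.
move=> mD mf_ f_f ig f_g.
have mEf_ n : measurable_fun D (EFin \o f_ n) by exact/measurable_EFinP.
have Ef_f x : D x -> (f_ n x)%:E @[n --> \oo] --> (f x)%:E.
  by move=> Dx; apply: cvg_EFin; [exact: nearW|exact: f_f].
have mEf : measurable_fun D (EFin \o f) by exact: emeasurable_fun_cvg mEf_ Ef_f.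
have Eg x : forall n, D x -> (`|(EFin \o f_ n) x| <= (EFin \o g) x)%E.
  by move=> n Dx; rewrite lee_fin; exact: f_g.
have [intf _ cf] := @dominated_convergence _ _ _ mu D mD (fun n => EFin \o f_ n)
  (EFin \o f) (EFin \o g) mEf_ mEf (@aeW _ _ _ mu _ Ef_f) ig
  (@aeW _ _ _ mu _ Eg).
split => //; apply: fine_cvg; rewrite fineK//; exact: integrable_fin_num.
Qed.

Lemma indic_cvg_bigcup (F : (set T)^nat) (x : T) : nondecreasing_seq F ->
  \1_(F n) x @[n --> \oo] --> (\1_(\bigcup_n F n) x : R).
Proof.
move=> ndF; have [[k _ Fk]|nF] := pselect ((\bigcup_n F n) x).
  apply: cvg_near_cst; exists k => // n /= kn.
  have Fn : F n x by have /subsetPset := ndF _ _ kn; exact.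
  have Ux : (\bigcup_n F n) x by exists k.
  by rewrite !indicE (mem_set Fn) (mem_set Ux).
rewrite (_ : (fun n => _) = cst (\1_(\bigcup_n F n) x)); first exact: cvg_cst.
apply/funext => n; rewrite /= !indicE (memNset nF) memNset// => Fx; apply: nF; by exists n.
Qed.

Lemma Rintegral_indic (D A : set T) (f : T -> R) :
  \int[mu]_(x in D `&` A) f x = \int[mu]_(x in D) (f x * \1_A x).
Proof.
rewrite Rintegral_mkcondr; apply: eq_Rintegral => x _.
by rewrite /patch indicE; case: ifP => _; rewrite ?mulr1 ?mulr0.
Qed.

End real_convergence.

Section borel_boxes.
Context (R : realType) (d : nat).
Local Notation E := 'rV[R]_d.

Definition ratbox (p : 'rV[rat]_d * 'rV[rat]_d) : set E :=
  obox (map_mx ratr p.1) (map_mx ratr p.2).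

(** The closed box, and not only the open one, lies in [U]: this is what makes its bumps test
    functions in [U]. *)
Lemma open_ratbox (U : set E) x : open U -> U x -> exists p : 'rV[rat]_d * 'rV[rat]_d,
  ratbox p x /\ cbox (map_mx ratr p.1) (map_mx ratr p.2) `<=` U.
Proof.
move=> oU Ux; have /nbhs_ballP [e /= e0 eU] : nbhs x U by exact: open_nbhs_nbhs.
have /choice[p hp] i : exists p : rat, x ord0 i - e < ratr p < x ord0 i.
  have : x ord0 i - e < x ord0 i by rewrite gtrBl.
  by move=> /rat_in_itvoo[q]; rewrite in_itv/= => qP; exists q.
have /choice[q hq] i : exists q : rat, x ord0 i < ratr q < x ord0 i + e.
  have : x ord0 i < x ord0 i + e by rewrite ltrDl.
  by move=> /rat_in_itvoo[r]; rewrite in_itv/= => rP; exists r.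
exists (\row_i p i, \row_i q i); split.
  by move=> i; rewrite !mxE/=; have /andP[_ ->] := hp i; have /andP[-> _] := hq i.
move=> y xy; apply: eU; split => // i j; rewrite ord1 /ball/=.
have := xy j; rewrite !mxE/= => /andP[py yq].
have /andP[hp1 hp2] := hp j; have /andP[hq1 hq2] := hq j.
by rewrite ltr_distlC; apply/andP; split; lra.
Qed.

Lemma obox_setI (a b a' b' : E) : obox a b `&` obox a' b' =
  obox (\row_i Num.max (a ord0 i) (a' ord0 i)) (\row_i Num.min (b ord0 i) (b' ord0 i)).
Proof.
apply/seteqP; split => x /=.
  by move=> [h h'] i; rewrite !mxE gt_max lt_min; have /andP[-> ->] := h i; exact: h'.
move=> h; split=> i; have := h i; rewrite !mxE gt_max lt_min => /andP[/andP[a1 a2] /andP[b1 b2]];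
  by apply/andP.
Qed.

Lemma obox_measurable (a b : E) : measurable (obox a b).
Proof. by apply: open_measurable_rV; exact: obox_open. Qed.

Lemma borel_box_ind (P : set E -> Prop) :
  (forall a b, P (obox a b)) -> P setT ->
  (forall A B, measurable A -> measurable B -> B `<=` A -> P A -> P B -> P (A `\` B)) ->
  (forall F : (set E)^nat, (forall n, measurable (F n)) -> nondecreasing_seq F ->
     (forall n, P (F n)) -> P (\bigcup_n F n)) ->
  forall A, measurable A -> P A.
Proof.
move=> Pbox PT PD PU A mA.
pose G : set (set E) := [set obox p.1 p.2 | p in [set: E * E]].
pose H : set (set E) := [set B | measurable B /\ P B].
have GI : setI_closed G.
  by move=> _ _ [[a b] _ <-] [[a' b'] _ <-] /=; rewrite obox_setI; eexists (_, _).
have lH : lambda_system setT H.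
  split => //.
  - move=> B C CB [mB PB] [mC PC]; split; first exact: measurableD.
    exact: PD.
  - move=> F ndF HF; split; first by apply: bigcupT_measurable => n; exact: (HF n).1.
    by apply: PU => // n; [exact: (HF n).1|exact: (HF n).2].
have GH : G `<=` H.
  by move=> _ [[a b] _ <-]; split; [exact: obox_measurable|exact: Pbox].
suff : <<s G >> A by move=> /(lambda_system_subset GI lH GH (fun _ _ => subsetT _))[].
move: A mA; apply: smallest_sub; first exact: smallest_sigma_algebra.
move=> U oU.
have -> : U = \bigcup_(p in [set p | cbox (map_mx ratr p.1) (map_mx ratr p.2) `<=` U]) ratbox p.
  apply/seteqP; split => [x Ux|x [p /= pU px]]; last exact/pU/obox_cbox.
  by have [p [px pU]] := open_ratbox oU Ux; exists p.
rewrite bigcup_mkcond.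
apply: (@countable_bigcupT_measurable _ (g_sigma_algebraType G)); first exact: countableP.
move=> p; case: ifPn => _; last exact: (@measurable0 _ (g_sigma_algebraType G)).
by apply: sub_sigma_algebra; eexists (_, _).
Qed.

(* Lindelof: countably many rational boxes suffice. *)
Lemma locally_negligible (mu : {measure set E -> \bar R}) (A : set E) :
  (forall x, A x -> exists2 U, open U /\ U x & mu.-negligible (A `&` U)) ->
  mu.-negligible A.
Proof.
move=> loc.
pose B (p : 'rV[rat]_d * 'rV[rat]_d) := if `[< mu.-negligible (A `&` ratbox p) >] then A `&`
  ratbox p else set0.
have AB : A = \bigcup_k (if unpickle k is Some p then B p else set0).
  apply/seteqP; split => [x Ax|x [k _]]; last first.
    by case: (unpickle k) => // p; rewrite /B; case: ifP => // _ [].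
  have [U [oU Ux] nU] := loc x Ax; have [p [px pU]] := open_ratbox oU Ux.
  exists (pickle p) => //; rewrite pickleK /B ifT//; apply/asboolP.
  by apply: negligibleS nU; apply: setIS; exact: subset_trans (@obox_cbox _ _ _ _) pU.
rewrite AB; apply: negligible_bigcup => k; case: (unpickle k) => [p|]; last exact: negligible_set0.
by rewrite /B; case: ifPn => [/asboolP//|_]; exact: negligible_set0.
Qed.

Lemma measurable_boxbump (a b : E) n (D : set E) : measurable_fun D (boxbump a b n).
Proof.
apply: (@measurable_funS _ _ _ _ setT) => //.
rewrite (_ : boxbump a b n = fun x => \prod_j bump (a ord0 j) (b ord0 j) n.+1 (x ord0 j))//.
apply: measurable_prod => j _.
apply: (@measurableT_comp _ _ _ _ _ _ (bump (a ord0 j) (b ord0 j) n.+1));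
  last exact: measurable_rV_coord.
by apply: continuous_measurable_fun; apply: smooth1_continuous; exact: smooth1_bump.
Qed.

(** The fundamental lemma of the calculus of variations. Bumps converge to indicators of boxes, and
    [borel_box_ind] leads from boxes to Borel sets, so that [g] integrates to 0 over every Borel
    part of a small box around each point of [Omega]. *)
Lemma bump_orthogonal_ae0 (mu : {measure set E -> \bar R}) (Omega : set E) (g : E -> R) :
  open Omega -> mu.-integrable Omega (EFin \o g) ->
  (forall a b n, cbox a b `<=` Omega -> \int[mu]_(x in Omega) (g x * boxbump a b n x) = 0) ->
  ae_eq mu Omega g (cst 0).
Proof.
move=> oO ig g0; have mO := open_measurable_rV oO.
have mg : measurable_fun Omega g by apply/measurable_EFinP; exact: measurable_int ig.
have int_box a b : cbox a b `<=` Omega -> \int[mu]_(x in Omega) (g x * \1_(obox a b) x) = 0.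
  move=> abO.
  have [] := @Rdominated_cvg _ _ _ mu Omega (fun n x => g x * boxbump a b n x)
    (fun x => g x * \1_(obox a b) x) (fun x => `|g x|) mO.
  - by move=> n; apply: measurable_funM => //; exact: measurable_boxbump.
  - by move=> x _; apply: cvgM; [exact: cvg_cst|exact: boxbump_cvg].
  - by have := integrable_abse ig; apply: eq_integrable.
  - move=> n x _ /=; rewrite normrM ler_piMr// ger0_norm ?boxbump_ge0//.
    exact: boxbump_le1.
  move=> _; under eq_cvg do rewrite g0//.
  by move=> /(cvg_unique _ (cvg_cst 0)) <-.
apply: (@negligibleS _ _ _ _ (Omega `&` [set x | g x != 0])).
  by move=> x /= /not_implyP[Ox /eqP].
apply: locally_negligible => x [Ox _].
have [p [px pO]] := open_ratbox oO Ox.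
set a := map_mx ratr p.1 in pO; set b := map_mx ratr p.2 in pO.
exists (obox a b); first by split => //; exact: obox_open.
have mQ := obox_measurable a b.
have ih (h : E -> R) : measurable_fun Omega h -> (forall x, 0 <= h x <= 1) ->
    mu.-integrable Omega (EFin \o (fun x => g x * h x)).
  move=> mh h01; apply: (@le_integrable_fin _ _ _ _ _ _ (fun x => `|g x|)) => //.
  - exact: measurable_funM.
  - by move=> y _; have /andP[h0 h1] := h01 y; rewrite normrM ler_piMr// ger0_norm.
  - by have := integrable_abse ig; apply: eq_integrable.
have indic01 (A : set E) y : 0 <= (\1_A y : R) <= 1 by rewrite indicE; case: (_ \in _) => /=;
  rewrite ?lexx ?ler01.
(* The hypothesis concerns only boxes whose closure is in [Omega], while the induction starts from
   arbitrary ones. Truncating to a good box solves this, as its intersection with any box is a good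
   box. *)
pose h x := g x * \1_(obox a b) x.
have mh : measurable_fun Omega h by apply: measurable_funM => //; exact: measurable_indic.
have int_h : mu.-integrable Omega (EFin \o h) by apply: ih => //; exact: measurable_indic.
have ihA A : measurable A -> mu.-integrable Omega (EFin \o (fun x => h x * \1_A x)).
  move=> mA; rewrite (_ : (fun x => _) = (fun x => g x * \1_(obox a b `&` A) x)).
    by apply: ih => //; apply: measurable_indic; exact: measurableI.
  by apply/funext => y; rewrite indicI mulrA.
have key A : measurable A -> \int[mu]_(x in Omega) (h x * \1_A x) = 0.
  move: A; apply: borel_box_ind.
  - move=> a' b'; rewrite -(int_box (\row_i Num.max (a ord0 i) (a' ord0 i)) (\row_i Num.min (b
    ord0 i) (b' ord0 i))).
      by apply: eq_Rintegral => y _; rewrite -obox_setI indicI mulrA.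
    move=> y hy; apply: pO => i; have := hy i; rewrite !mxE ge_max le_min.
    by move=> /andP[/andP[-> _] /andP[-> _]].
  - rewrite -(int_box a b pO); apply: eq_Rintegral => y _.
    by rewrite indicE in_setT mulr1.
  - move=> A B mA mB BA A0 B0.
    rewrite -[RHS](subrr 0) -{1}A0 -{1}B0 -RintegralB//; [|exact: ihA..].
    apply: eq_Rintegral => y _; rewrite -mulrBr; congr (_ * _).
    rewrite !indicE in_setD; have [yB|yB] /= := boolP (y \in B); last by rewrite andbT subr0.
    by rewrite (mem_set (BA _ (set_mem yB))) andbF subrr.
  - move=> F mF ndF F0.
    have [] := @Rdominated_cvg _ _ _ mu Omega (fun n x => h x * \1_(F n) x)
      (fun x => h x * \1_(\bigcup_n F n) x) (fun x => `|h x|) mO.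
    + by move=> n; apply: measurable_funM => //; exact: measurable_indic.
    + by move=> y _; apply: cvgM; [exact: cvg_cst|exact: indic_cvg_bigcup].
    + by have := integrable_abse int_h; apply: eq_integrable.
    + by move=> n y _; have /andP[h0 h1] := indic01 (F n) y; rewrite normrM ler_piMr// ger0_norm.
    move=> _; under eq_cvg do rewrite F0//.
    by move=> /(cvg_unique _ (cvg_cst 0)) <-.
have QO : obox a b `<=` Omega by exact: subset_trans (@obox_cbox _ _ _ _) pO.
have igQ : mu.-integrable (obox a b) (EFin \o g) by exact: integrableS ig.
have := @integral_ae_eq _ _ _ mu (obox a b) mQ (cst 0%E) (EFin \o g) igQ (measurable_cst _).
have H A : A `<=` obox a b -> measurable A ->
    (\int[mu]_(x in A) (EFin \o g) x = \int[mu]_(x in A) cst 0 x)%E.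
  move=> AQ mA; rewrite integral0 -[LHS]fineK; last first.
    by apply: integrable_fin_num => //; exact: integrableS igQ.
  congr EFin; rewrite -(key A mA) -/(Rintegral mu A g).
  rewrite -[in LHS](setIidr (subset_trans AQ QO)) Rintegral_indic.
  apply: eq_Rintegral => y _; rewrite /h !indicE.
  have [yA|yA] := boolP (y \in A); last by rewrite !mulr0.
  by rewrite (mem_set (AQ _ (set_mem yA))) !mulr1.
move=> /(_ H); apply: negligibleS => y /= [[Oy /eqP gy] Qy] gE; apply: gy.
by have [] := gE Qy.
Qed.

End borel_boxes.

Lemma integrable_indic_fin d (T : measurableType d) (R : realType)
    (mu : {measure set T -> \bar R}) (A : set T) : measurable A -> (mu A < +oo)%E ->
  mu.-integrable setT (fun x => (\1_A x : R)%:E).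
Proof.
move=> mA fin; apply/integrableP; split.
  by apply/measurable_EFinP; exact: measurable_indic.
rewrite (eq_integral (fun x => (\1_A x)%:E)); last first.
  by move=> x _; rewrite gee0_abs// lee_fin.
by rewrite integral_indic ?setIT.
Qed.

(** * Integrals of partial derivatives *)

Section integral_partial.
Context (R : realType).
Local Notation lambda := (lebesgue_rV R).

Definition hbox n (M : R) : set 'rV[R]_n := [set x | forall i, x ord0 i \in `]- M, M]].

Lemma measurable_hbox n M : measurable (@hbox n M).
Proof.
rewrite (_ : hbox _ = \bigcap_(i in [set: 'I_n])
   ((fun y : 'rV[R]_n => y ord0 i) @^-1` `]- M, M])).
  apply: fin_bigcap_measurable => // i _; rewrite -[X in measurable X]setTI.
  exact: measurable_rV_coord.
by apply/seteqP; split => y /= h i; [move=> _; exact: h|exact: (h i I)].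
Qed.

Lemma hbox_fin n M : 0 <= M -> (lambda n (@hbox n M) < +oo)%E.
Proof.
move=> M0; pose a : 'rV[R]_n := \row__ - M; pose b : 'rV[R]_n := \row__ M.
have -> : @hbox n M = [set x | forall i, x ord0 i \in `]a ord0 i, b ord0 i]].
  by apply/seteqP; split => x /= + i => /(_ i); rewrite !mxE.
rewrite lebesgue_rV_box ?ltry// => i.
by rewrite !mxE (le_trans _ M0)// oppr_le0.
Qed.

Lemma bounded_integrable n (f : 'rV[R]_n -> R) (C M : R) : 0 <= M ->
  measurable_fun setT f -> (forall x, `|f x| <= C * \1_(@hbox n M) x) ->
  (lambda n).-integrable setT (EFin \o f).
Proof.
move=> M0 mf fC; apply: (@le_integrable_fin _ _ _ (lambda n) setT f (fun x => C * \1_(@hbox n M)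
  x)) => //.
have fin : (lambda n (@hbox n M) < +oo)%E by exact: hbox_fin.
have h : (lambda n).-integrable setT (fun x => (\1_(@hbox n M) x)%:E).
  exact: integrable_indic_fin (@measurable_hbox n M) fin.
by have := integrableZl measurableT C h; apply: eq_integrable.
Qed.

(** Fubini in both orders. A derivative along the first coordinate calls for the inner integral over
    [t]; one along another coordinate calls for the inner integral over [y], where induction on the
    dimension applies. *)
Lemma Rintegral_step n (f : 'rV[R]_n.+1 -> R) :
  (lambda n.+1).-integrable setT (EFin \o f) ->
  (forall t, (lambda n).-integrable setT (fun y => (f (cons_rV (t, y)))%:E)) ->
  (forall y, lebesgue_measure.-integrable setT (fun t => (f (cons_rV (t, y)))%:E)) ->
  \int[lambda n.+1]_x f x =
    \int[lebesgue_measure]_t \int[lambda n]_y f (cons_rV (t, y)) /\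
  \int[lambda n.+1]_x f x =
    \int[lambda n]_y \int[lebesgue_measure]_t f (cons_rV (t, y)).
Proof.
move=> intf intt inty; have mf := measurable_int _ intf.
have mc := @measurable_cons_rV R n.
pose P := (@lebesgue_measure R \x lambda n)%E.
have intP : P.-integrable setT ((EFin \o f) \o @cons_rV R n).
  apply/integrableP; split; first exact: measurableT_comp.
  have := (integrableP _ _ _ intf).2; apply: le_lt_trans.
  rewrite [leRHS](@ge0_integral_pushforward _ _ _ _ _ _ mc P setT (fun x => `|(EFin \o f) x|%E))//.
  by apply: measurableT_comp.
have E : \int[lambda n.+1]_x f x = fine (\int[P]_z ((EFin \o f) \o @cons_rV R n) z)%E.
  by rewrite /Rintegral [X in fine X](@integral_pushforward _ _ _ _ _ _ mc P setT).
rewrite E /P; split.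
  rewrite -integral12_prod_meas1//; apply: congr1; apply: eq_integral => t _.
  by rewrite /fubini_F /Rintegral fineK//; exact: integrable_fin_num (intt t).
rewrite -integral21_prod_meas1//; apply: congr1; apply: eq_integral => y _.
by rewrite /fubini_G /Rintegral fineK//; exact: integrable_fin_num (inty y).
Qed.

Lemma Rintegral_derive0 (f f' : R -> R) (K : R) : 0 <= K -> continuous f' ->
  (forall t : R, is_derive t 1 f (f' t)) ->
  (forall t, t \notin `]- K, K] -> f t = 0) -> (forall t, t \notin `]- K, K] -> f' t = 0) ->
  \int[lebesgue_measure]_t f' t = 0.
Proof.
(* The half-open interval contains [K], where [f0] does not apply, and it is empty for [K = 0].
   Moving the ends outward by 1 settles both. *)
move=> K0 cf' df f0 f'0; pose L := K + 1.
have LL : - L < L by rewrite /L; lra.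
have -> : \int[lebesgue_measure]_t f' t = \int[lebesgue_measure]_(t in `[- L, L]) f' t.
  rewrite [RHS]Rintegral_mkcond; apply: eq_Rintegral => t _; rewrite /patch.
  case: ifPn => // tL; apply: f'0; apply: contra tL; rewrite mem_setE !in_itv/= /L.
  by move=> /andP[h1 h2]; apply/andP; split; lra.
have cf : continuous f.
  move=> t; apply: differentiable_continuous; apply/derivable1_diffP.
  exact: (@ex_derive _ _ _ _ _ _ _ (df t)).
have fL : f L = 0 by apply: f0; rewrite in_itv/= /L; apply/negP => /andP[]; lra.
have fNL : f (- L) = 0 by apply: f0; rewrite in_itv/= /L; apply/negP => /andP[]; lra.
rewrite /Rintegral (@continuous_FTC2 _ f' f) //.
- by rewrite fL fNL sube0.
- exact: continuous_subspaceT.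
- split.
  + by move=> t _; exact: (@ex_derive _ _ _ _ _ _ _ (df t)).
  + exact/cvg_at_right_filter/cf.
  + exact/cvg_at_left_filter/cf.
- by move=> t _; rewrite derive1E; exact: (@derive_val _ _ _ _ _ _ _ (df t)).
Qed.

Lemma rV_lineE n (x v : 'rV[R]_n) s i : (x + s *: v) ord0 i = x ord0 i + s * v ord0 i.
Proof. by rewrite !mxE. Qed.

Lemma cons_rV_line0 n t (y : 'rV[R]_n) s :
  @cons_rV R n (t, y) + s *: delta_mx ord0 ord0 = cons_rV (t + s, y).
Proof.
apply/rowP => i; rewrite rV_lineE; have [j ->|->] := unliftP ord0 i.
  by rewrite !cons_rVS mxE/= mulr0 addr0.
by rewrite !cons_rV0 mxE/= mulr1.
Qed.

Lemma cons_rV_lineS n t (y : 'rV[R]_n) s j :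
  @cons_rV R n (t, y) + s *: delta_mx ord0 (lift ord0 j) = cons_rV (t, y + s *: delta_mx ord0 j).
Proof.
apply/rowP => i; rewrite rV_lineE; have [k ->|->] := unliftP ord0 i.
  by rewrite !cons_rVS/= rV_lineE !mxE (inj_eq lift_inj).
by rewrite !cons_rV0 mxE/= mulr0 addr0.
Qed.

Lemma hbox_cons n M t (y : 'rV[R]_n) :
  hbox M (cons_rV (t, y)) <-> t \in `]- M, M] /\ hbox M y.
Proof.
split=> [h|[ht hy] i].
  by split => [|i]; [have := h ord0; rewrite cons_rV0|have := h (lift ord0 i); rewrite cons_rVS].
by have [k ->|->] := unliftP ord0 i; rewrite ?cons_rVS ?cons_rV0.
Qed.

(** Regularity is required only along lines in the direction [i], a condition which passes unchanged
    to the sections [phi (cons_rV (t, _))] in the induction on the dimension. *)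
Lemma Rintegral_line_derive0 n (i : 'I_n) (phi psi : 'rV[R]_n -> R) (C M : R) :
  0 <= M -> 0 <= C -> measurable_fun setT psi ->
  (forall x, continuous (fun t : R => psi (x + t *: delta_mx ord0 i))) ->
  (forall x (t : R), is_derive t 1 (fun s => phi (x + s *: delta_mx ord0 i))
     (psi (x + t *: delta_mx ord0 i))) ->
  (forall x, `|psi x| <= C * \1_(@hbox n M) x) ->
  (forall x, ~ hbox M x -> phi x = 0) ->
  \int[lambda n]_x psi x = 0.
Proof.
move=> M0 C0; elim: n i phi psi => [[]//|n IH] i phi psi mpsi cpsi dphi bpsi phi0.
have mtail t : measurable_fun setT (fun y : 'rV[R]_n => psi (cons_rV (t, y))).
  apply: (measurableT_comp mpsi); apply: (measurableT_comp (@measurable_cons_rV R n)).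
  exact: pair1_measurable.
have btail t y : `|psi (cons_rV (t, y))| <= C * \1_(@hbox n M) y.
  rewrite (le_trans (bpsi _))// ler_wpM2l// !indicE.
  have [/set_mem/hbox_cons[_ hy]|_] := boolP (cons_rV (t, y) \in _).
    by rewrite mem_set.
  by case: (_ \in _).
have psi0 x : ~ hbox M x -> psi x = 0.
  by move=> nx; apply/eqP; have := bpsi x; rewrite indicE memNset// mulr0 normr_le0.
have inty y : lebesgue_measure.-integrable setT (fun t => (psi (cons_rV (t, y)))%:E).
  apply: (@le_integrable_fin _ (measurableTypeR R) R lebesgue_measure setT (fun t => psi
    (cons_rV (t, y))) (fun t => C * \1_`]- M, M] t)) => //.
  - apply: (measurableT_comp mpsi); apply: (measurableT_comp (@measurable_cons_rV R n)).
    exact: pair2_measurable.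
  - move=> t _; rewrite (le_trans (bpsi _))// ler_wpM2l// !indicE.
    have [/set_mem/hbox_cons[ht _]|_] := boolP (cons_rV (t, y) \in _).
      by rewrite mem_set.
    by case: (_ \in _).
  - have h : lebesgue_measure.-integrable setT (fun t => (\1_`]- M, M] t : R)%:E).
      have fin : (lebesgue_measure (`](- M)%R, M]%classic : set R) < +oo)%E.
        by rewrite lebesgue_measure_itv/=; case: ifP => _; rewrite ?ltry// -EFinD ltry.
      exact: (@integrable_indic_fin _ (measurableTypeR R) R lebesgue_measure _ (measurable_itv
        _) fin).
    by have := integrableZl measurableT C h; apply: eq_integrable.
have [E1 E2] := @Rintegral_step n psi (bounded_integrable M0 mpsi bpsi)
  (fun t => bounded_integrable M0 (mtail t) (btail t))
  inty.
have [j ij|i0] := unliftP ord0 i.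
  rewrite E1 (@eq_Rintegral _ _ _ _ _ (cst 0)) ?Rintegral_cst ?mul0r// => t _.
  apply: (IH j (fun y => phi (cons_rV (t, y))) (fun y => psi (cons_rV (t, y)))) => //.
  - move=> y; have := cpsi (cons_rV (t, y)); rewrite ij.
    by under eq_fun do rewrite cons_rV_lineS.
  - move=> y s; have := dphi (cons_rV (t, y)) s; rewrite ij cons_rV_lineS.
    by under eq_fun do rewrite cons_rV_lineS.
  - by move=> y hy; apply: phi0 => /hbox_cons[].
rewrite E2 (@eq_Rintegral _ _ _ _ _ (cst 0)) ?Rintegral_cst ?mul0r// => y _.
have line t : cons_rV (0, y) + t *: delta_mx ord0 i = cons_rV (t, y).
  by rewrite i0 cons_rV_line0 add0r.
apply: (@Rintegral_derive0 (fun t => phi (cons_rV (t, y))) _ M) => //.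
- by have := cpsi (cons_rV (0, y)); under eq_fun do rewrite line.
- by move=> t; have := dphi (cons_rV (0, y)) t; rewrite line; under eq_fun do rewrite line.
- by move=> t tM; apply: phi0 => /hbox_cons[tM1 _]; rewrite tM1 in tM.
- by move=> t tM; apply: psi0 => /hbox_cons[tM1 _]; rewrite tM1 in tM.
Qed.
End integral_partial.

(** * Weak gradients *)

Section norm2_on.
Context d (T : measurableType d) (R : realType) (mu : {measure set T -> \bar R}).
Variables (D : set T) (mD : measurable D).
Implicit Types f g : T -> R.

Definition norm2 f := Num.sqrt (\int[mu]_(x in D) (f x ^+ 2)).

Lemma norm2_ge0 f : 0 <= norm2 f. Proof. exact: sqrtr_ge0. Qed.

Lemma sqr_norm2 f : norm2 f ^+ 2 = \int[mu]_(x in D) (f x ^+ 2).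
Proof. by rewrite sqr_sqrtr//; apply: Rintegral_ge0 => x _; exact: sqr_ge0. Qed.

(** Extension by zero embeds the square-integrable functions on [D] into [L2], from which the
    inequalities for [norm2] are inherited. *)
Lemma dot_patch f g (sf : sqint mu D f) (sg : sqint mu D g) :
  \int[mu]_(x in D) (f x * g x) =
  L2_ip mu (mkL2 (sqint_patch mD sf)) (mkL2 (sqint_patch mD sg)).
Proof.
rewrite /= dot_mkL2 Rintegral_mkcond; apply: eq_Rintegral => x _.
by rewrite /patch; case: ifP => // _; rewrite mulr0.
Qed.

Lemma norm2_patch f (sf : sqint mu D f) :
  norm2 f = nrm (L2_ip mu) (mkL2 (sqint_patch mD sf)).
Proof.
by rewrite /norm2 /nrm -dot_patch; congr Num.sqrt; apply: eq_Rintegral => x _; rewrite expr2.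
Qed.

Lemma norm2_cauchy f g : sqint mu D f -> sqint mu D g ->
  `|\int[mu]_(x in D) (f x * g x)| <= norm2 f * norm2 g.
Proof. by move=> sf sg; rewrite dot_patch !norm2_patch; exact: cauchy_schwarz. Qed.

Lemma norm2D f g : sqint mu D f -> sqint mu D g ->
  norm2 (fun x => f x + g x) <= norm2 f + norm2 g.
Proof.
move=> sf sg; rewrite (norm2_patch (sqintD mD sf sg)) (norm2_patch sf) (norm2_patch sg).
apply: le_trans (nrmD _ _ _); rewrite le_eqVlt; apply/orP; left; apply/eqP.
apply: eqn_nrm; apply/L2_eqnP; apply: aeW => x _.
rewrite [RHS](_ : _ = (f \_ D) x + (g \_ D) x)// mkL2E /patch.
by case: ifP => // _; rewrite addr0.
Qed.

Lemma norm2Z f (a : R) : sqint mu D f -> norm2 (fun x => a * f x) = `|a| * norm2 f.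
Proof.
move=> [mf sf]; rewrite /norm2 -sqrtr_sqr -sqrtrM ?sqr_ge0//; congr Num.sqrt.
by rewrite -(RintegralZl _ mD sf); apply: eq_Rintegral => x _; rewrite exprMn.
Qed.

Lemma norm2M f g (c : R) : sqint mu D f -> measurable_fun D g ->
  (forall x, D x -> `|g x| <= c) -> norm2 (fun x => f x * g x) <= c * norm2 f.
Proof.
(* On an empty [D] nothing forces [c] to be nonnegative. *)
move=> sf mg gc; have [D0|/set0P[x0 Dx0]] := eqVneq D set0.
  by rewrite /norm2 D0 !Rintegral_set0 sqrtr0 mulr0.
have c0 : 0 <= c by rewrite (le_trans _ (gc x0 Dx0)).
have [_ s1] := sqintM mD sf mg gc.
rewrite /norm2 -[X in X * _](ger0_norm c0) -sqrtr_sqr -sqrtrM ?sqr_ge0// ler_wsqrtr//.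
rewrite -(RintegralZl _ mD sf.2); apply: le_Rintegral => //.
  by have := integrableZl mD (c ^+ 2) sf.2.
move=> x Dx; rewrite exprMn mulrC ler_wpM2r ?sqr_ge0//.
by rewrite -[leLHS]real_normK ?num_real// ler_sqr ?nnegrE ?gc.
Qed.

Lemma ae_norm2 f g : sqint mu D f -> sqint mu D g -> ae_eq mu D f g -> norm2 f = norm2 g.
Proof.
move=> sf sg fg; congr (Num.sqrt (fine _)); apply: ae_eq_integral => //.
- exact: measurable_int sf.2.
- exact: measurable_int sg.2.
- by apply: filterS fg => x /= fg Dx; rewrite fg.
Qed.

Lemma ae_eq_Rintegral f g : measurable_fun D f -> measurable_fun D g -> ae_eq mu D f g ->
  \int[mu]_(x in D) f x = \int[mu]_(x in D) g x.
Proof.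
move=> mf mg fg; congr fine; apply: ae_eq_integral => //; try exact/measurable_EFinP.
by apply: filterS fg => x /= fg Dx; rewrite fg.
Qed.

Lemma norm2_eq0 f : sqint mu D f -> norm2 f = 0 -> ae_eq mu D f (cst 0).
Proof.
move=> sf; rewrite (norm2_patch sf) => f0.
have /L2_eqnP : eqn (L2_ip mu) (mkL2 (sqint_patch mD sf)) 0 by rewrite /eqn subr0.
by apply: filterS => x /= /(_ I) + Dx; rewrite /patch mem_set.
Qed.

End norm2_on.

Section test_functions.
Context (R : realType) (d : nat).
Local Notation E := 'rV[R]_d.
Local Notation lambda := (lebesgue_rV R d).

Lemma continuous_measurable_rV (f : E -> R) : continuous f -> measurable_fun setT f.
Proof.
move=> cf; apply: (measurability _ (RGenOpens.measurableE R)).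
move=> _ [_ [a [b ->] <-]]; rewrite setTI; apply: open_measurable_rV.
by apply: open_comp => [x _|]; [exact: cf|exact: interval_open].
Qed.

Lemma smooth_measurable (D : set E) (f : E -> R) : smooth f -> measurable_fun D f.
Proof.
move=> sf; apply: (@measurable_funS _ _ _ _ setT) => //.
by apply: continuous_measurable_rV; exact: smooth_continuous.
Qed.

Lemma continuous_bounded_on (K : set E) (f : E -> R) : compact K ->
  {within K, continuous f} -> exists2 C : R, 0 <= C & forall x, K x -> `|f x| <= C.
Proof.
move=> cK cf; have := continuous_compact cf cK => /compact_bounded [M [_ hM]].
exists (`|M| + 1); first by rewrite addr_ge0.
move=> x Kx; apply: (hM (`|M| + 1)); last by exists x.
by rewrite (le_lt_trans (ler_norm _))// ltrDl.
Qed.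

Lemma derive_support (phi : E -> R) (x v : E) :
  ~ closure [set x | phi x != 0] x -> 'D_v phi x = 0.
Proof.
move=> nx; have : \forall y \near x, cst 0 y = phi y.
  have : open (~` closure [set x | phi x != 0]) by apply: closed_openC; exact: closed_closure.
  rewrite openE => /(_ x nx); apply: filterS => y /= ny.
  by apply/esym/eqP/negPn/negP => py; apply: ny; exact: subset_closure.
by move=> /near_eq_derive <-; rewrite derive_cst.
Qed.

Variables (Omega : set E).
Hypotheses (Oopen : open Omega) (Obounded : bounded_set Omega).

Lemma Omega_measurable : measurable Omega. Proof. exact: open_measurable_rV. Qed.
Let mO := Omega_measurable.

Lemma Omega_hbox : exists2 M : R, 0 <= M & Omega `<=` hbox M.
Proof.
(* One unit for the strict inequality in [bounded_set], another because [hbox] is open at its left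
   ends. *)
move: Obounded => [M [_ hM]]; exists (`|M| + 2); first by rewrite addr_ge0.
have M1 : M < `|M| + 1 by rewrite (le_lt_trans (ler_norm _))// ltrDl.
move=> x /(hM _ M1) xM i; rewrite in_itv/=.
have : `|x ord0 i| <= `|M| + 1.
  apply: le_trans xM; rewrite [leRHS]/Num.norm/= mx_normrE.
  by apply: (le_trans _ (le_bigmax _ _ (ord0, i))).
by rewrite ler_norml => /andP[x1 x2]; apply/andP; split; lra.
Qed.

Lemma Omega_fin : (lambda Omega < +oo)%E.
Proof.
have [M M0 OM] := Omega_hbox; apply: le_lt_trans (hbox_fin d M0).
by apply: le_measure => //; rewrite inE//; exact: measurable_hbox.
Qed.

Lemma test_function_bounded phi : test_function Omega phi ->
  exists2 C : R, 0 <= C & forall x, `|phi x| <= C.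
Proof.
move=> [sp cp pO].
have [C C0 hC] := continuous_bounded_on cp (continuous_subspaceT (smooth_continuous sp)).
exists C => // x; have [px|px] := eqVneq (phi x) 0; first by rewrite px normr0.
by apply: hC; exact: subset_closure.
Qed.

Lemma test_function_partial phi i : test_function Omega phi ->
  test_function Omega (partial i phi).
Proof.
move=> [sp cp pO].
have supp : closure [set x : E | partial i phi x != 0] `<=` closure [set x : E | phi x != 0].
  rewrite [X in _ `<=` X](closure_id (closure [set x : E | phi x != 0])).1;
    last exact: closed_closure.
  apply: closureS => x /= /eqP px; apply: contrapT => /derive_support.
  by move=> /(_ (delta_mx ord0 i)).
split; [exact: smooth_partial| |exact: subset_trans pO].
by apply: subclosed_compact supp => //; exact: closed_closure.
Qed.

Lemma test_function_sqint phi : test_function Omega phi -> sqint lambda Omega phi.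
Proof.
move=> tp; have [C C0 hC] := test_function_bounded tp.
apply: (@sqint_ae_bounded _ _ _ _ _ _ C) => //; first exact: Omega_fin.
by apply: smooth_measurable; case: tp.
Qed.

(** As [phi] and its derivative vanish off [Omega], the integral may be taken over the whole space,
    where it vanishes along every line in the direction [i]. *)
Lemma Rintegral_partial0 phi i : test_function Omega phi ->
  \int[lambda]_(x in Omega) partial i phi x = 0.
Proof.
move=> tp; have tp' := test_function_partial i tp.
have [C C0 hC] := test_function_bounded tp'; have [M M0 OM] := Omega_hbox.
have p0 x : ~ Omega x -> phi x = 0 by exact: test_function0.
have p'0 x : ~ Omega x -> partial i phi x = 0 by exact: test_function0.
transitivity (\int[lambda]_x partial i phi x).
  rewrite Rintegral_mkcond; apply: eq_Rintegral => x _; rewrite /patch.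
  by case: ifPn => // /negP nx; rewrite p'0// => /mem_set.
apply: (@Rintegral_line_derive0 _ _ i phi _ C M) => //.
- by apply: smooth_measurable; case: tp'.
- move=> x t; apply: (@continuous_comp _ _ _ (fun t : R => x + t *: delta_mx ord0 i)).
    by apply: cvgD; [exact: cvg_cst|apply: cvgZr_tmp; exact: cvg_id].
  by apply: smooth_continuous; case: tp'.
- move=> x t; apply: derive_line; apply: smooth_differentiable; by case: tp.
- move=> x; rewrite indicE; have [/set_mem hx|hx] := boolP (x \in _).
    by rewrite mulr1.
  by rewrite mulr0 p'0 ?normr0// => /OM/mem_set; apply/negP.
- by move=> x nx; apply: p0 => /OM.
Qed.

End test_functions.

Section weak_gradients.
Context (R : realType) (d : nat) (Omega : set 'rV[R]_d).
Hypotheses (Oopen : open Omega) (Obounded : bounded_set Omega).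
Local Notation E := 'rV[R]_d.
Local Notation lambda := (lebesgue_rV R d).
Local Notation sq := (sqint lambda Omega).
Local Notation n2 := (norm2 lambda Omega).
Local Notation wg := (weak_gradient Omega).
Implicit Types (u v m : E -> R) (g h : 'I_d -> E -> R).

Let mO : measurable Omega := Omega_measurable Oopen.
Let Ofin := Omega_fin Oopen Obounded.

Let mul_int u v : sq u -> sq v -> lambda.-integrable Omega (EFin \o (fun x => u x * v x)).
Proof. exact: sqint_mul. Qed.

Let test_sq phi : test_function Omega phi -> sq phi.
Proof. exact: test_function_sqint. Qed.

Let test_partial_sq phi i : test_function Omega phi -> sq (partial i phi).
Proof. by move=> /(test_function_partial i); exact: test_sq. Qed.

Lemma closure_Omega_compact : compact (closure Omega).
Proof.
apply: bounded_closed_compact; last exact: closed_closure.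
have [M M0 OM] := Omega_hbox Obounded.
have OC : closure Omega `<=` cbox (\row__ - M) (\row__ M).
  rewrite (closure_id (cbox _ _)).1; last exact: cbox_closed.
  by apply: closureS => x /OM h i; have := h i; rewrite in_itv !mxE/= => /andP[/ltW -> ->].
have /compact_bounded := @cbox_compact R d (\row__ - M) (\row__ M).
by move=> [N [Nr hN]]; exists N; split => // x /hN h y /OC; exact: h.
Qed.

Lemma smooth_bounded m : smooth m -> exists2 C : R, 0 <= C & forall x, Omega x -> `|m x| <= C.
Proof.
move=> sm; have [C C0 hC] := continuous_bounded_on closure_Omega_compact
  (continuous_subspaceT (smooth_continuous sm)).
by exists C => // x Ox; apply: hC; exact: subset_closure.
Qed.

Lemma sq_smooth m : smooth m -> sq m.
Proof.
move=> sm; have [C _ hC] := smooth_bounded sm.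
by apply: (sqint_ae_bounded mO Ofin _ hC); exact: smooth_measurable.
Qed.

Lemma test_orthogonal_ae0 f : lambda.-integrable Omega (EFin \o f) ->
  (forall phi, test_function Omega phi -> \int[lambda]_(x in Omega) (f x * phi x) = 0) ->
  ae_eq lambda Omega f (cst 0).
Proof.
move=> intf f0; apply: bump_orthogonal_ae0 => // a b n abO.
by apply: f0; exact: test_boxbump.
Qed.

Lemma weak_gradient_unique u u' g g' : sq u -> sq u' -> ae_eq lambda Omega u u' ->
  wg u g -> wg u' g' -> forall i, ae_eq lambda Omega (g i) (g' i).
Proof.
move=> su su' uu' ug ug' i; have [sg Hg] := ug i; have [sg' Hg'] := ug' i.
have sN : sq (fun x => g i x + -1 * g' i x) by apply: sqintD => //; exact: sqintZ.
have : ae_eq lambda Omega (fun x => g i x + -1 * g' i x) (cst 0).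
  apply: test_orthogonal_ae0 => [|phi tp]; first exact: sqint_integrable sN.
  have sp := test_sq tp; have sp' := test_partial_sq i tp.
  rewrite (@eq_Rintegral _ _ _ lambda Omega (fun x => g i x * phi x - g' i x * phi x)); last first.
    by move=> x _; ring.
  rewrite RintegralB//; [|exact: mul_int..].
  apply/eqP; rewrite -oppr_eq0 opprB addrC -Hg// -[X in _ + X]opprK -Hg'// subr_eq0; apply/eqP.
  apply: ae_eq_Rintegral => //; try by apply: measurable_funM; [case: su|case: sp']; case: su'.
  by apply: filterS uu' => x /= E Ox; rewrite E.
by apply: filterS => x /= E Ox; have := E Ox; rewrite mulN1r => /subr0_eq.
Qed.

Lemma weak_gradient_linear (a : R) u v g h : sq u -> sq v -> wg u g -> wg v h ->
  wg (fun x => a * u x + v x) (fun i x => a * g i x + h i x).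
Proof.
move=> su sv ug vh i; have [sg Hg] := ug i; have [sh Hh] := vh i.
split; first by apply: sqintD => //; exact: sqintZ.
move=> phi tp; have sp := test_sq tp; have sp' := test_partial_sq i tp.
have lin (f k p : E -> R) : sq f -> sq k -> sq p ->
    \int[lambda]_(x in Omega) ((a * f x + k x) * p x) =
    a * \int[lambda]_(x in Omega) (f x * p x) + \int[lambda]_(x in Omega) (k x * p x).
  move=> sf sk sp0; rewrite -(RintegralZl _ mO (mul_int sf sp0)) -RintegralD//.
  - by apply: eq_Rintegral => x _; ring.
  - by have := integrableZl mO a (mul_int sf sp0).
  - exact: mul_int.
by rewrite !lin// Hg// Hh//; ring.
Qed.

Lemma weak_gradient_cst (c : R) : wg (cst c) (fun=> cst 0).
Proof.
move=> i; split; first by apply: sq_smooth; exact: smooth_cst.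
move=> phi tp; rewrite RintegralZl ?Rintegral_partial0//; last first.
  by apply: sqint_integrable => //; exact: test_partial_sq.
rewrite mulr0 (@eq_Rintegral _ _ _ lambda Omega (cst 0)) ?Rintegral_cst ?mul0r ?oppr0// => x _.
by rewrite /= mul0r.
Qed.

(** The identity for [phi] is that for [u] tested against [m \* phi], again a test function, after
    expanding its derivative. *)
Lemma weak_gradient_mul m u g : smooth m -> sq u -> wg u g ->
  wg (fun x => m x * u x) (fun i x => m x * g i x + partial i m x * u x).
Proof.
move=> sm su ug i; have [sg Hg] := ug i.
have [C _ hC] := smooth_bounded sm; have [C' _ hC'] := smooth_bounded (smooth_partial i sm).
have smul k f C0 : smooth k -> (forall x, Omega x -> `|k x| <= C0) -> sq f -> sq (fun x => k x *
  f x).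
  move=> sk kC sf; have := sqintM mO sf (@smooth_measurable _ _ Omega _ sk) kC.
  by rewrite (_ : _ \* _ = (fun x => k x * f x))//; apply/funext => x /=; rewrite mulrC.
have s1 := smul _ _ _ sm hC sg; have s2 := smul _ _ _ (smooth_partial i sm) hC' su.
split; first exact: sqintD.
move=> phi tp; have tmp := test_functionM sm tp.
have sp := test_sq tp; have := Hg _ tmp; rewrite partialM; last first.
- by move=> x; apply: smooth_differentiable; case: tp.
- by move=> x; exact: smooth_differentiable.
have s3 := smul _ _ _ sm hC su; have sp' := test_partial_sq i tp.
rewrite (@eq_Rintegral _ _ _ lambda Omega (fun x => (m x * u x) * partial i phi x + (partial i m
  x * u x) * phi x)); last first.
  by move=> x _ /=; ring.
rewrite RintegralD//; [|exact: mul_int..].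
move=> H.
have -> : \int[lambda]_(x in Omega) ((m x * g i x + partial i m x * u x) * phi x) =
    \int[lambda]_(x in Omega) ((m x * g i x) * phi x + (partial i m x * u x) * phi x).
  by apply: eq_Rintegral => x _; ring.
rewrite RintegralD//; [|exact: mul_int..].
apply/eqP; rewrite opprD -subr_eq opprK; apply/eqP; rewrite H; congr (- _).
by apply: eq_Rintegral => x _ /=; ring.
Qed.

Lemma grad_weak u : H1 Omega u -> wg u (grad Omega u).
Proof. by move=> [_ [g ug]]; exact: (@xgetPex _ (fun=> cst 0) [set g | wg u g] (ex_intro _ g
  ug)). Qed.

(** [H1norm] refers to a chosen gradient. By uniqueness any weak gradient computes it, so the
    explicit gradients of sums and products can be used in estimates. *)
Lemma H1norm_sqr u g : sq u -> wg u g ->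
  H1norm Omega u ^+ 2 = n2 u ^+ 2 + \sum_i n2 (g i) ^+ 2.
Proof.
move=> su ug; have uG : wg u (grad Omega u) by apply: grad_weak; split => //; exists g.
rewrite /H1norm sqr_sqrtr; last first.
  apply: addr_ge0; apply: Rintegral_ge0 => x _; first exact: sqr_ge0.
  by apply: sumr_ge0 => i _; exact: sqr_ge0.
rewrite sqr_norm2; congr (_ + _).
have sum_int (s : seq 'I_d) : lambda.-integrable Omega (fun x => (\sum_(i <- s) grad Omega u i x
  ^+ 2)%:E) /\
    \int[lambda]_(x in Omega) (\sum_(i <- s) grad Omega u i x ^+ 2) =
    \sum_(i <- s) \int[lambda]_(x in Omega) (grad Omega u i x ^+ 2).
  elim: s => [|i s [IH1 IH2]].
    rewrite big_nil; split.
      by under eq_fun do rewrite big_nil; exact: integrable0.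
    under eq_Rintegral do rewrite big_nil.
    by rewrite Rintegral_cst// mul0r.
  have si := (uG i).1.2; split.
    by under eq_fun do rewrite big_cons; exact: (integrableD mO si IH1).
  under eq_Rintegral do rewrite big_cons.
  by rewrite RintegralD// IH2 big_cons.
rewrite (sum_int _).2; apply: eq_bigr => i _; rewrite -sqr_norm2; congr (_ ^+ 2).
apply: ae_norm2 => //; [exact: (uG i).1|exact: (ug i).1|].
exact: (weak_gradient_unique su su (ae_eq_refl _ _ _) uG ug i).
Qed.

Lemma H1norm_ge0 u : 0 <= H1norm Omega u. Proof. exact: sqrtr_ge0. Qed.

Lemma norm2_le_H1norm u g : sq u -> wg u g -> n2 u <= H1norm Omega u.
Proof.
move=> su ug; rewrite -ler_sqr ?nnegrE ?H1norm_ge0 ?norm2_ge0// (H1norm_sqr su ug).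
by rewrite lerDl; apply: sumr_ge0 => i _; exact: sqr_ge0.
Qed.

Lemma grad_le_H1norm u g i : sq u -> wg u g -> n2 (g i) <= H1norm Omega u.
Proof.
move=> su ug; rewrite -ler_sqr ?nnegrE ?H1norm_ge0 ?norm2_ge0// (H1norm_sqr su ug).
rewrite (bigD1 i)//= addrCA lerDl addr_ge0 ?sqr_ge0//.
by apply: sumr_ge0 => j _; exact: sqr_ge0.
Qed.

Lemma H1norm_le u g : sq u -> wg u g -> H1norm Omega u <= n2 u + \sum_i n2 (g i).
Proof.
move=> su ug; have s0 (s : seq 'I_d) : 0 <= \sum_(i <- s) n2 (g i).
  by apply: sumr_ge0 => i _; exact: norm2_ge0.
rewrite -ler_sqr ?nnegrE ?H1norm_ge0 ?addr_ge0 ?norm2_ge0//.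
rewrite (H1norm_sqr su ug) sqrrD.
have h (s : seq 'I_d) : \sum_(i <- s) n2 (g i) ^+ 2 <= (\sum_(i <- s) n2 (g i)) ^+ 2.
  elim: s => [|i s IH]; first by rewrite !big_nil expr0n.
  rewrite !big_cons sqrrD (le_trans (lerD (lexx _) IH))// addrAC lerDl.
  by rewrite mulrn_wge0// mulr_ge0 ?norm2_ge0.
rewrite (le_trans (lerD (lexx _) (h _)))// addrAC lerDl mulrn_wge0//.
by rewrite mulr_ge0 ?norm2_ge0.
Qed.

End weak_gradients.

(* Subtracting a multiple of [th] makes the integral of [g] vanish, so that the
   difference has a compactly supported primitive. *)
Lemma bump_primitive (R : realType) (g th : R -> R) (a b : R) : a < b ->
  smooth1 g -> smooth1 th -> (forall t, ~~ (a <= t <= b) -> g t = 0) ->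
  (forall t, ~~ (a <= t <= b) -> th t = 0) -> (forall t, a < t < b -> 0 < th t) ->
  exists c B, [/\ smooth1 B, forall t, ~~ (a <= t <= b) -> B t = 0 &
    forall t : R, is_derive t 1 B (g t - c * th t)].
Proof.
move=> ab sg sth g0 th0 thp.
have [G dG] := exists_primitive (a - 1) (b + 1) (smooth1_continuous sg).
have [Th dTh] := exists_primitive (a - 1) (b + 1) (smooth1_continuous sth).
have MVTJ (F f : R -> R) : (forall x, x \in `]a - 1, b + 1[ -> is_derive x 1 F (f x)) ->
    forall s t, a - 1 < s -> s < t -> t < b + 1 ->
    exists2 x, s < x < t & F t - F s = f x * (t - s).
  move=> dF s t s1 st t1.
  have dF' x : x \in `[s, t] -> is_derive x 1 F (f x).
    by rewrite in_itv/= => /andP[sx xt]; apply: dF; rewrite in_itv/=; apply/andP; split; lra.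
  have cF : {within `[s, t], continuous F}.
    by apply: derivable_within_continuous => x xst; exact: (@ex_derive _ _ _ _ _ _ _ (dF' x xst)).
  have [x xst E] := MVT st (fun x (xst : x \in `]s, t[) => dF' x (subset_itv_oo_cc xst)) cF.
  by exists x => //; move: xst; rewrite in_itv.
have Thab : 0 < Th b - Th a.
  have [|||x xab ->] := MVTJ _ _ dTh a b; rewrite ?ltrDl ?gtrBl//.
  by rewrite mulr_gt0 ?thp// subr_gt0.
pose c := (G b - G a) / (Th b - Th a); pose h t := g t - c * th t.
(* The primitive of [h] that vanishes at [a] and, by the choice of [c], also at [b]. The margin of 1
   around [[a, b]] makes it differentiable at both ends; in the margin it is constant, hence 0. *)
pose B0 t := (G t + - G a) + (- c) * (Th t + - Th a).
have dB0 x : x \in `]a - 1, b + 1[ -> is_derive x 1 B0 (h x).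
  move=> xJ.
  have D := is_deriveD (is_deriveD (dG x xJ) (is_derive_cst (- G a) x 1))
    (is_deriveM (is_derive_cst (- c) x 1) (is_deriveD (dTh x xJ) (is_derive_cst (- Th a) x 1))).
  apply: (is_derive_eq (D : is_derive x 1 B0 _)).
  by rewrite /h scaler0 !addr0 /GRing.scale/= mulNr.
have h0 t : ~~ (a <= t <= b) -> h t = 0 by move=> tn; rewrite /h g0// th0// mulr0 subr0.
have B0a : B0 a = 0 by rewrite /B0 !subrr mulr0 addr0.
have B0b : B0 b = 0 by rewrite /B0 /c mulNr divfK ?subrr// gt_eqF.
have B0l t : a - 1 < t -> t <= a -> B0 t = 0.
  rewrite le_eqVlt => t1 /predU1P[->//|ta].
  have [|||x /andP[tx xa] E] := MVTJ _ _ dB0 t a => //; first lra.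
  by move: E; rewrite B0a h0 ?mul0r; [lra|apply/negP => /andP[]; lra].
have B0r t : b <= t -> t < b + 1 -> B0 t = 0.
  rewrite le_eqVlt => /predU1P[<-//|bt] t1.
  have [|||x /andP[tx xa] E] := MVTJ _ _ dB0 b t => //; first lra.
  by move: E; rewrite B0b h0 ?mul0r; [lra|apply/negP => /andP[]; lra].
pose B t := if t \in `]a - 1, b + 1[ then B0 t else 0.
have Bout t : ~~ (a < t < b) -> B t = 0.
  rewrite /B in_itv/= => tab; case: ifPn => // /andP[t1 t2].
  have [ta|at_] := leP t a; first exact: B0l.
  by apply: B0r => //; move: tab; rewrite at_/= -leNgt.
have dB (t : R) : is_derive t 1 B (h t).
  have [tJ|tJ] := boolP (t \in `]a - 1, b + 1[).
    apply: near_eq_is_derive (dB0 t tJ).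
    have : open (`]a - 1, b + 1[%classic : set R) by exact: interval_open.
    rewrite openE => /(_ t tJ); apply: filterS => s /= sJ.
    by rewrite /B sJ.
  rewrite h0; last by apply: contra tJ => /andP[? ?]; rewrite in_itv/=; apply/andP; split; lra.
  have E : \forall s \near t, cst 0 s = B s.
    move: tJ; rewrite in_itv/= negb_and -!leNgt => /orP[ta|bt].
      near=> s; rewrite Bout//; apply/negP => /andP[as_ _].
      have : s < a by near: s; apply: (cvgr_lt t) => //; lra.
      lra.
    near=> s; rewrite Bout//; apply/negP => /andP[_ sb].
    have : b < s by near: s; apply: (cvgr_gt t) => //; lra.
    lra.
  exact: near_eq_is_derive E (is_derive_cst _ _ _).
exists c, B; split => //.
  apply: (smooth1_primitive dB).
  rewrite (_ : h = (fun t => g t + (- c) * th t)); last by apply/funext => t; rewrite mulNr.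
  by apply: smooth1D => //; apply: smooth1M => //; exact: smooth1_cst.
by move=> t tab; apply: Bout; apply: contra tab => /andP[/ltW -> /ltW ->].
Unshelve. all: by end_near. Qed.

(** * Functions with vanishing weak gradient *)

Section zero_gradient.
Context (R : realType) (d : nat) (Omega : set 'rV[R]_d).
Hypotheses (Oopen : open Omega) (Obounded : bounded_set Omega).
Local Notation E := 'rV[R]_d.
Local Notation lambda := (lebesgue_rV R d).
Local Notation sq := (sqint lambda Omega).

Let mO : measurable Omega := Omega_measurable Oopen.
Let Ofin := Omega_fin Oopen Obounded.

Lemma lebesgue_open_gt0 (U : set E) x : open U -> U x -> (0 < lambda U)%E.
Proof.
move=> oU Ux; have [p [px pU]] := open_ratbox oU Ux.
set a := map_mx ratr p.1 in px pU; set b := map_mx ratr p.2 in px pU.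
pose Q : set E := [set y | forall i, y ord0 i \in `]a ord0 i, x ord0 i]].
have mQ : measurable Q.
  rewrite (_ : Q = \bigcap_(i in [set: 'I_d])
   ((fun y : E => y ord0 i) @^-1` `]a ord0 i, x ord0 i])).
    apply: fin_bigcap_measurable => // i _; rewrite -[X in measurable X]setTI.
    exact: measurable_rV_coord.
  by apply/seteqP; split => y /= h i; [move=> _; exact: h|exact: (h i I)].
have QU : Q `<=` U.
  move=> y hy; apply: pU => i; have := hy i; rewrite in_itv/= => /andP[/ltW -> yx]/=.
  by rewrite (le_trans yx)// ltW//; have /andP[] := px i.
apply: (@lt_le_trans _ _ (lambda Q)).
  rewrite lebesgue_rV_box => [|i]; last by rewrite ltW//; have /andP[] := px i.
  by rewrite lte_fin; apply: prodr_gt0 => i _; rewrite subr_gt0; have /andP[] := px i.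
by apply: le_measure => //; rewrite inE//; exact: open_measurable_rV.
Qed.

Section local.
Variables (a b : E) (abO : cbox a b `<=` Omega) (ab : forall i, a ord0 i < b ord0 i).

Let th (i : 'I_d) := bump (a ord0 i) (b ord0 i) 1.

Let admissible (g : 'I_d -> R -> R) := forall i, smooth1 (g i) /\
  forall t, ~~ (a ord0 i <= t <= b ord0 i) -> g i t = 0.

Let th_admissible i : smooth1 (th i) /\
  forall t, ~~ (a ord0 i <= t <= b ord0 i) -> th i t = 0.
Proof.
split; first exact: smooth1_bump.
by move=> t tab; apply: bump_out; apply: contra tab => /andP[/ltW -> /ltW ->].
Qed.

Let J (f : E -> R) (g : 'I_d -> R -> R) := \int[lambda]_(x in Omega) (f x * \prod_j g j (x ord0 j)).

Let annihilates f := forall phi i, test_function Omega phi ->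
  \int[lambda]_(x in Omega) (f x * partial i phi x) = 0.

(** By [bump_primitive], [g i - c * th i] is the derivative of a bump [B], so the product with that
    factor in place [i] is a partial derivative of a test function, which [f] annihilates. The
    constant depends on [g i] alone, and not on [f]. *)
Let J_replace g i : admissible g -> exists c, forall g', admissible g' -> g' i = g i ->
  forall f, sq f -> annihilates f -> J f g' = c * J f (fun j => if j == i then th i else g' j).
Proof.
move=> ag; have [sg g0] := ag i; have [sth th0] := th_admissible i.
have [c [B [sB B0 dB]]] := bump_primitive (ab i) sg sth g0 th0
  (fun t tab => etrans (bump_gt0 _ _ _ _) tab).
exists c => g' ag' g'i f sf af.
have ag'' k : smooth1 k -> (forall t, ~~ (a ord0 i <= t <= b ord0 i) -> k t = 0) ->
    test_function Omega (fun x : E => \prod_j (if j == i then k else g' j) (x ord0 j)).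
  move=> sk k0; apply: (test_function_prod (g := fun j => if j == i then k else g' j) _ abO).
    by move=> j; case: ifP => // _; case: (ag' j).
  by move=> j t; case: eqP => [->|_]; [exact: k0|case: (ag' j) => _; exact].
have := af _ i (ag'' B sB B0).
have dBi (t : R) : is_derive t 1 ((fun j => if j == i then B else g' j) i) (g i t - c * th i t).
  by rewrite /= eqxx; exact: dB.
rewrite (@partial_prod _ _ (fun j => if j == i then B else g' j) i _ dBi).
pose rest x := \prod_(j < d | j != i) g' j ((x : E) ord0 j).
have split_prod k (x : E) : \prod_j (if j == i then k else g' j) (x ord0 j) = k (x ord0 i) * rest x.
  rewrite (bigD1 i)//= eqxx; congr (_ * _); apply: eq_bigr => j ji.
  by rewrite (negbTE ji).
have sqk k : smooth1 k -> (forall t, ~~ (a ord0 i <= t <= b ord0 i) -> k t = 0) ->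
    sq (fun x : E => \prod_j (if j == i then k else g' j) (x ord0 j)).
  by move=> sk k0; exact: test_function_sqint (ag'' k sk k0).
have Jg' : J f g' = \int[lambda]_(x in Omega) (f x * \prod_j (if j == i then g i else g' j) (x
  ord0 j)).
  apply: eq_Rintegral => x _; congr (_ * _); apply: eq_bigr => j _.
  by case: eqP => // ->; rewrite g'i.
rewrite (@eq_Rintegral _ _ _ lambda Omega (fun x =>
    f x * \prod_j (if j == i then g i else g' j) (x ord0 j) -
    c * (f x * \prod_j (if j == i then th i else g' j) (x ord0 j)))); last first.
  move=> x _; rewrite (eq_bigr (fun j => (if j == i then (fun t => g i t - c * th i t) else g'
    j) (x ord0 j))).
    by rewrite !split_prod; ring.
  by move=> j _; case: eqP.
have i1 := sqint_mul mO sf (sqk _ sg g0); have i2 := sqint_mul mO sf (sqk _ sth th0).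
rewrite RintegralB//; last by have := integrableZl mO c i2.
by rewrite RintegralZl// -Jg' => /subr0_eq.
Qed.

(** The factors are exchanged for those of [th] one coordinate at a time. As [c] does not depend on
    [f], the functionals [J f] of all annihilating [f] are proportional on tensor products. *)
Let J_prod g : admissible g -> exists c, forall f, sq f -> annihilates f -> J f g = c * J f th.
Proof.
move=> ag; pose mix (s : seq 'I_d) j := if j \in s then th j else g j.
have amix s : admissible (mix s).
  by move=> i; rewrite /mix; case: ifP => _; [exact: th_admissible|exact: ag].
suff [c hc] : exists c, forall f, sq f -> annihilates f -> J f g = c * J f (mix (enum 'I_d)).
  exists c => f sf af; rewrite hc//; congr (_ * _); apply: eq_Rintegral => x _.
  by congr (_ * _); apply: eq_bigr => j _; rewrite /mix mem_enum.
elim: (enum 'I_d) => [|i s [c hc]].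
  by exists 1 => f _ _; rewrite mul1r.
have [is_|is_] := boolP (i \in s).
  exists c => f sf af; rewrite hc//; congr (_ * _); apply: eq_Rintegral => x _.
  congr (_ * _); apply: eq_bigr => j _; rewrite /mix inE; case: eqP => [->|//].
  by rewrite is_.
have [c' hc'] := J_replace i ag; exists (c * c') => f sf af.
rewrite hc// (hc' (mix s))//; last by rewrite /mix (negbTE is_).
rewrite -mulrA; congr (_ * (_ * _)); apply: eq_Rintegral => x _.
by congr (_ * _); apply: eq_bigr => j _; rewrite /mix inE; case: eqP => [->|].
Qed.

(** By [J_prod] an annihilating function is determined on the box by the number [J f th].
    Subtracting from [u] the constant with the same number gives 0. *)
Lemma zero_gradient_local u : sq u -> annihilates u ->
  exists c, ae_eq lambda (obox a b) u (cst c).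
Proof.
move=> su au.
have s1 : sq (cst 1) by apply: sq_smooth => //; exact: smooth_cst.
have a1 : annihilates (cst 1).
  move=> phi i tp; rewrite -[RHS](Rintegral_partial0 Obounded i tp).
  by apply: eq_Rintegral => x _; rewrite mul1r.
have QO : obox a b `<=` Omega by exact: subset_trans (@obox_cbox _ _ _ _) abO.
have key f : sq f -> annihilates f -> J f th = 0 -> ae_eq lambda (obox a b) f (cst 0).
  move=> sf af f0; apply: bump_orthogonal_ae0.
  - exact: obox_open.
  - by apply: (integrableS mO _ QO); [exact: obox_measurable|exact: sqint_integrable].
  - move=> a' b' n ab'; pose g j := bump (a' ord0 j) (b' ord0 j) n.+1.
    have Eint : \int[lambda]_(x in obox a b) (f x * boxbump a' b' n x) = J f g.
      rewrite /J [LHS]Rintegral_mkcond [RHS]Rintegral_mkcond; apply: eq_Rintegral => x _.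
      rewrite /patch; have [xQ|xQ] := boolP (x \in obox a b).
        by rewrite (mem_set (QO _ (set_mem xQ))).
      case: ifP => // _; apply/esym/eqP; rewrite mulf_eq0; apply/orP; right; apply/eqP.
      apply: (test_function0 (test_boxbump n ab')) => Qx.
      by move: xQ; rewrite mem_set.
    (* If the closed box is empty, its inclusion does not compare [a'], [b'] with [a], [b]
       coordinatewise; but then the bump vanishes identically. *)
    rewrite Eint; have [[z hz]|nz] := pselect (cbox a' b' !=set0); last first.
      rewrite -Eint (@eq_Rintegral _ _ _ lambda _ (cst 0)) ?Rintegral_cst ?mul0r//;
        first exact: obox_measurable.
      move=> x _; rewrite /= (@test_function0 _ _ set0 (boxbump a' b' n) x) ?mulr0//.
      by apply: test_boxbump => y hy; apply: nz; exists y.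
    have inab j t : a' ord0 j <= t <= b' ord0 j -> a ord0 j < t < b ord0 j.
      move=> tj; pose y : E := \row_k (if k == j then t else z ord0 k).
      have : obox a b y by apply: ab' => k; rewrite mxE; case: eqP => [->//|_]; exact: hz.
      by move=> /(_ j); rewrite mxE eqxx.
    have ag : admissible g.
      move=> j; split; first exact: smooth1_bump.
      move=> t tab; apply: bump_out; apply: contra tab => /andP[/ltW t1 /ltW t2].
      by have /andP[/ltW -> /ltW ->] := inab j t (introT andP (conj t1 t2)).
    by have [c hc] := J_prod ag; rewrite hc// f0 mulr0.
(* This saves computing the integral of [th]: if it were 0, [key] would make 1 vanish almost
   everywhere on the box, and any constant would do. *)
have [J1|J1] := eqVneq (J (cst 1) th) 0.
  exists 0; have := key _ s1 a1 J1.
  by apply: filterS => x /= H Qx; have := H Qx => /eqP; rewrite oner_eq0.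
pose c := J u th / J (cst 1) th; exists c.
have lin phi : sq phi -> \int[lambda]_(x in Omega) ((u x - c) * phi x) =
    \int[lambda]_(x in Omega) (u x * phi x) - c * \int[lambda]_(x in Omega) (cst 1 x * phi x).
  move=> sp; have i1 := sqint_mul mO su sp; have i2 := sqint_mul mO s1 sp.
  rewrite -RintegralZl// -RintegralB//; last by have := integrableZl mO c i2.
  by apply: eq_Rintegral => x _ /=; ring.
have sc : sq (fun x => u x - c).
  have := sqintD mO su (sqintZ (- c) mO s1).
  by rewrite (_ : _ \+ _ = (fun x => u x - c))//; apply/funext => x /=; rewrite mulr1.
have : ae_eq lambda (obox a b) (fun x => u x - c) (cst 0).
  apply: key => //.
    move=> phi i tp; rewrite lin ?au ?a1 ?mulr0 ?subr0//.
    by apply: test_function_sqint => //; exact: test_function_partial.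
  rewrite /J lin; first by rewrite -/(J u th) -/(J (cst 1) th) /c divfK ?subrr.
  apply: (test_function_sqint Oopen Obounded); apply: (test_function_prod _ abO).
    by move=> j; case: (th_admissible j).
  by move=> j; case: (th_admissible j).
by apply: filterS => x /= H Qx; have := H Qx => /subr0_eq.
Qed.

End local.

(** The sets [S c] of points near which [u] is a.e. equal to [c] are open and cover [Omega]. They
    are disjoint because nonempty open sets have positive measure, so connectedness leaves only one
    of them in [Omega]. *)
Lemma zero_gradient_cst u g : Omega !=set0 -> connected Omega ->
  sq u -> weak_gradient Omega u g -> (forall i, ae_eq lambda Omega (g i) (cst 0)) ->
  exists c, ae_eq lambda Omega u (cst c).
Proof.
move=> [x0 Ox0] Oconn su ug g0.
have au phi i : test_function Omega phi -> \int[lambda]_(x in Omega) (u x * partial i phi x) = 0.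
  move=> tp; rewrite (ug i).2//; rewrite (@ae_eq_Rintegral _ _ _ lambda Omega mO _ (cst 0))
    ?Rintegral_cst ?mul0r ?oppr0//.
    by apply: measurable_funM; [case: (ug i).1|case: (test_function_sqint Oopen Obounded tp)].
  by apply: filterS (g0 i) => x /= E Ox; rewrite E// mul0r.
pose S c := [set x | exists U, [/\ open U, U x & ae_eq lambda U u (cst c)]].
have S_open c : open (S c).
  rewrite openE => x [U [oU Ux Uc]].
  have : nbhs x U by exact: open_nbhs_nbhs.
  by apply: filterS => y Uy; exists U.
have S_all x : Omega x -> exists c, S c x.
  move=> Ox; have [p [px pO]] := open_ratbox Oopen Ox.
  have [c hc] := @zero_gradient_local _ _ pO (fun i => ltac:(have /andP[h1 h2] := px i;
    exact: lt_trans h1 h2)) u su au.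
  by exists c, (@ratbox R d p); split => //; exact: obox_open.
have S_inj c c' x : S c x -> S c' x -> c = c'.
  move=> [U [oU Ux Uc]] [U' [oU' Ux' Uc']]; apply: contrapT => cc'.
  have oUU : open (U `&` U') by exact: openI.
  have : lambda.-negligible (U `&` U').
    apply: negligibleS (negligibleU Uc Uc') => y [Uy Uy'] /=.
    apply: contrapT => /not_orP[/contrapT /(_ Uy) h1 /contrapT /(_ Uy') h2].
    by apply: cc'; rewrite -[LHS]h1 -[RHS]h2.
  move=> /(measure_negligible (open_measurable_rV oUU)) l0.
  by have := @lebesgue_open_gt0 _ x oUU (conj Ux Ux'); rewrite l0 ltxx.
have [c hc] := S_all _ Ox0; exists c.
have E : Omega `&` S c = Omega.
  apply: Oconn; first by exists x0.
    by exists (S c).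
  exists (~` (\bigcup_(c' in [set c' | c' != c]) S c')).
    by apply: open_closedC; apply: bigcup_open => c' _; exact: S_open.
  apply/seteqP; split => x [Ox Sx]; split => //.
    by move=> [c' /= /eqP c'c Sc']; apply: c'c; exact: S_inj Sc' Sx.
  have [c' Sc'] := S_all _ Ox; have [<-//|c'c] := eqVneq c' c.
  by exfalso; apply: Sx; exists c'.
apply: (@negligibleS _ _ _ _ (Omega `&` [set x | u x != c])).
  by move=> x /= /not_implyP[Ox /eqP].
apply: locally_negligible => x [Ox _].
have [_ [U [oU Ux Uc]]] : (Omega `&` S c) x by rewrite E.
exists U => //; apply: negligibleS Uc => y /= [[_ /eqP uy] Uy].
by move=> /(_ Uy).
Qed.

End zero_gradient.

(** * The Hausdorff measure of the boundary *)

Section boundary_measure.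
Context (R : realType) (m : nat).
Hypothesis m_gt0 : (0 < m)%N.
Local Notation lambda := (lebesgue_rV R m).

Definition bbox (a b : 'rV[R]_m) : set 'rV[R]_m := [set x | forall i, x ord0 i \in `]a ord0 i,
  b ord0 i]].

Lemma measurable_bbox a b : measurable (bbox a b).
Proof.
rewrite (_ : bbox a b = \bigcap_(i in [set: 'I_m])
   ((fun y : 'rV[R]_m => y ord0 i) @^-1` `]a ord0 i, b ord0 i])).
  apply: fin_bigcap_measurable => // i _; rewrite -[X in measurable X]setTI.
  exact: measurable_rV_coord.
by apply/seteqP; split => y /= h i; [move=> _; exact: h|exact: (h i I)].
Qed.

Lemma sum_sqr_measurable : measurable [set x : 'rV[R]_m | enorm x <= 1].
Proof.
have mf : measurable_fun setT (fun x : 'rV[R]_m => \sum_i x ord0 i ^+ 2).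
  by apply: measurable_sum => i; apply: measurable_funX; exact: measurable_rV_coord.
have := mf measurableT [set` `]-oo, 1]] (measurable_itv _); rewrite setTI.
congr (measurable _); apply/seteqP; split => x /=; rewrite in_itv/= /enorm.
  by move=> h; rewrite -[leRHS]sqrtr1 ler_wsqrtr.
by rewrite -[X in _ <= X -> _]sqrtr1 ler_psqrt ?nnegrE//; apply: sumr_ge0 => i _; exact: sqr_ge0.
Qed.

(** A zero normalization would make every [hausdorff_gauge] vanish. Finiteness of the volume is part
    of the proof, since [fine] sends infinity to 0. *)
Lemma unit_ball_volume_gt0 : 0 < unit_ball_volume R m.
Proof.
rewrite /unit_ball_volume; apply: fine_gt0; apply/andP; split; last first.
  have : (0 : R) <= 2 by [].
  move=> /(hbox_fin m); apply: le_lt_trans; apply: le_measure; rewrite ?inE.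
  - exact: sum_sqr_measurable.
  - exact: measurable_hbox.
  - move=> x /= x1 i; have : `|x ord0 i| <= 1.
      apply: le_trans x1; apply: le_trans (ler_normr_enorm x).
      rewrite [leRHS]/Num.norm/= mx_normrE.
      by apply: (le_trans _ (le_bigmax _ _ (ord0, i))).
    by rewrite ler_norml in_itv/= => /andP[h1 h2]; apply/andP; split; lra.
(* The cube of side [1 / m] is in the unit ball: its coordinates are at most 1, so each square is at
   most [r], and [m] of them sum to at most 1. *)
pose r : R := m%:R^-1; have r0 : 0 < r by rewrite invr_gt0 ltr0n.
have sub : bbox (\row__ 0) (\row__ r) `<=` [set x | enorm x <= 1].
  move=> x hx /=; rewrite /enorm -[leRHS]sqrtr1 ler_wsqrtr//.
  apply: (@le_trans _ _ (\sum_(i < m) r)).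
    apply: ler_sum => i _; have := hx i; rewrite in_itv/= !mxE => /andP[x0 xr].
    rewrite expr2 (le_trans _ xr)// ler_piMl// ?(ltW x0)// (le_trans xr)//.
    by rewrite invf_le1 ?ltr0n// ler1n.
  by rewrite sumr_const card_ord /r -[_ *+ m]mulr_natl mulfV// pnatr_eq0 -lt0n.
apply: (@lt_le_trans _ _ (lambda (bbox (\row__ 0) (\row__ r)))).
  rewrite lebesgue_rV_box => [|i]; last by rewrite !mxE ltW.
  by rewrite lte_fin; apply: prodr_gt0 => i _; rewrite !mxE subr0.
by apply: le_measure => //; rewrite inE; [exact: measurable_bbox|exact: sum_sqr_measurable].
Qed.

Let c : R := unit_ball_volume R m / 2 ^+ m.
Let c0 : 0 < c.
Proof. by rewrite divr_gt0 ?unit_ball_volume_gt0// exprn_gt0. Qed.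

(** The projection of a set of diameter [D] fits into a cube of half-side [r = max (2 D) eta], of
    volume at most [(4 D)^m + 2 eta], because [(2 eta)^m <= 2 eta]. Dividing by the normalization
    [c] expresses [D^m] by the gauge. *)
Lemma tail_cover (U : set 'rV[R]_m.+1) (eta : R) : 0 < eta -> 2 * eta <= 1 ->
  (ediam U <= 1%:E)%E -> exists Bx, [/\ measurable Bx, (@tail_rV R m) @` U `<=` Bx &
   (lambda Bx <= (4 ^+ m / c)%:E * hausdorff_gauge m U + (2 * eta)%:E)%E].
Proof.
move=> eta0 eta1 U1; have [->|/set0P[x Ux]] := eqVneq U set0.
  exists set0; split => //; first by rewrite image_set0.
  by rewrite measure0 /hausdorff_gauge eqxx mule0 add0e lee_fin mulr_ge0// ltW.
have dU y z : U y -> U z -> ((enorm (y - z))%:E <= ediam U)%E.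
  by move=> Uy Uz; apply: ereal_sup_ubound; exists y => //; exists z.
have diam_ge0 : (0%:E <= ediam U)%E.
  by apply: le_trans (dU x x Ux Ux); rewrite lee_fin sqrtr_ge0.
have [D DE] : exists D : R, ediam U = D%:E.
  exists (fine (ediam U)); rewrite fineK// fin_numE; apply/andP; split.
    by rewrite gt_eqF// (lt_le_trans _ diam_ge0)// ltNy0.
  by rewrite lt_eqF// (le_lt_trans U1)// ltry.
have D0 : 0 <= D by move: diam_ge0; rewrite DE lee_fin.
(* The half-open cube needs [D < r]: the factor 2 ensures it for positive [D], and [eta] for
   [D = 0]. *)
pose r := Num.max (2 * D) eta.
have r0 : 0 < r by rewrite lt_max eta0 orbT.
have Dr : D < r.
  rewrite lt_max; have [D_gt0|] := ltP 0 D; first by rewrite ltr_pMl// ltr1n.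
  by move=> D1; rewrite (le_lt_trans D1 eta0) orbT.
pose a : 'rV[R]_m := \row_i (x ord0 (lift ord0 i) - r).
pose b : 'rV[R]_m := \row_i (x ord0 (lift ord0 i) + r).
exists (bbox a b); split; first exact: measurable_bbox.
  move=> _ [y Uy <-] i; rewrite in_itv/= !mxE.
  have : `|y ord0 (lift ord0 i) - x ord0 (lift ord0 i)| <= D.
    have := dU y x Uy Ux; rewrite DE lee_fin; apply: le_trans.
    apply: le_trans (ler_normr_enorm _); rewrite [leRHS]/Num.norm/= mx_normrE.
    by apply: (le_trans _ (le_bigmax _ _ (ord0, lift ord0 i))); rewrite /= !mxE.
  by rewrite ler_norml => /andP[h1 h2]; apply/andP; split; lra.
rewrite lebesgue_rV_box => [|i]; last by rewrite !mxE lerD2l; lra.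
rewrite (eq_bigr (fun=> 2 * r)); last by move=> i _; rewrite !mxE; ring.
rewrite prodr_const card_ord /hausdorff_gauge ifF; last by apply/negbTE/set0P; exists x.
rewrite DE -/c -EFin_expe -!EFinM -EFinD lee_fin mulrA divfK ?gt_eqF//.
rewrite -exprMn /r; have [h|h] := leP (2 * D) eta.
  rewrite (_ : (2 * eta) ^+ m <= _)//.
  apply: (@le_trans _ _ (2 * eta)); last by rewrite lerDr exprn_ge0// mulr_ge0.
  by rewrite -[leRHS]expr1 ler_wiXn2l// mulr_ge0// ltW.
rewrite (_ : 2 * (2 * D) = 4 * D); last by ring.
by rewrite lerDl mulr_ge0// ltW.
Qed.

(** Dropping a coordinate does not increase distances, so null sets project to null sets. Vanishing
    of the content at scale 1 already provides covers of total gauge below any [e]. *)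
Lemma hausdorff_null_tail (A : set 'rV[R]_m.+1) (Q : set 'rV[R]_m) : measurable Q ->
  Q `<=` (@tail_rV R m) @` A -> hausdorff_measure m A = 0%E -> lambda Q = 0%E.
Proof.
move=> mQ QA A0; apply/eqP; rewrite eq_le measure_ge0 andbT.
have cont0 : hausdorff_content m 1 A = 0%E.
  apply/eqP; rewrite eq_le; apply/andP; split.
    by rewrite -A0; apply: ereal_sup_ubound; exists 1 => /=.
  apply: le_ereal_inf_tmp => _ [U _ <-]; apply: nneseries_ge0 => k _ _.
  rewrite /hausdorff_gauge; case: eqVneq => // /set0P[x Ux].
  rewrite mule_ge0 ?expe_ge0//; first by rewrite lee_fin ltW.
  apply: (@le_trans _ _ (enorm (x - x))%:E); first by rewrite lee_fin sqrtr_ge0.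
  by apply: ereal_sup_ubound; exists x => //; exists x.
have K0 : 0 <= 4 ^+ m / c by rewrite divr_ge0// ?exprn_ge0// ltW.
suff key e : 0 < e -> e <= 1 -> (lambda Q <= ((4 ^+ m / c + 1) * e)%:E)%E.
  have Qfin : lambda Q \is a fin_num.
    by rewrite ge0_fin_numE// (le_lt_trans (key 1 _ _))// ltry.
  rewrite -(fineK Qfin) lee_fin; apply: (@le0_of_small _ _ (4 ^+ m / c + 1)) => e e0 e1.
  by rewrite -lee_fin (fineK Qfin) mulrC key.
move=> e0 e1.
have fin : hausdorff_content m 1 A \is a fin_num by rewrite cont0.
have [_ [U [dU AU] <-]] := lb_ereal_inf_adherent e0 fin.
rewrite -/(hausdorff_content m 1 A) cont0 add0e => Ue.
(* The surplus volume of the cube of index [k] is then [e / 2 ^+ k.+1], and these sum to [e]. *)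
pose eta k : R := e / 2 ^+ k.+2.
have eta0 k : 0 < eta k by rewrite divr_gt0// exprn_gt0.
have two_eta k : 2 * eta k = e / 2 ^+ k.+1.
  by rewrite /eta [2 ^+ k.+2]exprS; field; rewrite expf_neq0.
have eta1 k : 2 * eta k <= 1.
  by rewrite two_eta ler_pdivrMr ?exprn_gt0// mul1r (le_trans e1)// exprn_ege1// ler1n.
have /choice[Bx hB] k := tail_cover (eta0 k) (eta1 k) (dU k).
have QB : Q `<=` \bigcup_k Bx k.
  move=> z /QA[x Ax <-]; have [k _ Ukx] := AU _ Ax; exists k => //.
  by have [_ h _] := hB k; apply: h; exists x.
apply: (@le_trans _ _ (\sum_(k <oo) lambda (Bx k))%E).
  have mB k : measurable (Bx k) by have [] := hB k.
  have mUB := bigcupT_measurable _ mB.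
  apply: (le_trans _ (generalized_Boole_inequality _ mB mUB)).
  by apply: le_measure => //; rewrite inE.
have g0 k : (0 <= hausdorff_gauge m (U k))%E.
  rewrite /hausdorff_gauge; case: eqVneq => // /set0P[x Ux].
  rewrite mule_ge0 ?expe_ge0//; first by rewrite lee_fin ltW.
  apply: (@le_trans _ _ (enorm (x - x))%:E); first by rewrite lee_fin sqrtr_ge0.
  by apply: ereal_sup_ubound; exists x => //; exists x.
apply: (@le_trans _ _ (\sum_(k <oo) ((4 ^+ m / c)%:E * hausdorff_gauge m (U k) + (e / (2 ^
  k.+1)%:R)%:E))%E).
  apply: lee_nneseries => // k _; have [_ _ h] := hB k.
  apply: (le_trans h); by rewrite leeD2l// lee_fin two_eta natrX.
apply: (le_trans (epsilon_trick _ _ _)) => //; [by move=> k; rewrite mule_ge0|exact: ltW|].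
rewrite nneseriesZl// mulrDl mul1r EFinD; apply: leeD2r.
by rewrite [leRHS]EFinM; apply: lee_wpmul2l; [rewrite lee_fin|exact: ltW].
Qed.

(** Every line parallel to the first axis that meets the bounded open set also meets its boundary.
    The projection of the boundary thus contains a box [Q] of positive Lebesgue measure, and
    [hausdorff_null_tail] applies. *)
Lemma boundary_hausdorff_gt0 (Omega : set 'rV[R]_m.+1) : Omega !=set0 ->
  open Omega -> bounded_set Omega -> (0 < hausdorff_measure m (boundary Omega))%E.
Proof.
move=> [x0 Ox0] oO bO; rewrite lt_neqAle measure_ge0 andbT eq_sym; apply/eqP => G0.
have [p [px pO]] := open_ratbox oO Ox0.
set a := map_mx ratr p.1 in px pO; set b := map_mx ratr p.2 in px pO.
have [M M0 OM] := Omega_hbox bO.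
pose Q := bbox (tail_rV a) (tail_rV x0).
have Qlt i : a ord0 (lift ord0 i) < x0 ord0 (lift ord0 i) by have /andP[] := px (lift ord0 i).
have tailE (x : 'rV[R]_m.+1) i : tail_rV x ord0 i = x ord0 (lift ord0 i) by rewrite mxE.
have Q0 : (0 < lambda Q)%E.
  rewrite lebesgue_rV_box => [|i]; last by rewrite !tailE ltW.
  by rewrite lte_fin; apply: prodr_gt0 => i _; rewrite !tailE subr_gt0.
suff QG : Q `<=` (@tail_rV R m) @` boundary Omega.
  by move: Q0; rewrite (hausdorff_null_tail (measurable_bbox _ _) QG G0) ltxx.
move=> z hz; pose t0 := x0 ord0 ord0; pose line t : 'rV[R]_m.+1 := cons_rV (t, z).
have lineE t s : ball (line t) s = [set y | (`|t - y ord0 ord0| < s) /\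
    forall i, `|z ord0 i - y ord0 (lift ord0 i)| < s].
  apply/seteqP; split => y /=.
    move=> [s0 h]; split; first by have := h ord0 ord0; rewrite /ball/= /line cons_rV0.
    by move=> i; have := h ord0 (lift ord0 i); rewrite /ball/= /line cons_rVS.
  move=> [h0 h]; split; first exact: le_lt_trans (normr_ge0 _) h0.
  move=> i j; rewrite ord1 /ball/= /line; have [k ->|->] := unliftP ord0 j.
    by rewrite cons_rVS; exact: h.
  by rewrite cons_rV0.
have Tline t s : ball (line t) s (line (t + s / 2)) \/ s <= 0.
  have [s0|s0] := ltP 0 s; [left|by right].
  rewrite lineE /= /line cons_rV0/= opprD addrA subrr sub0r normrN ger0_norm;
    last by rewrite divr_ge0// ltW.
  split; first by lra.
  by move=> i; rewrite cons_rVS/= subrr normr0.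
pose T : set R := [set t | Omega (line t)].
have Tt0 : T t0.
  apply: pO => i; have [j ->|->] := unliftP ord0 i; rewrite ?cons_rV0 ?cons_rVS/=.
    have := hz j; rewrite in_itv/= !tailE => /andP[/ltW -> zx]/=.
    by rewrite (le_trans zx)// ltW//; have /andP[] := px (lift ord0 j).
  by have /andP[/ltW -> /ltW ->] := px ord0.
have T_sup : has_sup T.
  split; first by exists t0.
  exists M => t /OM /(_ ord0); rewrite cons_rV0 in_itv/=.
  by move=> /andP[].
(* The last exit point: it is a limit of points of [Omega] on the line, and if it were in the open
   set, the line would stay in [Omega] beyond the supremum. *)
exists (line (sup T)); last by rewrite /line cons_rVK.
split.
  move=> B /nbhs_ballP[e /= e0 eB].
  have [t Tt te] := sup_adherent e0 T_sup.
  exists (line t); split => //; apply: eB; rewrite lineE /= /line cons_rV0/=; split.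
    have tT : t <= sup T by apply: ub_le_sup => //; case: T_sup.
    by rewrite ger0_norm ?subr_ge0//; lra.
  by move=> i; rewrite cons_rVS/= subrr normr0.
move=> /interior_subset; rewrite -/(T (sup T)) => Ts.
have : nbhs (line (sup T)) Omega by exact: open_nbhs_nbhs.
move=> /nbhs_ballP[e /= e0 eO]; have [bl|] := Tline (sup T) e; last by rewrite leNgt e0.
have : sup T + e / 2 <= sup T.
  by apply: ub_le_sup; [case: T_sup|exact: eO].
by rewrite gerDl leNgt divr_gt0.
Qed.

End boundary_measure.

(** * Traces and the Dirichlet-to-Neumann graph *)

Section traces.
Context (R : realType) (d : nat) (Omega : set 'rV[R]_d).
Hypotheses (Oopen : open Omega) (Obounded : bounded_set Omega).
Hypothesis Gamma_finite : (surface_measure Omega (boundary Omega) < +oo)%E.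
Local Notation E := 'rV[R]_d.
Local Notation lambda := (lebesgue_rV R d).
Local Notation sq := (sqint lambda Omega).
Local Notation n2 := (norm2 lambda Omega).
Local Notation wg := (weak_gradient Omega).
Local Notation G := (boundary Omega).
Local Notation sig := (surface_measure Omega).
Local Notation L2G := (L2 sig).
Local Notation nG := (nrm (L2_ip sig)).

Let mO : measurable Omega := Omega_measurable Oopen.
Let Ofin := Omega_fin Oopen Obounded.
Let mG : measurable G := measurable_boundary Omega.

Lemma surface_setT : sig setT = sig G.
Proof. by rewrite /surface_measure/= /mrestr setTI setIid. Qed.

Lemma surface_fin : (sig setT < +oo)%E. Proof. by rewrite surface_setT. Qed.

Lemma surface_compl : sig (~` G) = 0%E.
Proof. by rewrite /surface_measure/= /mrestr setICl measure0. Qed.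

Lemma surface_ae (P : E -> Prop) : (forall x, G x -> P x) -> {ae sig, forall x, P x}.
Proof.
move=> GP; exists (~` G); split; [exact: measurableC|exact: surface_compl|].
by move=> x /= nP Gx; apply: nP; exact: GP.
Qed.

Lemma surface_Rintegral (f : E -> R) :
  \int[sig]_(x in G) f x = \int[sig]_x (f x * \1_G x).
Proof. by rewrite -[in LHS](setTI G) Rintegral_indic. Qed.

(** A function continuous on the closure of [Omega] may be arbitrary elsewhere; the cut-off makes it
    measurable on the whole space. *)
Definition boundary_values (v : E -> R) : E -> R := v \* \1_G.

Lemma boundary_values_measurable (v : E -> R) : {within closure Omega, continuous v} ->
  measurable_fun setT (boundary_values v).
Proof.
move=> cv; have mv : measurable_fun G v.
  apply: (measurability _ (RGenOpens.measurableE R)).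
  move=> _ [_ [a [b ->] <-]].
  have oI : open (`]a, b[%classic : set R) by exact: interval_open.
  move/continuousP : (cv) => cv1; have := cv1 _ oI.
  move=> /open_subspaceP[V oV VE].
  rewrite (_ : _ `&` _ = G `&` V).
    by apply: measurableI => //; exact: open_measurable_rV.
  apply/seteqP; split => x [Gx vx]; split => //.
    have : (v @^-1` `]a, b[ `&` closure Omega) x by split => //; case: Gx.
    by rewrite -VE => -[].
  have : (V `&` closure Omega) x by split => //; case: Gx.
  by rewrite VE => -[].
rewrite (_ : boundary_values v = v \_ G).
  by apply/(measurable_restrictT _ mG).
apply/funext => x; rewrite /boundary_values /patch /= indicE.
by case: ifP => _; rewrite ?mulr1 ?mulr0.
Qed.

Lemma boundary_values_sqint (v : E -> R) : {within closure Omega, continuous v} ->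
  sqint sig setT (boundary_values v).
Proof.
move=> cv; have [C C0 hC] := continuous_bounded_on (closure_Omega_compact Obounded) cv.
apply: (@sqint_ae_bounded _ _ _ _ _ _ C) => //; first exact: surface_fin.
  exact: boundary_values_measurable.
move=> x _; rewrite /boundary_values /= indicE.
have [/set_mem[xO _]|_] := boolP (x \in G); first by rewrite mulr1 hC.
by rewrite mulr0 normr0.
Qed.

Definition bdL2 (v : E -> R) (cv : {within closure Omega, continuous v}) : L2G :=
  mkL2 (boundary_values_sqint cv).

Lemma L2dist_bd (v : E -> R) (cv : {within closure Omega, continuous v}) (phi : L2G) :
  L2dist sig (v \* \1_G) phi = (nG (bdL2 cv - phi))%:E.
Proof. by rewrite -L2distE. Qed.

Lemma H1_sq u : H1 Omega u -> sq u. Proof. by case. Qed.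

Lemma weak_gradient_ae u u' g : sq u -> sq u' -> ae_eq lambda Omega u u' -> wg u g -> wg u' g.
Proof.
move=> su su' uu' ug i; have [sg Hg] := ug i; split => // phi tp; rewrite -Hg//.
have [sp _] := test_function_sqint Oopen Obounded (test_function_partial i tp).
apply: ae_eq_Rintegral => //; try by apply: measurable_funM => //; [case: su'|case: su].
  by apply: measurable_funM => //; case: su'.
  by apply: measurable_funM => //; case: su.
by apply: filterS uu' => x /= H Ox; rewrite H.
Qed.

Lemma H1_linear a u v : H1 Omega u -> H1 Omega v -> H1 Omega (fun x => a * u x + v x).
Proof.
move=> Hu Hv; split; first by apply: sqintD => //; [exact: sqintZ (H1_sq Hu)|exact: H1_sq].
by eexists; apply: (weak_gradient_linear Oopen Obounded a (H1_sq Hu) (H1_sq Hv)); exact: grad_weak.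
Qed.

Lemma H1_cst (c : R) : H1 Omega (cst c).
Proof.
split; first by apply: (sq_smooth Oopen Obounded); exact: smooth_cst.
by exists (fun=> cst 0); exact: weak_gradient_cst.
Qed.

(** The factor [d.+1] is the number of [norm2] terms, one for the function and one per partial
    derivative, each bounded separately. This crude triangle inequality is enough for limits. *)
Lemma H1norm_linear a u v : H1 Omega u -> H1 Omega v ->
  H1norm Omega (fun x => a * u x + v x) <= (d.+1)%:R * (`|a| * H1norm Omega u + H1norm Omega v).
Proof.
move=> Hu Hv; have su := H1_sq Hu; have sv := H1_sq Hv.
have gu := grad_weak Hu; have gv := grad_weak Hv.
have W := weak_gradient_linear Oopen Obounded a su sv gu gv.
apply: (le_trans (H1norm_le Oopen Obounded _ W)).
  by apply: sqintD => //; exact: sqintZ.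
have lin f k : sq f -> sq k -> n2 f <= H1norm Omega u -> n2 k <= H1norm Omega v ->
    n2 (fun x => a * f x + k x) <= `|a| * H1norm Omega u + H1norm Omega v.
  move=> sf sk fu kv; rewrite (le_trans (norm2D mO (sqintZ a mO sf) sk))//.
  rewrite norm2Z//; apply: lerD; last exact: kv.
  exact: (ler_wpM2l (normr_ge0 a) fu).
rewrite -[d.+1]add1n natrD mulrDl mul1r; apply: lerD.
  apply: lin => //; [exact: (norm2_le_H1norm Oopen Obounded su gu)|exact: (norm2_le_H1norm Oopen
    Obounded sv gv)].
apply: (@le_trans _ _ (\sum_(i < d) (`|a| * H1norm Omega u + H1norm Omega v))).
  apply: ler_sum => i _; apply: lin; [exact: (gu i).1|exact: (gv i).1| |].
    exact: (grad_le_H1norm Oopen Obounded i su gu).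
  exact: (grad_le_H1norm Oopen Obounded i sv gv).
by rewrite sumr_const card_ord mulr_natl.
Qed.

Lemma H1_sub u v : H1 Omega u -> H1 Omega v -> H1 Omega (u \- v).
Proof.
move=> Hu Hv; rewrite (_ : u \- v = fun x => -1 * v x + u x); first exact: H1_linear.
by apply/funext => x /=; ring.
Qed.

Lemma is_traceP u (phi : L2G) : is_trace u phi <->
  forall e : R, 0 < e -> exists (v : E -> R) (cv : {within closure Omega, continuous v}),
    [/\ H1 Omega v, H1norm Omega (v \- u) <= e & nG (bdL2 cv - phi) <= e].
Proof.
split.
  move=> [w [Hw Hn Hd]] e e0.
  have h1 : \forall n \near \oo, H1norm Omega (w n \- u) <= e.
    move/cvgrPdist_le : Hn => /(_ e e0); apply: filterS => n.
    by rewrite sub0r normrN; exact: le_trans (ler_norm _).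
  have h2 : \forall n \near \oo, nG (bdL2 (Hw n).1 - phi) <= e.
    move: Hd; under eq_cvg do rewrite (L2dist_bd (Hw _).1).
    by move=> /ecvg0P; apply => // n; exact: nrm_ge0.
  have [n _ /(_ n (leqnn n)) [k1 k2]] := filterI h1 h2.
  by exists (w n), (Hw n).1; split => //; exact: (Hw n).2.
move=> h; have /choice[w hw] (n : nat) : exists v, exists cv : {within closure Omega, continuous v},
    [/\ H1 Omega v, H1norm Omega (v \- u) <= n.+1%:R^-1 & nG (bdL2 cv - phi) <= n.+1%:R^-1].
  by apply: h; rewrite invr_gt0.
have cvg0 (f : nat -> R) : (forall n, 0 <= f n) -> (forall n, f n <= n.+1%:R^-1) ->
    forall e : R, 0 < e -> \forall n \near \oo, f n <= e.
  move=> f0 fn e e0; have := @near_infty_natSinv_lt R (PosNum e0).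
  by apply: filterS => n /ltW; exact: le_trans.
exists w; split.
- by move=> n; have [cv [Hv _ _]] := hw n; split.
- apply/cvgrPdist_le => e e0.
  have := cvg0 (fun n => H1norm Omega (w n \- u)) (fun=> H1norm_ge0 _ _) _ e e0.
  have hn n : H1norm Omega (w n \- u) <= n.+1%:R^-1 by have [? []] := hw n.
  by move=> /(_ hn); apply: filterS => n; rewrite sub0r normrN ger0_norm// H1norm_ge0.
- have cw n : {within closure Omega, continuous (w n)} by have [cv _] := hw n.
  have hcw n : nG (bdL2 (cw n) - phi) <= n.+1%:R^-1.
    by have [cv [_ _]] := hw n; rewrite (Prop_irrelevance cv (cw n)).
  under eq_cvg do rewrite (L2dist_bd (cw _)).
  apply/ecvg0P; first by move=> n; exact: nrm_ge0.
  by apply: cvg0 => // n; exact: nrm_ge0.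
Qed.

Definition energy u v := \sum_(i < d) \int[lambda]_(x in Omega) (grad Omega u i x * grad Omega v
  i x).

Lemma energyC u v : energy u v = energy v u.
Proof. by apply: eq_bigr => i _; apply: eq_Rintegral => x _; rewrite mulrC. Qed.

Lemma Rintegral_grad_sum u v : H1 Omega u -> H1 Omega v ->
  \int[lambda]_(x in Omega) (\sum_i grad Omega u i x * grad Omega v i x) = energy u v.
Proof.
move=> /grad_weak gu /grad_weak gv.
have int i := sqint_mul mO (gu i).1 (gv i).1.
suff h (s : seq 'I_d) :
    lambda.-integrable Omega (fun x => (\sum_(i <- s) grad Omega u i x * grad Omega v i x)%:E) /\
    \int[lambda]_(x in Omega) (\sum_(i <- s) grad Omega u i x * grad Omega v i x) =
    \sum_(i <- s) \int[lambda]_(x in Omega) (grad Omega u i x * grad Omega v i x).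
  exact: (h _).2.
elim: s => [|i s [IH1 IH2]].
  rewrite big_nil; split; first by under eq_fun do rewrite big_nil; exact: integrable0.
  under eq_Rintegral do rewrite big_nil.
  by rewrite Rintegral_cst// mul0r.
split; first by under eq_fun do rewrite big_cons; exact: (integrableD mO (int i) IH1).
under eq_Rintegral do rewrite big_cons.
by rewrite RintegralD// IH2 big_cons.
Qed.

(* The witness of the Laplacian in [is_normal_derivative] vanishes a.e. when
   [u] is harmonic. *)
Lemma normal_derivative_energy u (psi : L2G) : H1 Omega u -> is_laplacian Omega u (cst 0) ->
  is_normal_derivative u psi ->
  forall (v : E -> R) (cv : {within closure Omega, continuous v}), H1 Omega v ->
  energy u v = L2_dot psi (bdL2 cv).
Proof.
move=> Hu lu [f [sf lf Hf]] v cv Hv; have := Hf v (conj cv Hv).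
have f0 : ae_eq lambda Omega f (cst 0).
  apply: (test_orthogonal_ae0 Oopen); first exact: sqint_integrable.
  move=> phi tp; rewrite -lf// lu// (@eq_Rintegral _ _ _ lambda Omega (cst 0)) ?Rintegral_cst
    ?mul0r// => x _.
  by rewrite mul0r.
rewrite (@ae_eq_Rintegral _ _ _ lambda Omega mO _ (cst 0)) //; last 2 first.
- by apply: measurable_funM; [case: sf|case: (H1_sq Hv)].
- by apply: filterS f0 => x /= H Ox; rewrite H// mul0r.
rewrite Rintegral_cst// mul0r add0r Rintegral_grad_sum// => ->.
rewrite surface_Rintegral; apply: eq_Rintegral => x _.
by rewrite /= /boundary_values /= mulrA.
Qed.

(** Green's formula holds for the continuous approximants [v] of [u']. Both sides pass to the limit
    by Cauchy-Schwarz: the energy since gradients converge, the boundary term since [bdL2 cv]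
    converges to [phi']. *)
Lemma energy_trace u (psi : L2G) u' (phi' : L2G) :
  H1 Omega u -> is_laplacian Omega u (cst 0) -> is_normal_derivative u psi ->
  H1 Omega u' -> is_trace u' phi' -> energy u u' = L2_dot psi phi'.
Proof.
move=> Hu lu nu Hu' /is_traceP tu'.
apply/eqP; rewrite -subr_eq0 -normr_le0.
apply: (@le0_of_small _ _ (\sum_i n2 (grad Omega u i) + nG psi)) => e e0 _.
have [v [cv [Hv vu' bv]]] := tu' e e0.
have gu := grad_weak Hu; have gu' := grad_weak Hu'; have gv := grad_weak Hv.
rewrite (_ : _ - _ = (energy u u' - energy u v) + L2_dot psi (bdL2 cv - phi')); last first.
  rewrite (normal_derivative_energy Hu lu nu cv Hv).
  have -> : L2_dot psi (bdL2 cv - phi') = L2_dot psi (bdL2 cv) - L2_dot psi phi'.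
    exact: (ipBr (L2_ip sig)).
  by ring.
rewrite (le_trans (ler_normD _ _))// mulrDr lerD//; last first.
  rewrite (le_trans (cauchy_schwarz (L2_ip sig) _ _))// mulrC ler_wpM2r//.
  exact: nrm_ge0.
rewrite distrC /energy -sumrB mulr_sumr (le_trans (ler_norm_sum _ _ _))// ler_sum// => i _.
have sD : sq (fun x => -1 * grad Omega u' i x + grad Omega v i x).
  by apply: sqintD => //; [apply: sqintZ => //; exact: (gu' i).1|exact: (gv i).1].
rewrite -RintegralB//; last 2 first.
- exact: (sqint_mul mO (gu i).1 (gv i).1).
- exact: (sqint_mul mO (gu i).1 (gu' i).1).
rewrite (@eq_Rintegral _ _ _ lambda Omega (fun x => grad Omega u i x * (-1 * grad Omega u' i x +
  grad Omega v i x))); last first.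
  by move=> x _; ring.
apply: (le_trans (norm2_cauchy mO (gu i).1 sD)); rewrite mulrC.
apply: ler_wpM2r; first exact: norm2_ge0.
apply: le_trans vu'.
have W := weak_gradient_linear Oopen Obounded (-1) (H1_sq Hu') (H1_sq Hv) gu' gv.
rewrite (_ : v \- u' = fun x => -1 * u' x + v x); last by apply/funext => x /=; ring.
apply: (grad_le_H1norm Oopen Obounded i _ W).
by apply: sqintD => //; [exact: sqintZ (H1_sq Hu')|exact: H1_sq].
Qed.

Lemma dtn_symmetric (phi psi phi' psi' : L2G) : dtn phi psi -> dtn phi' psi' ->
  L2_dot psi phi' = L2_dot psi' phi.
Proof.
move=> [u [Hu lu tu nu]] [u' [Hu' lu' tu' nu']].
by rewrite -(energy_trace Hu lu nu Hu' tu') -(energy_trace Hu' lu' nu' Hu tu) energyC.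
Qed.

Lemma energy_ge0 u : 0 <= energy u u.
Proof.
by apply: sumr_ge0 => i _; apply: Rintegral_ge0 => x _; rewrite -expr2 sqr_ge0.
Qed.

Lemma dtn_positive (phi psi : L2G) : dtn phi psi -> 0 <= L2_dot psi phi.
Proof. by move=> [u [Hu lu tu nu]]; rewrite -(energy_trace Hu lu nu Hu tu) energy_ge0. Qed.

Lemma energy_eq0 u : H1 Omega u -> energy u u = 0 ->
  forall i, ae_eq lambda Omega (grad Omega u i) (cst 0).
Proof.
move=> Hu /eqP; rewrite psumr_eq0 => [/allP h i|i _]; last first.
  by apply: Rintegral_ge0 => x _; rewrite -expr2 sqr_ge0.
have /eqP gi0 := h i (mem_index_enum i).
apply: (norm2_eq0 mO); first exact: (grad_weak Hu i).1.
by rewrite /norm2 (_ : \int[_]_(_ in _) _ = 0) ?sqrtr0// -[RHS]gi0.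
Qed.

(** The supply of kernel elements: it applies to constants, and also to the zero function, all of
    whose traces are thereby in the kernel. *)
Lemma dtn_of_gradient0 u (phi : L2G) : H1 Omega u ->
  wg u (fun=> cst 0) -> is_trace u phi -> dtn phi 0.
Proof.
move=> Hu u0 tu; have su := H1_sq Hu.
have Z f : \int[lambda]_(x in Omega) (cst 0 x * f x) = 0.
  rewrite (@eq_Rintegral _ _ _ lambda Omega (cst 0)) ?Rintegral_cst ?mul0r// => x _.
  by rewrite mul0r.
have lu : is_laplacian Omega u (cst 0).
  move=> f tf; rewrite Z.
  have tff i := test_function_partial i (test_function_partial i tf).
  have int i := sqint_mul mO su (test_function_sqint Oopen Obounded (tff i)).
  suff h (s : seq 'I_d) : lambda.-integrable Omega
      (fun x => (u x * \sum_(i <- s) partial i (partial i f) x)%:E) /\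
      \int[lambda]_(x in Omega) (u x * \sum_(i <- s) partial i (partial i f) x) = 0.
    exact: (h _).2.
  elim: s => [|i s [IH1 IH2]].
    split; first by under eq_fun do rewrite big_nil mulr0; exact: integrable0.
    under eq_Rintegral do rewrite big_nil mulr0.
    by rewrite Rintegral_cst// mul0r.
  split; first by under eq_fun do rewrite big_cons mulrDr; exact: (integrableD mO (int i) IH1).
  under eq_Rintegral do rewrite big_cons mulrDr.
  rewrite RintegralD// IH2 addr0 (u0 i).2; last exact: test_function_partial.
  by rewrite Z oppr0.
exists u; split => //; exists (cst 0); split => //.
  by apply: (sq_smooth Oopen Obounded); exact: smooth_cst.
move=> v [cv Hv]; rewrite Z add0r Rintegral_grad_sum// /energy big1; last first.
  move=> i _; have su0 := weak_gradient_unique Oopen Obounded su su (ae_eq_refl _ _ _)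
    (grad_weak Hu) u0 i.
  rewrite (@ae_eq_Rintegral _ _ _ lambda Omega mO _ (cst 0)) ?Rintegral_cst ?mul0r//.
    by apply: measurable_funM; [case: (grad_weak Hu i).1|case: (grad_weak Hv i).1].
  by apply: filterS su0 => x /= H Ox; rewrite H// mul0r.
apply/esym; rewrite (@eq_Rintegral _ _ _ sig G (cst 0)) ?Rintegral_cst ?mul0r// => x _.
by rewrite mul0r.
Qed.

Lemma is_trace_linear a u u' (phi phi' : L2G) : H1 Omega u -> H1 Omega u' ->
  is_trace u phi -> is_trace u' phi' ->
  is_trace (fun x => a * u x + u' x) (a *: phi + phi').
Proof.
move=> Hu Hu' /is_traceP t /is_traceP t'; apply/is_traceP => e e0.
pose K : R := d.+1%:R * (`|a| + 1); have K0 : 0 < K by rewrite mulr_gt0// ltr_wpDl.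
have K1 : `|a| + 1 <= K by rewrite ler_peMl ?addr_ge0// ler1n.
have eK : 0 < e / K by rewrite divr_gt0.
have [v [cv [Hv vu bv]]] := t _ eK; have [v' [cv' [Hv' vu' bv']]] := t' _ eK.
have cw : {within closure Omega, continuous (fun x => a * v x + v' x)}.
  by move=> x; apply: cvgD; [apply: cvgM; [exact: cvg_cst|exact: cv]|exact: cv'].
exists (fun x => a * v x + v' x), cw; split; first exact: H1_linear.
  rewrite (_ : _ \- _ = fun x => a * (v \- u) x + (v' \- u') x); last first.
    by apply/funext => x /=; ring.
  apply: (le_trans (H1norm_linear _ (H1_sub Hv Hu) (H1_sub Hv' Hu'))).
  rewrite -(divfK (lt0r_neq0 K0) e) [leRHS]mulrC /K -mulrA ler_wpM2l// mulrDl mul1r.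
  by apply: lerD; [exact: (ler_wpM2l (normr_ge0 a) vu)|exact: vu'].
have -> : nG (bdL2 cw - (a *: phi + phi')) = nG (a *: (bdL2 cv - phi) + (bdL2 cv' - phi')).
  congr nrm; apply/LfuneqP => x.
  rewrite [LHS](_ : _ = (a * v x + v' x) * \1_G x - (a * phi x + phi' x))//.
  rewrite [RHS](_ : _ = a * (v x * \1_G x - phi x) + (v' x * \1_G x - phi' x))//.
  by ring.
rewrite (le_trans (nrmD _ _ _))// nrmZ.
apply: (@le_trans _ _ ((`|a| + 1) * (e / K))).
  rewrite mulrDl mul1r.
  by apply: lerD; [exact: (ler_wpM2l (normr_ge0 a) bv)|exact: bv'].
by rewrite mulrCA ger_pMr// ler_pdivrMr// mul1r.
Qed.

Let le_of_sqr (p q : R) : p ^+ 2 = q ^+ 2 -> 0 <= p -> 0 <= q -> p <= q.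
Proof. by move=> pq p0 q0; rewrite -ler_sqr ?nnegrE// pq. Qed.

Lemma is_trace_ae u u' (phi : L2G) : H1 Omega u -> sq u' -> ae_eq lambda Omega u u' ->
  is_trace u phi -> is_trace u' phi.
Proof.
move=> Hu su' uu' /is_traceP t; apply/is_traceP => e /t[v [cv [Hv vu bv]]].
exists v, cv; split; [exact: Hv| |exact: bv]; apply: le_trans vu.
have su := H1_sq Hu; have gu := grad_weak Hu; have gv := grad_weak Hv.
have gu' := weak_gradient_ae su su' uu' gu.
have E1 w : v \- w = fun x => -1 * w x + v x by apply/funext => x /=; ring.
rewrite !E1.
have s1 : sq (fun x => -1 * u x + v x) by apply: sqintD => //; [exact: sqintZ|exact: H1_sq].
have s2 : sq (fun x => -1 * u' x + v x) by apply: sqintD => //; [exact: sqintZ|exact: H1_sq].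
have W1 := weak_gradient_linear Oopen Obounded (-1) su (H1_sq Hv) gu gv.
have W2 := weak_gradient_linear Oopen Obounded (-1) su' (H1_sq Hv) gu' gv.
have N1 := H1norm_sqr Oopen Obounded s1 W1; have N2 := H1norm_sqr Oopen Obounded s2 W2.
have n12 : n2 (fun x => -1 * u' x + v x) = n2 (fun x => -1 * u x + v x).
  by apply: (ae_norm2 mO s2 s1); apply: filterS uu' => x /= H Ox; rewrite H.
move: N2; rewrite n12 => N2; have {}N2 := etrans N2 (esym N1).
exact: (le_of_sqr N2 (H1norm_ge0 _ _) (H1norm_ge0 _ _)).
Qed.

End traces.

(** * Domination, convergence and indicators in [L2] *)

Section L2_order.
Context d (T : measurableType d) (R : realType) (mu : {measure set T -> \bar R}).
Local Notation N := (nrm (L2_ip mu)).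
Implicit Types f g h : L2 mu.

Lemma L2_nrm_le f g : {ae mu, forall x, `|f x| <= `|g x|} -> N f <= N g.
Proof.
move=> fg; rewrite ler_sqrt ?L2_dot_ge0//=.
pose g' : T -> R := fun x => f x * f x + `|g x * g x - f x * f x|.
have mf := (L2_sqint f).1; have mg := (L2_sqint g).1.
have mg' : measurable_fun setT (fun x => g x * g x) by exact: measurable_funM.
have mf' : measurable_fun setT (fun x => f x * f x) by exact: measurable_funM.
have mx : measurable_fun setT (fun x => Num.max (f x * f x) (g x * g x)).
  exact: measurable_maxr.
(* The comparison of integrals is pointwise and the hypothesis holds only a.e.; so the square of [g]
   is replaced by the maximum of the two squares, equal to it a.e. *)
have E : L2_dot g g = \int[mu]_x Num.max (f x * f x) (g x * g x).
  apply: ae_eq_Rintegral => //.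
  apply: filterS fg => x h _; apply/esym/max_idPr; rewrite -!expr2 -[f x ^+ 2]real_normK
    ?num_real//.
  by rewrite -[g x ^+ 2]real_normK ?num_real// ler_sqr ?nnegrE.
rewrite E; apply: le_Rintegral => //.
- exact: L2_mul_integrable.
- apply: (@le_integrable_fin _ _ _ _ _ _ (fun x => f x * f x + g x * g x)) => //.
    move=> x _; rewrite ger0_norm; last by rewrite le_max -expr2 sqr_ge0.
    by rewrite ge_max lerDl lerDr -!expr2 !sqr_ge0.
  exact: integrableD (L2_mul_integrable f f) (L2_mul_integrable g g).
- by move=> x _; rewrite le_max lexx.
Qed.

Lemma L2_dominated_cvg (f_ : nat -> L2 mu) f g :
  (forall x, f_ n x @[n --> \oo] --> f x) -> (forall n x, `|f_ n x| <= `|g x|) ->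
  (forall x, `|f x| <= `|g x|) ->
  forall e : R, 0 < e -> exists n, N (f_ n - f) <= e.
Proof.
move=> fcvg fg f0g e e0.
have mf := (L2_sqint f).1; have mf_ n := (L2_sqint (f_ n)).1.
have [||||_] := @Rdominated_cvg _ T R mu setT (fun n x => (f_ n x - f x) * (f_ n x - f x))
  (cst 0) (fun x => 4 * (g x * g x)) measurableT.
- by move=> n; apply: measurable_funM; exact: measurable_funB.
- move=> x _; have h : f_ n x - f x @[n --> \oo] --> (0 : R).
    by rewrite -(subrr (f x)); apply: cvgB => //; exact: cvg_cst.
  by rewrite /= -(mulr0 0); apply: cvgM.
- by have := integrableZl measurableT 4 (L2_mul_integrable g g).
- move=> n x _; rewrite normrM; have h : `|f_ n x - f x| <= 2 * `|g x|.
    have := ler_normB (f_ n x) (f x); have := fg n x; have := f0g x.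
    move: `|f x| `|f_ n x| `|g x| => a b c; lra.
  have -> : 4 * (g x * g x) = (2 * `|g x|) * (2 * `|g x|).
    have : `|g x| * `|g x| = g x * g x by rewrite -!expr2 real_normK ?num_real.
    by lra.
  by rewrite ler_pM.
rewrite /Rintegral integral0 /= => /cvgrPdist_le /(_ (e ^+ 2)).
have e2 : 0 < e ^+ 2 by rewrite exprn_gt0.
move=> /(_ e2)[n _ /(_ n (leqnn n))]; rewrite sub0r normrN => h; exists n.
rewrite -ler_sqr ?nnegrE ?nrm_ge0 ?(ltW e0)// sqr_nrm.
exact: le_trans (ler_norm _) h.
Qed.

End L2_order.

Section L2_indicator.
Context d (T : measurableType d) (R : realType) (mu : {measure set T -> \bar R}).
Hypothesis mu_fin : (mu setT < +oo)%E.
Implicit Types (f : L2 mu) (A : set T).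

Lemma sqint_indic A : measurable A -> sqint mu setT (\1_A : T -> R).
Proof.
move=> mA; apply: (@sqint_ae_bounded _ _ _ _ _ _ 1) => // x _.
by rewrite indicE ger0_norm// lern1 leq_b1.
Qed.

Definition indL2 A (mA : measurable A) : L2 mu := mkL2 (sqint_indic mA).

Lemma sqint_mask f A : measurable A -> sqint mu setT (fun x => f x * \1_A x).
Proof.
move=> mA; apply: (@sqintM _ _ _ _ _ _ _ 1) => //; first exact: L2_sqint.
by move=> x _; rewrite indicE ger0_norm// lern1 leq_b1.
Qed.

Definition maskL2 f A (mA : measurable A) : L2 mu := mkL2 (sqint_mask f mA).

Lemma dot_indL2 f A (mA : measurable A) : L2_dot f (indL2 mA) = \int[mu]_(x in A) f x.
Proof. by rewrite -[in RHS](setTI A) Rintegral_indic. Qed.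

Lemma dot_maskL2 h f A (mA : measurable A) :
  L2_dot h (maskL2 f mA) = \int[mu]_(x in A) (h x * f x).
Proof.
rewrite -[in RHS](setTI A) Rintegral_indic.
by apply: eq_Rintegral => x _; rewrite /= mulrA.
Qed.

Lemma mask_orthogonal_ae0 h f : (forall A (mA : measurable A), L2_dot h (maskL2 f mA) = 0) ->
  {ae mu, forall x, h x * f x = 0}.
Proof.
move=> h0; have int := L2_mul_integrable h f.
have : ae_eq mu setT (EFin \o (fun x => h x * f x)) (cst 0%E).
  apply: integral_ae_eq => // A _ mA; rewrite integral0.
  have := h0 A mA; rewrite dot_maskL2 /Rintegral => /eqP.
  rewrite fine_eq0; first by move/eqP.
  by apply: integrable_fin_num => //; exact: integrableS int.
by apply: filterS => x /= /(_ I) [].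
Qed.

End L2_indicator.

(* A set which no open set splits into two non-negligible parts concentrates
   near a single point. *)
Lemma zero_one_negligible (R : realType) n (mu : {measure set 'rV[R]_n -> \bar R})
    (A : set 'rV[R]_n) :
  measurable A -> (forall x, mu.-negligible [set x]) ->
  (forall U : set 'rV[R]_n, open U -> mu (A `&` U) = 0%E \/ mu (A `\` U) = 0%E) ->
  mu.-negligible A.
Proof.
move=> mA pt0 A01; apply: locally_negligible => x Ax.
pose B k : set 'rV[R]_n := ball x k.+1%:R^-1.
have oB k : open (B k) by apply: ball_open; rewrite invr_gt0.
have mB k : measurable (B k) by exact: open_measurable_rV.
have [[k Bk]|nB] := pselect (exists k, mu (A `&` B k) = 0%E).
  exists (B k); first by split => //; apply: ballxx; rewrite invr_gt0.
  by apply/negligibleP => //; exact: measurableI.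
(* Now [A] minus any small ball about [x] is null, so [A] is null up to the point [x], and the whole
   space serves as neighbourhood. *)
exists setT; first by split => //; exact: openT.
rewrite setIT; have : mu.-negligible ([set x] `|` \bigcup_k (A `\` B k)).
  apply: negligibleU => //; apply: negligible_bigcup => k.
  have [h|h] := A01 _ (oB k); first by exfalso; apply: nB; exists k.
  by apply/negligibleP => //; exact: measurableD.
apply: negligibleS => y Ay; have [->|yx] := eqVneq y x; [by left|right].
have yx0 : 0 < `|x - y| by rewrite normr_gt0 subr_eq0 eq_sym.
have [k _ /(_ k (leqnn k)) hk] := @near_infty_natSinv_lt R (PosNum yx0).
exists k => //; split => //; rewrite /B -ball_normE /= => /lt_trans/(_ hk).
by rewrite ltxx.
Qed.

Lemma hausdorff_measure_set1 (R : realType) n s (x : 'rV[R]_n) : (0 < s)%N ->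
  hausdorff_measure s [set x] = 0%E.
Proof.
move=> s0; apply/eqP; rewrite eq_le measure_ge0 andbT.
apply: ge_ereal_sup => _ [e e0 <-].
have d0 : ediam [set x] = 0%E :> \bar R.
  rewrite /ediam (_ : [set _ | _ in _ & _ in _] = [set 0%E]) ?ereal_sup1//.
  have e00 : enorm (0 : 'rV[R]_n) = 0.
    by rewrite /enorm big1 ?sqrtr0// => i _; rewrite mxE expr0n.
  apply/seteqP; split => [_ [_ -> [_ -> <-]]|_ ->]; first by rewrite subrr e00.
  by exists x => //; exists x => //; rewrite subrr e00.
have dset0 : ediam (set0 : set 'rV[R]_n) = -oo%E.
  rewrite /ediam (_ : [set _ | _ in _ & _ in _] = set0) ?ereal_sup0//.
  by rewrite -subset0 => _ [? []].
apply: ereal_inf_lbound; exists (fun k => if k is 0 return set 'rV[R]_n then [set x] else set0).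
  split; last by move=> _ ->; exists 0%N.
  by case => [|k]; rewrite ?d0 ?dset0 ?lee_fin ?leNye// ltW.
apply: eseries0 => -[|k] _ _; last by rewrite /hausdorff_gauge eqxx.
rewrite /hausdorff_gauge d0; case: ifPn => // _.
by case: s s0 => // s _; rewrite expeS mul0e mule0.
Qed.

(** * Traces of the zero function *)

Section traces_of_zero.
Context (R : realType) (d : nat) (Omega : set 'rV[R]_d).
Hypotheses (Oopen : open Omega) (Obounded : bounded_set Omega).
Hypothesis Gamma_finite : (surface_measure Omega (boundary Omega) < +oo)%E.
Local Notation E := 'rV[R]_d.
Local Notation lambda := (lebesgue_rV R d).
Local Notation sq := (sqint lambda Omega).
Local Notation n2 := (norm2 lambda Omega).
Local Notation G := (boundary Omega).
Local Notation sig := (surface_measure Omega).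
Local Notation L2G := (L2 sig).
Local Notation nG := (nrm (L2_ip sig)).

Let mO : measurable Omega := Omega_measurable Oopen.
Let is_traceP := is_traceP Obounded Gamma_finite.

Lemma is_trace_closed u (phi : L2G) :
  (forall e : R, 0 < e -> exists2 psi : L2G, is_trace u psi & nG (psi - phi) <= e) ->
  is_trace u phi.
Proof.
move=> h; apply/is_traceP => e e0; have e20 : 0 < e / 2 by rewrite divr_gt0.
have [psi /is_traceP /(_ _ e20)[v [cv [Hv vu bv]]] pp] := h _ e20.
exists v, cv; split; [exact: Hv|apply: le_trans vu _|].
  by rewrite ler_pdivrMr// ler_peMr ?(ltW e0)// ler1n.
rewrite (le_trans (nrm_sub_trans _ psi _ _))// [leRHS]splitr.
by apply: lerD; [exact: bv|exact: pp].
Qed.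

Lemma is_trace_dominated u (psi_ : nat -> L2G) (psi g : L2G) :
  (forall n, is_trace u (psi_ n)) ->
  (forall x, psi_ n x @[n --> \oo] --> psi x) -> (forall n x, `|psi_ n x| <= `|g x|) ->
  (forall x, `|psi x| <= `|g x|) -> is_trace u psi.
Proof.
move=> tn cvgn gn gpsi; apply: is_trace_closed => e e0.
by have [n hn] := L2_dominated_cvg cvgn gn gpsi e0; exists (psi_ n).
Qed.

Lemma H1norm_smooth_mul m : smooth m -> exists2 K : R, 0 < K & forall v, H1 Omega v ->
  H1 Omega (fun x => m x * v x) /\ H1norm Omega (fun x => m x * v x) <= K * H1norm Omega v.
Proof.
move=> sm; have [C C0 hC] := smooth_bounded Obounded sm.
have /choice[D hD] i : exists D : R, 0 <= D /\ forall x, Omega x -> `|partial i m x| <= D.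
  by have [D D0 hD] := smooth_bounded Obounded (smooth_partial i sm); exists D.
have K0 : 0 <= C + \sum_i (C + D i).
  by apply: addr_ge0 => //; apply: sumr_ge0 => i _; rewrite addr_ge0//; have [] := hD i.
(* By the product rule, [m * v] contributes [C] and each partial derivative [C + D i]; the final 1
   makes the constant positive. *)
exists (C + \sum_i (C + D i) + 1) => [|v Hv]; first by rewrite ltr_wpDl.
have sv := H1_sq Hv; have gv := grad_weak Hv.
have W := weak_gradient_mul Oopen Obounded sm sv gv.
have smul k f C' : smooth k -> (forall x, Omega x -> `|k x| <= C') -> sq f ->
    sq (fun x => k x * f x) /\ n2 (fun x => k x * f x) <= C' * n2 f.
  move=> sk kC sf; have mk := @smooth_measurable _ _ Omega _ sk.
  have E : (fun x => k x * f x) = (fun x => f x * k x) by apply/funext => x; rewrite mulrC.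
  by rewrite E; split; [exact: (sqintM mO sf mk kC)|exact: norm2M].
have [smv nmv] := smul _ _ _ sm hC sv.
split; first by split => //; eexists; exact: W.
apply: (le_trans (H1norm_le Oopen Obounded smv W)).
have N0 := H1norm_ge0 Omega v.
have nv := norm2_le_H1norm Oopen Obounded sv gv.
apply: (@le_trans _ _ ((C + \sum_i (C + D i)) * H1norm Omega v)); last first.
  by apply: (ler_wpM2r N0); rewrite lerDl.
rewrite mulrDl mulr_suml; apply: lerD; first exact: (le_trans nmv (ler_wpM2l C0 nv)).
apply: ler_sum => i _; have [D0 hDi] := hD i.
have [s1 n1] := smul _ _ _ sm hC (gv i).1.
have [s2 n2'] := smul _ _ _ (smooth_partial i sm) hDi sv.
apply: (le_trans (norm2D mO s1 s2)); rewrite mulrDl; apply: lerD.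
  exact: (le_trans n1 (ler_wpM2l C0 (grad_le_H1norm Oopen Obounded i sv gv))).
exact: (le_trans n2' (ler_wpM2l D0 nv)).
Qed.

(** If [v] approximates 0 in $H^1$ with boundary values near [phi], then [m * v] still approximates
    0, by [H1norm_smooth_mul], with boundary values near [m * phi]. *)
Lemma is_trace0_mul m (phi psi : L2G) : smooth m -> (forall x, `|m x| <= 1) ->
  (forall x, psi x = m x * phi x) -> is_trace (cst 0) phi -> is_trace (cst 0) psi.
Proof.
move=> sm m1 mphi /is_traceP t; apply/is_traceP => e e0.
have sub0 (v : E -> R) : v \- cst 0 = v by apply/funext => x /=; rewrite subr0.
have [K K0 hK] := H1norm_smooth_mul sm.
have eK : 0 < Num.min e (e / K) by rewrite lt_min e0 divr_gt0.
have l1 : Num.min e (e / K) <= e by rewrite ge_min lexx.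
have l2 : Num.min e (e / K) <= e / K by rewrite ge_min lexx orbT.
have [v [cv [Hv]]] := t _ eK; rewrite (sub0 v) => vK bv.
have {}vK := le_trans vK l2; have {}bv := le_trans bv l1.
have [Hmv nmv] := hK v Hv.
have cmv : {within closure Omega, continuous (fun x => m x * v x)}.
  move=> x; apply: cvgM; last exact: cv.
  exact: (continuous_subspaceT (smooth_continuous sm)).
exists (fun x => m x * v x), cmv; split; [exact: Hmv| |apply: le_trans bv].
  rewrite (sub0 (fun x => m x * v x)); apply: (le_trans nmv).
  by rewrite mulrC -ler_pdivlMr.
apply: L2_nrm_le; apply: nearW => x.
rewrite [X in `|X|](_ : _ = (m x * v x) * \1_G x - psi x)//.
rewrite [X in _ <= `|X|](_ : _ = v x * \1_G x - phi x)//.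
rewrite mphi -mulrA -mulrBr normrM -[leRHS]mul1r.
by apply: ler_wpM2r.
Qed.

(** Bumps give the boxes, linearity gives differences, and domination by [phi] gives increasing
    unions. Quantifying over every [psi] that is pointwise [phi] times the indicator keeps
    measurability proofs out of the induction predicate. *)
Lemma is_trace0_mask A (phi psi : L2G) : measurable A -> is_trace (cst 0) phi ->
  (forall x, psi x = phi x * \1_A x) -> is_trace (cst 0) psi.
Proof.
move=> mA tphi; move: A mA psi; apply: (borel_box_ind (P := fun A => forall psi : L2G,
  (forall x, psi x = phi x * \1_A x) -> is_trace (cst 0) psi)).
- move=> a b psi hpsi.
  have sqb n : sqint sig setT (phi \* boxbump a b n).
    apply: (@sqintM _ _ _ _ _ _ _ 1) => //; first exact: L2_sqint.
      exact: measurable_boxbump.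
    by move=> x _; rewrite ger0_norm ?boxbump_ge0 ?boxbump_le1.
  apply: (@is_trace_dominated _ (fun n => mkL2 (sqb n)) psi phi).
  + move=> n; apply: (is_trace0_mul (smooth_boxbump a b n) _ _ tphi).
      by move=> x; rewrite ger0_norm ?boxbump_ge0 ?boxbump_le1.
    by move=> x; rewrite mkL2E /= mulrC.
  + by move=> x; rewrite hpsi; apply: cvgM; [exact: cvg_cst|exact: boxbump_cvg].
  + move=> n x; rewrite mkL2E /= normrM -[leRHS]mulr1; apply: ler_wpM2l => //.
    by rewrite ger0_norm ?boxbump_ge0 ?boxbump_le1.
  + move=> x; rewrite hpsi normrM -[leRHS]mulr1; apply: ler_wpM2l => //.
    by rewrite indicE ger0_norm// lern1 leq_b1.
- move=> psi hpsi; suff -> : psi = phi by [].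
  by apply/LfuneqP => x; rewrite hpsi indicT mulr1.
- move=> A B mA mB BA PA PB psi hpsi.
  have tA := PA (maskL2 phi mA) (fun=> erefl).
  have tB := PB (maskL2 phi mB) (fun=> erefl).
  have H0 := H1_cst Oopen Obounded 0.
  have := is_trace_linear Oopen Obounded Gamma_finite (-1) H0 H0 tB tA.
  rewrite (_ : (fun x => _) = cst 0); last by apply/funext => x /=; rewrite mulr0 addr0.
  suff -> : -1 *: maskL2 phi mB + maskL2 phi mA = psi by [].
  apply/LfuneqP => x; rewrite hpsi.
  rewrite [LHS](_ : _ = -1 * (phi x * \1_B x) + phi x * \1_A x)//.
  have -> : \1_(A `\` B) x = \1_A x - \1_B x :> R.
    rewrite !indicE in_setD; have [xB|xB] := boolP (x \in B); last first.
      by rewrite andbT subr0.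
    have -> : x \in A by rewrite inE; apply: BA; exact: set_mem.
    by rewrite subrr.
  by ring.
- move=> F mF ndF PF psi hpsi.
  apply: (@is_trace_dominated _ (fun n => maskL2 phi (mF n)) psi phi).
  + by move=> n; exact: (PF n (maskL2 phi (mF n)) (fun=> erefl)).
  + move=> x; rewrite hpsi; apply: cvgM; [exact: cvg_cst|exact: indic_cvg_bigcup].
  + move=> n x; rewrite normrM -[leRHS]mulr1; apply: ler_wpM2l => //.
    by rewrite indicE ger0_norm// lern1 leq_b1.
  + move=> x; rewrite hpsi normrM -[leRHS]mulr1; apply: ler_wpM2l => //.
    by rewrite indicE ger0_norm// lern1 leq_b1.
Qed.

End traces_of_zero.

(** * The semigroup of the Dirichlet-to-Neumann operator *)

Section dtn_semigroup.
Context (R : realType) (d : nat) (Omega : set 'rV[R]_d).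
Hypotheses (Oneq0 : Omega !=set0) (Oopen : open Omega) (Obounded : bounded_set Omega).
Hypothesis Oconn : connected Omega.
Hypothesis Gamma_finite : (surface_measure Omega (boundary Omega) < +oo)%E.
Local Notation E := 'rV[R]_d.
Local Notation lambda := (lebesgue_rV R d).
Local Notation G := (boundary Omega).
Local Notation sig := (surface_measure Omega).
Local Notation L2G := (L2 sig).
Local Notation nG := (nrm (L2_ip sig)).
Variable S : R -> L2G -> L2G.
Hypothesis S_generated : generated_by S (opp_graph (@dtn R d Omega)).

Let mG : measurable G := measurable_boundary Omega.
Let sfin := surface_fin Gamma_finite.
Let S_C0 : C0_semigroup S := S_generated.1.

Let genP f g : infinitesimal_generator S f g <-> dtn f (- g).
Proof. exact: S_generated.2. Qed.

Let dotN (f g : L2G) : L2_dot (- f) g = - L2_dot f g.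
Proof. exact: (ipNl (L2_ip sig)). Qed.

Let gen_sym f f' g g' : infinitesimal_generator S f f' ->
  infinitesimal_generator S g g' -> L2_dot f' g = L2_dot f g'.
Proof.
move=> /genP hf /genP hg.
have := dtn_symmetric Oopen Obounded Gamma_finite hf hg.
rewrite !dotN => /oppr_inj ->; exact: L2_dotC.
Qed.

Let gen_diss f f' : infinitesimal_generator S f f' -> L2_dot f' f <= 0.
Proof.
move=> /genP hf; have := dtn_positive Oopen Obounded Gamma_finite hf.
by rewrite dotN oppr_ge0.
Qed.

Let S_contraction (t : R) f : 0 < t -> nG (S t f) <= nG f.
Proof. exact: (L2_semigroup_contraction sfin S_C0 gen_diss). Qed.

Let S_symmetric (t : R) f g : 0 < t -> L2_dot (S t f) g = L2_dot f (S t g).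
Proof. exact: (L2_semigroup_symmetric sfin S_C0 gen_sym gen_diss). Qed.

Let dtn0_fix f (t : R) : dtn f 0 -> 0 < t -> eqn (L2_ip sig) (S t f) f.
Proof.
move=> f0 t0; apply/L2_eqnP; apply: (L2_gen0_fix sfin S_C0) => //.
by apply/genP; rewrite oppr0.
Qed.

Let cst_cont (c : R) : {within closure Omega, continuous (cst c : E -> R)}.
Proof. by move=> x; exact: cvg_cst. Qed.

Let bcst c : L2G := bdL2 Obounded Gamma_finite (@cst_cont c).

Let H1norm0 : H1norm Omega (cst 0) <= 0.
Proof.
have n0 : norm2 lambda Omega (cst 0) = 0.
  rewrite /norm2 (@eq_Rintegral _ _ _ lambda Omega (cst 0)) => [|x _]; last by rewrite expr0n.
  by rewrite Rintegral_cst ?mul0r ?sqrtr0//; exact: Omega_measurable.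
have H0 := H1_sq (H1_cst Oopen Obounded 0).
apply: (le_trans (H1norm_le Oopen Obounded H0 (weak_gradient_cst Oopen Obounded 0))).
by rewrite n0 big1 ?addr0.
Qed.

Let is_trace_bcst c : is_trace (cst c) (bcst c).
Proof.
apply/(is_traceP Obounded Gamma_finite) => e e0; exists (cst c), (@cst_cont c).
split; [exact: H1_cst| |by rewrite subrr nrm0 ltW].
rewrite (_ : _ \- _ = cst 0); last by apply/funext => x /=; rewrite subrr.
exact: (le_trans H1norm0 (ltW e0)).
Qed.

Let dtn_bcst c : dtn (bcst c) 0.
Proof.
apply: (dtn_of_gradient0 Oopen Obounded (H1_cst Oopen Obounded c) _ (is_trace_bcst c)).
exact: weak_gradient_cst.
Qed.

Let bcst_scale c : bcst c = c *: bcst 1.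
Proof.
apply/LfuneqP => x; rewrite [LHS](_ : _ = c * \1_G x)//.
by rewrite [RHS](_ : _ = c * (1 * \1_G x))// mul1r.
Qed.

Let dot_bcst f c : L2_dot f (bcst c) = c * \int[sig]_(x in G) f x.
Proof.
rewrite bcst_scale [LHS](ipZr (L2_ip sig)); congr (_ * _).
rewrite (surface_Rintegral Omega); apply: eq_Rintegral => x _.
by rewrite [bcst 1 x](_ : _ = 1 * \1_G x)// mul1r.
Qed.

Lemma dtn_ker_cst (phi : L2G) : dtn phi 0 -> exists c, is_trace (cst c) phi.
Proof.
move=> [u [Hu lu tu nu]].
have e0 : energy Omega u u = 0.
  by rewrite (energy_trace Oopen Obounded Gamma_finite Hu lu nu Hu tu) [LHS](ip0l (L2_ip sig)).
have [c uc] := zero_gradient_cst Oopen Obounded Oneq0 Oconn (H1_sq Hu) (grad_weak Hu)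
  (energy_eq0 Oopen Hu e0).
exists c; apply: (is_trace_ae Oopen Obounded Gamma_finite Hu _ uc tu).
exact: (H1_sq (H1_cst Oopen Obounded c)).
Qed.

(** The zero vector is a trace of the zero function, a null [phi] is at distance 0 from it, and
    traces form a closed set. *)
Let nG0_trace (phi : L2G) : nG phi = 0 -> is_trace (cst 0) phi.
Proof.
move=> p0; apply: is_trace_closed => // e e0; exists (bcst 0); first exact: is_trace_bcst.
rewrite (_ : bcst 0 = 0); first by rewrite sub0r nrmN p0 ltW.
by rewrite bcst_scale scale0r.
Qed.

Hypothesis Gamma_gt0 : (0 < sig G)%E.

Let sG := fine (sig G).

Let sG_gt0 : 0 < sG.
Proof. by apply: fine_gt0; rewrite Gamma_gt0. Qed.

Let dot_bcst1 : L2_dot (bcst 1) (bcst 1) = sG.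
Proof.
rewrite dot_bcst mul1r (@eq_Rintegral _ _ _ sig G (cst 1)) ?Rintegral_cst ?mul1r// => x xG.
by rewrite [LHS](_ : _ = 1 * \1_G x)// indicE xG mulr1.
Qed.

Let bcst1_neq0 : ~ eqn (L2_ip sig) (bcst 1) 0.
Proof.
move=> h; have := eqn_ip h h; rewrite [LHS]dot_bcst1 [RHS](ip0l (L2_ip sig)).
by have := sG_gt0; move=> /[swap] ->; rewrite ltxx.
Qed.

Lemma trace_unique_dim_ker : trace_unique Omega -> dim_ker (@dtn R d Omega) 1.
Proof.
move=> tu; exists (fun=> bcst 1); split.
- by move=> _; exact: dtn_bcst.
- move=> c; rewrite big_ord1 => /(L2_eqnP _ (0 : L2G)).2 c0 i; rewrite (ord1 i);
  apply/eqP/negPn/negP => cn0.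
  apply: bcst1_neq0; have := eqnZ (c ord0)^-1 c0.
  rewrite scalerA (mulVf cn0) scale1r scaler0; exact.
- move=> phi /dtn_ker_cst[c tc]; exists (fun=> c); rewrite big_ord1 -bcst_scale.
  have := is_trace_linear Oopen Obounded Gamma_finite (-1) (H1_cst Oopen Obounded c)
    (H1_cst Oopen Obounded c) (is_trace_bcst c) tc.
  rewrite (_ : (fun x => _) = cst 0); last by apply/funext => x /=; ring.
  move=> /tu /(L2_eqnP _ (0 : L2G)).2; rewrite scaleN1r addrC => h; apply/L2_eqnP.
  by have := h; rewrite /eqn subr0.
Qed.

Let meanL2 (phi : L2G) := bcst (sG^-1 * \int[sig]_(x in G) phi x).

Let L2dist_mean (f phi : L2G) : L2dist sig f (mean_projection phi) = (nG (f - meanL2 phi))%:E.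
Proof. by rewrite -L2distE. Qed.

Lemma dim_ker_converges : dim_ker (@dtn R d Omega) 1 -> forall phi : L2G,
  L2dist sig (S t phi) (mean_projection phi) @[t --> +oo] --> 0%E.
Proof.
move=> [e [_ _ ek]] phi.
under eq_cvg do rewrite L2dist_mean.
apply/ecvg0P; first by move=> t; exact: nrm_ge0.
have [q [/genP q0 qcvg]] := L2_semigroup_converges sfin S_C0 gen_sym gen_diss phi.
rewrite oppr0 in q0.
suff qm : eqn (L2_ip sig) q (meanL2 phi).
  move=> r r0; have [M hM] := qcvg r r0; apply/near_pinftyP; exists M => t /hM.
  by move=> h; rewrite -(eqn_nrm (eqnB (eqn_refl _ (S t phi)) qm)).
have [a] := ek _ (dtn_bcst 1); rewrite big_ord1 => /L2_eqnP ha.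
have [b] := ek _ q0; rewrite big_ord1 => /L2_eqnP hb.
(* The spanning vector of the kernel is arbitrary; as the nonzero constant is a multiple of it, the
   constant spans the kernel too. *)
have a0 : a ord0 != 0.
  by apply: contra_notN bcst1_neq0 => /eqP a0; move: ha; rewrite a0 scale0r.
pose k := b ord0 / a ord0.
have qk : eqn (L2_ip sig) q (k *: bcst 1).
  apply: (eqn_trans hb); have := eqn_sym (eqnZ k ha).
  by rewrite scalerA /k divfK.
(* S is symmetric and fixes constants, so the integral over the boundary is conserved in time and
   inherited by the limit. *)
have qphi : L2_dot q (bcst 1) = L2_dot phi (bcst 1).
  apply/eqP; rewrite -subr_eq0 -normr_le0.
  apply: (@le0_of_small _ _ (nG (bcst 1))) => r r0 _; have [M hM] := qcvg r r0.
  pose t := Num.max M 0 + 1.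
  have [Mt t0] : M < t /\ 0 < t by rewrite /t; split; rewrite ltr_pwDr// le_max lexx ?orbT.
  have <- : L2_dot (S t phi) (bcst 1) = L2_dot phi (bcst 1).
    rewrite S_symmetric//; apply: (@eqn_ip _ _ (L2_ip sig)); first exact: eqn_refl.
    exact: dtn0_fix.
  rewrite -[X in `|X|](ipBl (L2_ip sig)) (le_trans (cauchy_schwarz (L2_ip sig) _ _))//.
  by rewrite ler_wpM2r ?nrm_ge0// nrmB hM.
have kE : k = sG^-1 * \int[sig]_(x in G) phi x.
  have qk1 : L2_dot q (bcst 1) = k * sG.
    rewrite (eqn_ip qk (eqn_refl (L2_ip sig) (bcst 1)) : L2_dot _ _ = _).
    by rewrite [LHS](ipZl (L2_ip sig)) -dot_bcst1.
  have := qphi; rewrite qk1 dot_bcst mul1r => <-.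
  by rewrite mulrCA mulVf ?mulr1// lt0r_neq0.
by rewrite /meanL2 bcst_scale -kE.
Qed.

(** Let [phi] and [chi] be the indicators of an invariant [G1] and of its complement in the
    boundary. Then [S t phi] stays orthogonal to [chi], hence so does the limit, and their product
    is the measure of [G1] times that of its complement, divided by the total measure. *)
Lemma converges_irreducible :
  (forall phi : L2G, L2dist sig (S t phi) (mean_projection phi) @[t --> +oo] --> 0%E) ->
  irreducible G S.
Proof.
move=> cvS G1 mG1 G1G inv.
have mG2 : measurable (G `\` G1) by exact: measurableD.
pose phi := indL2 sfin mG1; pose chi := indL2 sfin mG2.
have phi0 : ae_eq sig (G `\` G1) phi (cst 0).
  by apply: nearW => x [_ xG1]; rewrite /= indicE memNset.
have Sphi0 t : 0 < t -> L2_dot (S t phi) chi = 0.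
  move=> t0; rewrite dot_indL2 (@ae_eq_Rintegral _ _ _ sig _ mG2 _ (cst 0)) ?Rintegral_cst ?mul0r//.
    by apply: (@measurable_funS _ _ _ _ setT) => //; exact: (L2_sqint _).1.
  exact: inv.
have mean0 : L2_dot (meanL2 phi) chi = 0.
  apply/eqP; rewrite -normr_le0; apply: (@le0_of_small _ _ (nG chi)) => e e0 _.
  have := cvS phi; under eq_cvg do rewrite L2dist_mean.
  move=> /ecvg0P h; have /near_pinftyP[M hM] := h (fun=> nrm_ge0 _ _) e e0.
  pose t := Num.max M 0 + 1.
  have [Mt t0] : M < t /\ 0 < t by rewrite /t; split; rewrite ltr_pwDr// le_max lexx ?orbT.
  have <- : L2_dot (meanL2 phi) chi - L2_dot (S t phi) chi = L2_dot (meanL2 phi) chi.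
    by rewrite Sphi0// subr0.
  rewrite -[X in `|X|](ipBl (L2_ip sig)) (le_trans (cauchy_schwarz (L2_ip sig) _ _))//.
  by rewrite ler_wpM2r ?nrm_ge0// nrmB hM.
have G1fin : (sig G1 \is a fin_num)%E.
  by rewrite ge0_fin_numE// (le_lt_trans _ Gamma_finite)// le_measure ?inE.
have G2fin : (sig (G `\` G1) \is a fin_num)%E.
  by rewrite ge0_fin_numE// (le_lt_trans _ Gamma_finite)// le_measure ?inE// => x [].
move: mean0; rewrite dot_indL2.
have -> : \int[sig]_(x in G `\` G1) meanL2 phi x = sG^-1 * fine (sig G1) * fine (sig (G `\` G1)).
  rewrite -Rintegral_cst//; apply: eq_Rintegral => x /set_mem[Gx _].
  rewrite [LHS](_ : _ = (sG^-1 * \int[sig]_(x in G) phi x) * \1_G x)// indicE mem_set// mulr1.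
  congr (_ * _); rewrite (@eq_Rintegral _ _ _ sig G (fun x => cst 1 x * \1_G1 x)); last first.
    by move=> y _; rewrite /= mul1r.
  by rewrite -Rintegral_indic (setIidr G1G) Rintegral_cst// mul1r.
move=> /eqP; rewrite !mulf_eq0 invr_eq0 (gt_eqF sG_gt0)/= => /orP[] /eqP h0.
  by left; rewrite -(fineK G1fin) h0.
by right; rewrite -(fineK G2fin) h0.
Qed.

Hypothesis d_ge2 : (2 <= d)%N.

Lemma irreducible_trace_unique : irreducible G S -> trace_unique Omega.
Proof.
move=> irrS phi; split; last first.
  by move=> /(L2_eqnP _ (0 : L2G)).2; rewrite /eqn subr0; exact: nG0_trace.
move=> tphi.
have mask0 A (mA : measurable A) : dtn (maskL2 phi mA) 0.
  apply: (dtn_of_gradient0 Oopen Obounded (H1_cst Oopen Obounded 0)).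
    exact: weak_gradient_cst.
  by apply: (is_trace0_mask Oopen Obounded Gamma_finite (phi := phi) mA tphi).
have mphi : measurable_fun setT phi := (L2_sqint phi).1.
pose G0 := G `&` [set x | phi x != 0].
have mG0 : measurable G0.
  apply: measurableI => //; rewrite (_ : [set x | _] = ~` (phi @^-1` [set 0])).
    by apply: measurableC; rewrite -[X in measurable X]setTI; exact: mphi.
  by apply/seteqP; split => x /= /eqP.
have inv G1 : measurable G1 -> G1 `<=` G0 -> sig G1 = 0%E \/ sig (G `\` G1) = 0%E.
  move=> mG1 G10; apply: irrS => // [x /G10[]//|t t0 f f0].
  (* By symmetry [h] is orthogonal to every vector that [S t] fixes, in particular to all the masks
     of [phi]; this forces [h * phi = 0] a.e. *)
  pose h := S t f - f.
  have hphi : {ae sig, forall x, h x * phi x = 0}.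
    apply: mask_orthogonal_ae0 => A mA.
    rewrite [LHS](ipBl (L2_ip sig)); apply/eqP; rewrite subr_eq0; apply/eqP.
    rewrite [LHS]S_symmetric//; apply: (@eqn_ip _ _ (L2_ip sig)); first exact: eqn_refl.
    exact: dtn0_fix.
  (* On the boundary, [h] vanishes a.e. where [phi] does not, and [f] vanishes a.e. where [phi]
     does, since [G1] is contained in the set where [phi] is nonzero. *)
  have fh : L2_dot h f = 0.
    rewrite /L2_dot (@ae_eq_Rintegral _ _ _ sig _ measurableT _ (cst 0)) ?Rintegral_cst ?mul0r//.
      by apply: measurable_funM; [exact: (L2_sqint h).1|exact: (L2_sqint f).1].
    have GG : {ae sig, forall x, G x} by exact: surface_ae.
    apply: filterS3 hphi f0 GG => x hx fx Gx _.
    have [p0|p0] := eqVneq (phi x) 0.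
      rewrite fx /= ?mulr0//; split => // /G10[_]; by rewrite /= p0 eqxx.
    by move/eqP: hx; rewrite mulf_eq0 (negbTE p0) orbF => /eqP ->; rewrite mul0r.
  (* The squared norm of [h] is that of [S t f] minus twice [L2_dot (S t f) f] plus that of [f]. By
     [fh] the middle product is the squared norm of [f], and contractivity makes the total
     nonpositive. *)
  have hN : eqn (L2_ip sig) (S t f) f.
    rewrite /eqn; apply/eqP; rewrite -sqrf_eq0 eq_le sqr_ge0 andbT.
    have c : L2_dot (S t f) (S t f) <= L2_dot f f.
      have := S_contraction f t0; rewrite -ler_sqr ?nnegrE ?nrm_ge0//.
      by rewrite !sqr_nrm.
    have e1 : L2_dot h f = L2_dot (S t f) f - L2_dot f f := ipBl (L2_ip sig) _ _ _.
    have e2 : L2_dot h (S t f) = L2_dot (S t f) (S t f) - L2_dot f (S t f) := ipBl (L2_ip sig) _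
      _ _.
    have e3 : L2_dot h h = L2_dot h (S t f) - L2_dot h f := ipBr (L2_ip sig) _ _ _.
    rewrite sqr_nrm [X in X <= _](_ : _ = L2_dot h h)// e3 e2.
    have e4 := L2_dotC f (S t f).
    rewrite fh in e1 *; move: c e1 e4.
    move: (L2_dot _ _) (L2_dot _ _) (L2_dot _ _) (L2_dot _ _) => *; lra.
  apply: filterS2 f0 ((L2_eqnP _ _).1 hN) => x fx Sx Gx.
  by rewrite Sx// fx.
have : sig.-negligible G0.
  apply: zero_one_negligible => // [x|U oU].
    apply/negligibleP.
      apply: closed_measurable_rV; apply: accessible_closed_set1; apply: hausdorff_accessible.
      exact: norm_hausdorff.
    apply/eqP; rewrite eq_le measure_ge0 andbT.
    (* This is where [2 <= d] enters: points are null because the Hausdorff dimension [d.-1] is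
       positive. *)
    rewrite -(@hausdorff_measure_set1 R d d.-1 x); last by rewrite -ltnS prednK// (ltn_trans _
      d_ge2).
    by apply: le_outer_measure; exact: subIsetl.
  (* If the complement of this set in the boundary is null, then so is its part inside [G0], which
     is the set difference of [G0] and [U]. *)
  have [||h|h] := inv (G0 `&` U); [| |by left|right].
  - by apply: measurableI => //; exact: open_measurable_rV.
  - by move=> x [].
  - apply/eqP; rewrite eq_le measure_ge0 andbT -h le_measure// ?inE.
    + by apply: measurableD => //; exact: open_measurable_rV.
    + by apply: measurableD => //; apply: measurableI => //; exact: open_measurable_rV.
    + by move=> x [[Gx px] nU]; split => // -[].
have GG : sig.-negligible (~` G) by apply/negligibleP; [exact: measurableC|exact: surface_compl].
move=> /(negligibleU GG); apply: negligibleS => x /= nx.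
have [Gx|nGx] := pselect (G x); [right|by left].
by split => //=; apply: contra_notN nx => /eqP -> _.
Qed.

End dtn_semigroup.

(** * The cycle of implications *)

Unset Implicit Arguments.

Theorem theorem1p1 (R : realType) (d : nat) (d_ge2 : (2 <= d)%N)
    (Omega : set 'rV[R]_d)
    (Omega_neq0 : Omega !=set0) (Omega_bounded : bounded_set Omega)
    (Omega_connected : connected Omega) (Omega_open : open Omega)
    (Gamma_finite : (surface_measure Omega (boundary Omega) < +oo)%E)
    (S : R -> L2 (surface_measure Omega) -> L2 (surface_measure Omega))
    (S_generated : generated_by S (opp_graph (@dtn R d Omega))) :
  [<-> trace_unique Omega;
       dim_ker (@dtn R d Omega) 1;
       forall phi : L2 (surface_measure Omega),
         L2dist (surface_measure Omega) (S t phi) (mean_projection phi)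
           @[t --> +oo] --> 0%E;
       irreducible (boundary Omega) S].
Proof.
have d_gt0 : (0 < d)%N by rewrite (ltn_trans _ d_ge2).
have Gamma_gt0 : (0 < surface_measure Omega (boundary Omega))%E.
  rewrite /surface_measure /= /mrestr setIid.
  clear S S_generated Omega_connected Gamma_finite.
  (* Projecting along the first axis requires the dimension in the form [m.+1]; what else depends on
     [d] has been cleared for the case analysis. *)
  case: d d_ge2 d_gt0 Omega Omega_neq0 Omega_bounded Omega_open => // m m_ge2 _ Omega O0 Ob Oo.
  by apply: boundary_hausdorff_gt0.
tfae.
- exact: (trace_unique_dim_ker Omega_neq0 Omega_open Omega_bounded Omega_connected
    Gamma_finite Gamma_gt0).
- exact: (dim_ker_converges Omega_open Omega_bounded Gamma_finite S_generated Gamma_gt0).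
- exact: (converges_irreducible Omega_bounded Gamma_finite Gamma_gt0).
- exact: (irreducible_trace_unique Omega_open Omega_bounded Gamma_finite S_generated d_ge2).
Qed.
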